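(* Let $d>k\geq 1$ be odd integers. Let $p$ be an odd prime such that $p\nmid dk(d-k)$, and let $q=p^r$ with $r\geq 1$. Then, for $x\in\mathbb{F}_q^\times$, $$1+q\cdot{}_{d-1}G_{d-1}\left[\begin{array}{ccccccc}\frac{1}{d},&\frac{2}{d},&\ldots,&\frac{k}{d},&\frac{k+1}{d},&\ldots,&\frac{d-1}{d}\\ 0,&\frac{1}{k},&\ldots,&\frac{k-1}{k},&\frac{1}{d-k},&\ldots,&\frac{d-k-1}{d-k}\end{array}\Big|\,x\right]_q$$ $$=-\sum_{t\in\mathbb{F}_q}\varphi(t(t-1))\;{}_{d-1}G_{d-1}\left[\begin{array}{cccccccccc}\frac{1}{d},&\ldots,&\frac{k}{d},&\frac{k+1}{d},&\ldots,&\frac{k+\frac{d-k}{2}-1}{d},&\frac{k+\frac{d-k}{2}}{d},&\ldots,&\frac{d-2}{d},&\frac{d-1}{d}\\ 0,&\ldots,&\frac{k-1}{k},&\frac{1}{d-k},&\ldots,&\frac{\frac{d-k}{2}-1}{d-k},&\frac{\frac{d-k}{2}+1}{d-k},&\ldots,&\frac{d-k-1}{d-k},&0\end{array}\Big|\,xt\right]_q .$$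
   Context: $\varphi$ is the quadratic character on $\mathbb{F}_q$ (with $\varphi(0)=0$). On both sides the upper parameters are $\frac1d,\ldots,\frac{d-1}{d}$. On the left the lower parameters are $0,\frac1k,\ldots,\frac{k-1}{k}$ followed by $\frac{h}{d-k}$ for $1\le h\le d-k-1$; on the right the lower parameters are $0,\frac1k,\ldots,\frac{k-1}{k}$, followed by $\frac{h}{d-k}$ for $1\le h\le d-k-1$, $h\ne\frac{d-k}{2}$, followed by one additional $0$. Let $\mathbb{Z}_q$ be the ring of integers of the unramified extension of $\mathbb{Q}_p$ with residue field $\mathbb{F}_q$. The $p$-adic gamma function is $\Gamma_p(n)=(-1)^n\prod_{0<j<n,\,p\nmid j}j$ for positive integers $n$, $\Gamma_p(0)=1$, extended continuously to $\mathbb{Z}_p$. Let $\omega:\mathbb{F}_q^\times\to\mathbb{Z}_q^\times$ be the Teichmüller character ($\omega(a)$ is the $(q-1)$-th root of unity in $\mathbb{Z}_q$ congruent to $a$ modulo $p$), $\overline{\omega}=\omega^{-1}$, with $\overline{\omega}^a(0)=0$ for all $a$ (including $a=0$). For $x\in\mathbb{Q}$, $\lfloor x\rfloor$ is the floor and $\langle x\rangle=x-\lfloor x\rfloor$. For an odd prime $p$, $q=p^r$, $t\in\mathbb{F}_q$, and $a_j,b_j\in\mathbb{Q}\cap\mathbb{Z}_p$ $(1\le j\le n)$, McCarthy's $p$-adic hypergeometric function is $${}_nG_n\left[\begin{array}{ccc}a_1,&\ldots,&a_n\\ b_1,&\ldots,&b_n\end{array}\Big|\,t\right]_q=\frac{-1}{q-1}\sum_{a=0}^{q-2}(-1)^{an}\,\overline{\omega}^a(t)\prod_{j=1}^n\prod_{i=0}^{r-1}(-p)^{-\lfloor\langle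 a_jp^i\rangle-\frac{ap^i}{q-1}\rfloor-\lfloor\langle -b_jp^i\rangle+\frac{ap^i}{q-1}\rfloor}\frac{\Gamma_p(\langle(a_j-\frac{a}{q-1})p^i\rangle)}{\Gamma_p(\langle a_jp^i\rangle)}\frac{\Gamma_p(\langle(-b_j+\frac{a}{q-1})p^i\rangle)}{\Gamma_p(\langle -b_jp^i\rangle)}.$$ *)

(* Defs.v *)
From mathcomp Require Import all_boot all_order all_algebra.
From mathcomp Require Import boolp classical_sets.

Set Implicit Arguments.
Unset Strict Implicit.
Unset Printing Implicit Defensive.

Import Order.TTheory GRing.Theory Num.Theory.

Local Open Scope ring_scope.

Definition ppow_dvd (W : idomainType) (p N : nat) (x : W) : Prop :=
  exists z : W, x = p%:R ^+ N * z.

(** [W] is the ring of integers of the unramified extension of Q_p with residue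
    field [F]: a complete discrete valuation ring of characteristic 0 with
    uniformizer p (so the extension is unramified) and residue map [res].
    For [F] finite of characteristic p, these axioms determine [(W, res)] up to
    a unique isomorphism.  The characteristic is 0 because p is nonzero in the
    domain [W] and zero in [F]. *)
Record unramified_integers (p : nat) (F : finFieldType) (W : idomainType)
    (res : {rmorphism W -> F}) : Prop := UnramifiedIntegers {
  unram_p_neq0 : p%:R != 0 :> W;
  unram_res_surj : forall a : F, exists w : W, res w = a;
  unram_res_ker : forall w : W, res w = 0 <-> ppow_dvd p 1 w;
  unram_separated : forall w : W, (forall N : nat, ppow_dvd p N w) -> w = 0;
  unram_complete : forall u : nat -> W,
    (forall N : nat, ppow_dvd p N (u N.+1 - u N)) ->
    exists l : W, forall N : nat, ppow_dvd p N (u N - l)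
}.

(** The formula also gives the value 1 at n = 0. *)
Definition padic_gamma_nat (p n : nat) : int :=
  (-1) ^+ n * \prod_(1 <= j < n | ~~ (p %| j)%N) j%:Z.

(** The extension by continuity: the p-adic limit of [padic_gamma_nat p n] as
    the natural number n tends to [x].  It is only meaningful for [x] in the
    closure Z_p of the natural numbers in [W]. *)
Definition padic_gamma (W : idomainType) (p : nat) (x : W) : W :=
  xget 0 [set y : W | forall N : nat, exists M : nat, forall n : nat,
    ppow_dvd p M (n%:R - x) -> ppow_dvd p N ((padic_gamma_nat p n)%:~R - y)].

Definition teichmuller (F : finFieldType) (W : idomainType)
    (res : {rmorphism W -> F}) (t : F) : W :=
  xget 0 [set w : W | w ^+ #|F|.-1 = 1 /\ res w = t].

(** The value at 0 is 0 also for the trivial character (a = 0). *)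
Definition omegabar (F : finFieldType) (W : idomainType)
    (res : {rmorphism W -> F}) (a : nat) (t : F) : W :=
  if t == 0 then 0 else (teichmuller res t)^-1 ^+ a.

Definition quadratic_char (F : finFieldType) (t : F) : int :=
  if t == 0 then 0 else if [exists s : F, s ^+ 2 == t] then 1 else -1.

Definition frac_part (x : rat) : rat := x - (Num.floor x)%:~R.

(** [Gamma_p] at a rational number whose denominator is prime to p (hence a
    unit of [W]), as an element of the fraction field of [W]. *)
Definition gamma_rat (W : idomainType) (p : nat) (x : rat) : {fraction W} :=
  tofrac (padic_gamma p (ratr x : W)).

Definition mccarthy_factor (W : idomainType) (p r : nat) (aj bj : rat)
    (a i : nat) : {fraction W} :=
  let P : rat := (p ^ i)%N%:R in
  let s : rat := a%:R / ((p ^ r)%N%:R - 1) in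
  (- p%:R) ^ (- Num.floor (frac_part (aj * P) - s * P)
              - Num.floor (frac_part (- bj * P) + s * P))
  * (gamma_rat W p (frac_part ((aj - s) * P))
     / gamma_rat W p (frac_part (aj * P)))
  * (gamma_rat W p (frac_part ((- bj + s) * P))
     / gamma_rat W p (frac_part (- bj * P))).

(** Here #|F| = p ^ r; the parameters are the first [n] entries of [A] (upper)
    and [B] (lower).  The value lies in the fraction field Q_q of [W], because
    the powers of [-p] may have negative exponents. *)
Definition mccarthyG (F : finFieldType) (W : idomainType)
    (res : {rmorphism W -> F}) (p r n : nat) (A B : seq rat) (t : F) :
    {fraction W} :=
  - 1 / ((p ^ r)%N%:R - 1) *
  \sum_(0 <= a < (p ^ r)%N.-1)
    (-1) ^+ (a * n) * tofrac (omegabar res a t) *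
    \prod_(j < n) \prod_(i < r) mccarthy_factor W p r A`_j B`_j a i.

Definition upper_params (d : nat) : seq rat :=
  [seq h%:R / d%:R | h <- iota 1 d.-1].

Definition lower_params_left (d k : nat) : seq rat :=
  [seq h%:R / k%:R | h <- iota 0 k]
  ++ [seq h%:R / (d - k)%N%:R | h <- iota 1 (d - k).-1].

Definition lower_params_right (d k : nat) : seq rat :=
  [seq h%:R / k%:R | h <- iota 0 k]
  ++ [seq h%:R / (d - k)%N%:R | h <- iota 1 (d - k).-1 & h != (d - k)./2]
  ++ [:: 0].

(* Main.v *)
Require Import Defs.
From mathcomp Require Import all_boot all_order all_algebra cyclic finfield.
From mathcomp Require Import boolp classical_sets.
From mathcomp Require Import zify ring lra.

Set Implicit Arguments.
Unset Strict Implicit.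
Unset Printing Implicit Defensive.

Import Order.TTheory GRing.Theory Num.Theory.

Local Open Scope ring_scope.

(** Let q = p^r, let T be the Teichmüller character and φ the quadratic character.
    The signs (-1)^(a (d-1)) are 1 because d is odd, and the two functions G differ
    only in one lower parameter: the entry 1/2 on the left, obtained for
    h = (d - k)/2, is 0 on the right. Exchanging the sums over t and a on the right
    replaces φ(t (t-1)) by the Jacobi sums
      J(a) = sum of φ(t (t-1)) T(t)^(-a) = sum over t <> 0 of φ(1 - t) T(t)^a.
    Comparing the coefficients of T(x)^(-a), the theorem becomes
      J(a) (factors at 0) = - q (factors at 1/2)   for 0 < a < q - 1
    ([jacobi_lower_factors]), together with J(0) = -1 ([jacobi_sum0]).

    The former is the Gross-Koblitz formula for J(a) ([jacobi_gamma]): if s_i is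
    the fractional part of a p^i / (q - 1), δ_i = 1 or 0 according to whether
    s_i < 1/2 or not, and σ_i = s_i - 1/2 + δ_i, then, over all i < r,
      J(a) prod Gamma_p(1/2) Gamma_p(s_i) = - prod (- (-p)^δ_i Gamma_p(σ_i)).
    It is proved here without Gauss sums. Let b = q - 1 - a and
    rho = (1 - X^q) / (1 - X). As rho is (1 - X)^(q-1) modulo p, the power of rho
    with exponent approximately M + 1/2 gives, modulo p^M, a polynomial with values
    φ(1 - t) at the points T(t) ([geom_poly_exp_cong], [hpoly_teichmuller]), so
    that J(a) is q - 1 times a sum of coefficients of this power, at the exponents
    (q-1) i + b ([sum_teichmuller_horner], [coef_hpoly]). Expanding
    (1 - X^q)^K (1 - X)^(-K) and summing the resulting truncated convolutions in
    closed form ([truncated_convolution], [coef_trace]) leaves a Lagrange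
    interpolation sum over the nodes n = 0, ..., M, with values
      R(n) = w(q n + b) / w(n),   where w(n) = (1/2) (3/2) ... (n - 1/2) / n!
    ([trace_term_cong]).

    The function R extends continuously to Z_p: its forward differences have
    high valuation, because the product of p consecutive factors without the
    multiple of p is the value of a polynomial congruent to X^(p-1) - 1 modulo p
    ([block_poly_res], [ratio_exists]). So R has a convergent Newton series
    ([newton_series]), and a computation of residues shows that the interpolation
    sum is - R(x) at the fixed point x = - b / (q - 1) of n -> q n + b
    ([trace_evaluation], [jacobi_ratio]). Near this point are natural numbers n_0
    that lead, by successively appending the digits of b in base p, to numbers n_i
    close to s_i - 1. Along these, R(n_0) telescopes into rising
    factorials without their multiples of p ([poch_split], [orbit_ratio]), and
    these are quotients of values of Gamma_p ([padic_gamma_unit_poch]). *)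

(** * Congruences modulo powers of p *)

Section PowerDivisibility.
Variables (R : idomainType) (p : nat).
Implicit Types (x y z : R) (N M : nat).
Local Notation pdiv_by := (@ppow_dvd R p).

Lemma ppow_dvdP N z : pdiv_by N (p%:R ^+ N * z).
Proof. by exists z. Qed.

Lemma ppow_dvd0 N : pdiv_by N 0.
Proof. by exists 0; rewrite mulr0. Qed.

Lemma ppow_dvd_any x : pdiv_by 0 x.
Proof. by exists x; rewrite expr0 mul1r. Qed.

Lemma ppow_dvdD N x y : pdiv_by N x -> pdiv_by N y -> pdiv_by N (x + y).
Proof. by case=> u -> [v ->]; exists (u + v); rewrite mulrDr. Qed.

Lemma ppow_dvdN N x : pdiv_by N x -> pdiv_by N (- x).
Proof. by case=> u ->; exists (- u); rewrite mulrN. Qed.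

Lemma ppow_dvdMl N x y : pdiv_by N y -> pdiv_by N (x * y).
Proof. by case=> u ->; exists (x * u); rewrite mulrCA. Qed.

Lemma ppow_dvdMr N x y : pdiv_by N x -> pdiv_by N (x * y).
Proof. by rewrite mulrC; apply: ppow_dvdMl. Qed.

Lemma ppow_dvdM N M x y : pdiv_by N x -> pdiv_by M y -> pdiv_by (N + M) (x * y).
Proof. by case=> u -> [v ->]; exists (u * v); rewrite exprD mulrACA. Qed.

Lemma ppow_dvdW N M x : (N <= M)%N -> pdiv_by M x -> pdiv_by N x.
Proof.
by move=> le [u ->]; exists (p%:R ^+ (M - N) * u); rewrite mulrA -exprD subnKC.
Qed.

Lemma ppow_dvd_sum N (I : Type) (s : seq I) (P : pred I) (f : I -> R) :
  (forall i, P i -> pdiv_by N (f i)) -> pdiv_by N (\sum_(i <- s | P i) f i).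
Proof.
by move=> h; elim/big_ind: _ => //; [exact: ppow_dvd0 | move=> *; exact: ppow_dvdD].
Qed.

Lemma ppow_dvd_nat N n : (p ^ N %| n)%N -> pdiv_by N n%:R.
Proof.
by case/dvdnP=> m ->; exists m%:R; rewrite natrM natrX mulrC.
Qed.

Definition pcong N x y := pdiv_by N (x - y).

Lemma pcong_refl N x : pcong N x x.
Proof. by rewrite /pcong subrr; apply: ppow_dvd0. Qed.

Lemma pcong_sym N x y : pcong N x y -> pcong N y x.
Proof. by move/ppow_dvdN; rewrite /pcong opprB. Qed.

Lemma pcong_trans N y x z : pcong N x y -> pcong N y z -> pcong N x z.
Proof.
by move=> h1 h2; rewrite /pcong -(subrKA y); apply: ppow_dvdD.
Qed.

Lemma pcongW N M x y : (N <= M)%N -> pcong M x y -> pcong N x y.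
Proof. exact: ppow_dvdW. Qed.

Lemma pcong0 x y : pcong 0 x y.
Proof. exact: ppow_dvd_any. Qed.

Lemma pcongD N x y z t : pcong N x y -> pcong N z t -> pcong N (x + z) (y + t).
Proof.
by move=> h1 h2; rewrite /pcong opprD addrACA; apply: ppow_dvdD.
Qed.

Lemma pcongN N x y : pcong N x y -> pcong N (- x) (- y).
Proof. by move=> h; rewrite /pcong -opprD; apply: ppow_dvdN. Qed.

Lemma pcongM N x y z t : pcong N x y -> pcong N z t -> pcong N (x * z) (y * t).
Proof.
move=> h1 h2; apply: (@pcong_trans _ (x * t)).
  by rewrite /pcong -mulrBr; apply: ppow_dvdMl.
by rewrite /pcong -mulrBl; apply: ppow_dvdMr.
Qed.

Lemma pcongMl N x y z : pcong N y z -> pcong N (x * y) (x * z).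
Proof. by apply: pcongM; apply: pcong_refl. Qed.

Lemma pcongMr N x y z : pcong N x y -> pcong N (x * z) (y * z).
Proof. by move=> h; apply: pcongM => //; apply: pcong_refl. Qed.

Lemma pcongX N n x y : pcong N x y -> pcong N (x ^+ n) (y ^+ n).
Proof.
by move=> h; elim: n => [|n IH]; [exact: pcong_refl | rewrite !exprS; apply: pcongM].
Qed.

Lemma pcong_sum N (I : Type) (s : seq I) (P : pred I) (f g : I -> R) :
  (forall i, P i -> pcong N (f i) (g i)) ->
  pcong N (\sum_(i <- s | P i) f i) (\sum_(i <- s | P i) g i).
Proof.
by move=> h; elim/big_ind2: _ => //; [exact: pcong_refl | move=> *; exact: pcongD].
Qed.

Lemma pcong_prod N (I : Type) (s : seq I) (P : pred I) (f g : I -> R) :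
  (forall i, P i -> pcong N (f i) (g i)) ->
  pcong N (\prod_(i <- s | P i) f i) (\prod_(i <- s | P i) g i).
Proof.
by move=> h; elim/big_ind2: _ => //; [exact: pcong_refl | move=> *; exact: pcongM].
Qed.

Lemma pcong_nat N m n : m = n %[mod p ^ N] -> pcong N m%:R n%:R.
Proof.
move=> e; wlog le_mn : m n e / (n <= m)%N => [hw|].
  by case/orP: (leq_total n m) => h; [apply: hw | apply/pcong_sym/hw].
rewrite /pcong -natrB //; apply: ppow_dvd_nat.
by rewrite -eqn_mod_dvd //; apply/eqP.
Qed.

(** (y + p^N z)^p = y^p + p (p^N z) y^(p-1) + ..., where N >= 1 makes the later
    terms small. *)
Lemma pcongXp N x y : prime p -> (0 < N)%N -> pcong N x y -> pcong N.+1 (x ^+ p) (y ^+ p).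
Proof.
move=> pr N0 [z e]; have -> : x = y + p%:R ^+ N * z by rewrite -e addrC subrK.
rewrite /pcong exprDn big_ord_recl /= subn0 mulr1 bin0 mulr1n addrC addKr.
apply: ppow_dvd_sum => i _; rewrite /bump leq0n add1n.
rewrite -mulr_natl exprMn; have [ip|] := ltnP i.+1 p.
  rewrite -add1n; apply: ppow_dvdM.
    by apply: ppow_dvd_nat; rewrite expn1 prime_dvd_bin.
  by apply: ppow_dvdMl; rewrite exprS -!mulrA; apply: ppow_dvdP.
move=> pi; do 2!apply: ppow_dvdMl; rewrite -exprM; apply: ppow_dvdMr.
apply: (@ppow_dvdW _ (N * i.+1)); last by exists 1; rewrite mulr1.
have := prime_gt1 pr; nia.
Qed.

Lemma pcongXpn N n x y : prime p -> (0 < N)%N -> pcong N x y ->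
  pcong (N + n) (x ^+ (p ^ n)) (y ^+ (p ^ n)).
Proof.
move=> pr N0 h; elim: n => [|n IH]; first by rewrite addn0 expn0 !expr1.
by rewrite addnS expnSr !exprM; apply: pcongXp => //; rewrite addn_gt0 N0.
Qed.

End PowerDivisibility.

(** * The ring of integers of an unramified extension *)

Section Unramified.
Variables (p : nat) (F : finFieldType) (W : idomainType) (res : {rmorphism W -> F}).
Hypothesis p_prime : prime p.
Hypothesis U : unramified_integers p res.
Implicit Types (x y z : W) (N M n : nat).

Let p_neq0 : p%:R != 0 :> W := unram_p_neq0 U.

Lemma res_eq0 x : res x = 0 <-> ppow_dvd p 1 x.
Proof. exact: unram_res_ker U x. Qed.

Lemma res_p : p%:R = 0 :> F.
Proof.
by rewrite -(rmorph_nat res); apply/res_eq0; exists 1; rewrite mulr1 expr1.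
Qed.

Lemma res_eq_pcong x y : res x = res y <-> pcong p 1 x y.
Proof.
rewrite /pcong -res_eq0 rmorphB; split=> [->|/eqP]; first by rewrite subrr.
by rewrite subr_eq0 => /eqP.
Qed.

Lemma eq_ppow x : (forall N, ppow_dvd p N x) -> x = 0.
Proof. exact: unram_separated U x. Qed.

Lemma eq_pcong x y : (forall N, pcong p N x y) -> x = y.
Proof. by move=> h; apply/eqP; rewrite -subr_eq0; apply/eqP/eq_ppow. Qed.

Lemma ppow_dvd_cancel N M x : ppow_dvd p (N + M) (p%:R ^+ M * x) -> ppow_dvd p N x.
Proof.
case=> z; rewrite addnC exprD -mulrA => /mulfI e; exists z; apply: e.
exact: expf_neq0.
Qed.

(** The inverse of 1 - p z is the sum of the geometric series. *)
Lemma unit_res x : res x != 0 -> x \is a GRing.unit.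
Proof.
move=> rx; have [y ey] := unram_res_surj U (res x)^-1.
have : ppow_dvd p 1 (1 - x * y).
  by apply/res_eq0; rewrite rmorphB rmorph1 rmorphM /= ey mulfV // subrr.
case=> z; rewrite expr1 => ez.
pose u N := \sum_(i < N) (p%:R * z) ^+ i.
have [|l hl] := unram_complete U (u := u).
  by move=> N; rewrite /u big_ord_recr /= addrAC subrr add0r exprMn; apply: ppow_dvdP.
suff e1 : (x * y) * l = 1 by apply/unitrPr; exists (y * l); rewrite mulrA.
have exy : x * y = 1 - p%:R * z by rewrite -ez subKr.
apply: eq_pcong => N; apply: (@pcong_trans _ _ _ (x * y * u N)).
  by apply: pcongMl; apply: pcong_sym; apply: hl.
have -> : x * y * u N = 1 - (p%:R * z) ^+ N.
  by rewrite exy /u -opprB mulNr -subrX1 opprB.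
rewrite /pcong addrAC subrr add0r exprMn -mulrN.
exact: ppow_dvdP.
Qed.

Lemma natF_neq0 n : ~~ (p %| n)%N -> n%:R != 0 :> F.
Proof.
move=> pn; apply/eqP => e.
have co : coprime n p by rewrite coprime_sym prime_coprime.
have n0 : (0 < n)%N by case: n pn {e co} => //; rewrite dvdn0.
have [u v eq _] := egcdnP p n0.
have := congr1 (fun k => k%:R : F) eq.
by rewrite natrD !natrM res_p e !mulr0 (eqP co) add0r => /eqP; rewrite eq_sym oner_eq0.
Qed.

Lemma unit_nat n : ~~ (p %| n)%N -> n%:R \is a @GRing.unit W.
Proof. by move=> pn; apply: unit_res; rewrite rmorph_nat natF_neq0. Qed.

Lemma ppow_dvd1_nat n : ppow_dvd p 1 (n%:R : W) <-> (p %| n)%N.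
Proof.
rewrite -res_eq0 rmorph_nat; split=> [e|/dvdnP[m ->]]; last first.
  by rewrite natrM res_p mulr0.
by apply: contraT => /natF_neq0; rewrite e eqxx.
Qed.

Lemma ppow_dvd_unit N x y : x \is a GRing.unit ->
  ppow_dvd p N (x * y) -> ppow_dvd p N y.
Proof. by move=> ux h; rewrite -(mulKr ux y); apply: ppow_dvdMl. Qed.

Lemma natW_partE n : (0 < n)%N ->
  exists2 u : W, u \is a GRing.unit & n%:R = p%:R ^+ logn p n * u.
Proof.
move=> n0; have [m co e] := pfactor_coprime p_prime n0.
exists m%:R; last by rewrite {1}e natrM natrX mulrC.
by apply: unit_nat; rewrite -prime_coprime.
Qed.

Lemma natW_neq0 n : (0 < n)%N -> n%:R != 0 :> W.
Proof.
case/natW_partE=> u uu ->; rewrite mulf_neq0 ?expf_neq0 //.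
by apply: contraTneq uu => ->; rewrite unitr0.
Qed.

Lemma ppow_dvd_natM N n x : (0 < n)%N ->
  ppow_dvd p (N + logn p n) (n%:R * x) -> ppow_dvd p N x.
Proof.
case/natW_partE=> u uu {1}->; rewrite -mulrA => /ppow_dvd_cancel.
exact: ppow_dvd_unit.
Qed.

End Unramified.

(** * Teichmüller representatives and the quadratic character *)

Lemma finField_generator (F : finFieldType) :
  exists g : F, #|F|.-1.-primitive_root g.
Proof.
have c1 := card_finRing_gt1 F.
pose rs := filter (predC1 0) (enum F).
have [||||g _] := @hasP _ _ _ (@has_prim_root F #|F|.-1 rs _ _ _ _).
- by rewrite -subn1 subn_gt0.
- apply/allP=> x; rewrite mem_filter /= => /andP[x0 _].
  by rewrite unity_rootE -(inj_eq (mulfI x0)) -exprS prednK ?expf_card ?mulr1 // ltnW.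
- by rewrite filter_uniq ?enum_uniq.
- rewrite size_filter -[leqRHS](addKn (count_mem 0 (enum F))).
  rewrite count_predC count_uniq_mem ?enum_uniq // mem_enum /=.
  by rewrite -cardE subn1.
by exists g.
Qed.

Lemma expf_pred_card (F : finFieldType) (t : F) : t != 0 -> t ^+ #|F|.-1 = 1.
Proof.
move=> t0; apply: (mulfI t0); rewrite -exprS prednK ?expf_card ?mulr1 //.
by apply: ltnW; apply: card_finRing_gt1.
Qed.

Section QuadraticCharacter.
Variable F : finFieldType.
Hypothesis card_odd : odd #|F|.

Let h := #|F|.-1./2.
Let hE : #|F|.-1 = (h * 2)%N.
Proof.
by rewrite /h -[LHS]odd_double_half -muln2; case: #|F| card_odd => //= n /negPf ->.
Qed.

Let h_gt0 : (0 < h)%N.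
Proof.
have: (0 < #|F|.-1)%N by rewrite -subn1 subn_gt0 card_finRing_gt1.
by rewrite hE muln_gt0 => /andP[].
Qed.

(** Euler's criterion: if t = g^i for a generator g, then t^h = 1 forces i to be
    even. *)
Lemma quadratic_charE (t : F) : (quadratic_char t)%:~R = t ^+ h.
Proof.
rewrite /quadratic_char; have [->|t0] := eqVneq t 0.
  by rewrite expr0n -[_ == _]/(h == 0)%N; case: (h) h_gt0.
case: existsP => [[s /eqP es]|ns].
  have s0 : s != 0 by apply: contraNneq t0 => s0; rewrite -es s0 expr0n.
  by rewrite -es -exprM mulnC -hE expf_pred_card.
have [g pg] := finField_generator F.
have [i ti] : exists i : nat, t = g ^+ i.
  by have /(prim_rootP pg)[i ->] := expf_pred_card t0; exists i.
have sq : (t ^+ h) ^+ 2 = 1 by rewrite -exprM -hE expf_pred_card.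
move/eqP: sq; rewrite sqrf_eq1 => /orP[/eqP e|/eqP -> //].
move: e; rewrite {1}ti -exprM => /eqP; rewrite -(prim_order_dvd pg) hE mulnC.
rewrite dvdn_pmul2r // => /dvdnP[j ij]; case: ns; exists (g ^+ j).
by rewrite -exprM -ij ti.
Qed.

Lemma quadratic_char_sqM (s t : F) : s != 0 ->
  quadratic_char (s ^+ 2 * t) = quadratic_char t.
Proof.
move=> s0; rewrite /quadratic_char mulf_eq0 expf_eq0 (negPf s0) /=.
case: eqP => // _; congr (if _ then _ else _).
apply/existsP/existsP=> -[u /eqP e]; last by exists (s * u); rewrite exprMn e.
by exists (u / s); rewrite exprMn e exprVn mulrAC mulfV ?mul1r // expf_neq0.
Qed.

End QuadraticCharacter.

Section Teichmuller.
Variables (p r : nat) (F : finFieldType) (W : idomainType) (res : {rmorphism W -> F}).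
Hypothesis p_prime : prime p.
Hypothesis r_gt0 : (0 < r)%N.
Hypothesis cardF : #|F| = (p ^ r)%N.
Hypothesis U : unramified_integers p res.

Let q := (p ^ r)%N.

Let q_gt1 : (1 < q)%N.
Proof. by rewrite /q -cardF card_finRing_gt1. Qed.

Lemma pcong_expq N n (x y : W) : (0 < N)%N -> pcong p N x y ->
  pcong p (N + n) (x ^+ (q ^ n)) (y ^+ (q ^ n)).
Proof.
move=> N0 h; rewrite /q -expnM; apply: (@pcongW _ _ _ (N + r * n)).
  by rewrite leq_add2l; nia.
exact: pcongXpn.
Qed.

(** The representative is the limit of w^(q^N), for any lift w. *)
Lemma teichmuller_exists (t : F) : t != 0 ->
  exists w : W, w ^+ #|F|.-1 = 1 /\ res w = t.
Proof.
move=> t0; have [w0 ew0] := unram_res_surj U t.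
have step : pcong p 1 (w0 ^+ q) w0.
  by apply/(res_eq_pcong U); rewrite rmorphXn /= ew0 /q -cardF expf_card.
pose u N := w0 ^+ (q ^ N).
have uS N : u N.+1 = u N ^+ q by rewrite /u expnSr exprM.
have [|l hl] := unram_complete U (u := u).
  move=> N; rewrite /u expnS exprM; apply: (ppow_dvdW (leqnSn N)).
  by rewrite -add1n; apply: pcong_expq.
have lq : l ^+ q = l.
  apply: (eq_pcong U) => N; apply: (@pcong_trans _ _ _ (u N.+1)).
    by rewrite uS; apply/pcongX/pcong_sym/hl.
  by apply: pcongW (hl N.+1).
have rl : res l = t.
  have /(res_eq_pcong U) <- : pcong p 1 (u 1) l by apply: hl.
  by rewrite /u expn1 rmorphXn /= ew0 /q -cardF expf_card.
exists l; split=> //; have l0 : l != 0.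
  by apply: contra_neq t0 => l0; rewrite -rl l0 rmorph0.
by apply: (mulfI l0); rewrite -exprS prednK cardF ?lq ?mulr1 // ltnW.
Qed.

Local Notation T := (teichmuller res).

Lemma teichmullerP (t : F) : t != 0 -> T t ^+ #|F|.-1 = 1 /\ res (T t) = t.
Proof.
move=> t0; rewrite /teichmuller; case: xgetP => [w _ //|no].
by have [w hw] := teichmuller_exists t0; case: (no w).
Qed.

Lemma teichmuller_exp (t : F) : t != 0 -> T t ^+ q.-1 = 1.
Proof. by case/teichmullerP; rewrite cardF. Qed.

Lemma teichmuller_res (t : F) : t != 0 -> res (T t) = t.
Proof. by case/teichmullerP. Qed.

(** Both roots are fixed by q-th powers, and each q-th power gains a digit of
    agreement. *)
Lemma root_unity_inj (x y : W) :
  x ^+ q.-1 = 1 -> y ^+ q.-1 = 1 -> res x = res y -> x = y.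
Proof.
move=> ex ey e; apply: (eq_pcong U) => N.
have fixq (z : W) : z ^+ q.-1 = 1 -> z ^+ (q ^ N) = z.
  move=> ez; elim: N => [|N IH]; first by rewrite expn0 expr1.
  by rewrite expnSr exprM IH -[in z ^+ q](prednK (ltnW q_gt1)) exprS ez mulr1.
rewrite -(fixq x ex) -(fixq y ey); apply: (@pcongW _ _ _ (1 + N)); first by rewrite leq_addl.
by apply: pcong_expq => //; apply/(res_eq_pcong U).
Qed.

Lemma teichmullerE (t : F) (w : W) : t != 0 -> w ^+ q.-1 = 1 -> res w = t -> T t = w.
Proof.
move=> t0 ew rw; apply: root_unity_inj; rewrite ?teichmuller_exp //.
by rewrite teichmuller_res.
Qed.

Lemma teichmullerM (s t : F) : s != 0 -> t != 0 -> T (s * t) = T s * T t.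
Proof.
move=> s0 t0; apply: teichmullerE; first by rewrite mulf_neq0.
  by rewrite exprMn !teichmuller_exp // mulr1.
by rewrite rmorphM /= !teichmuller_res.
Qed.

Lemma teichmuller1 : T 1 = 1.
Proof. by apply: teichmullerE; rewrite ?oner_eq0 ?expr1n ?rmorph1. Qed.

Lemma teichmuller_unit (t : F) : t != 0 -> T t \is a GRing.unit.
Proof.
by move=> t0; apply: (unit_res U); rewrite teichmuller_res.
Qed.

Lemma teichmullerV (t : F) : t != 0 -> T t^-1 = (T t)^-1.
Proof.
move=> t0; apply: (mulrI (teichmuller_unit t0)).
by rewrite mulrV ?teichmuller_unit // -teichmullerM ?invr_neq0 // mulfV // teichmuller1.
Qed.

(** Multiplication by T g ^+ n, for a generator g, permutes the terms; the sum
    vanishes when T g ^+ n is not 1. *)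
Lemma sum_teichmuller_exp n :
  \sum_(t : F | t != 0) T t ^+ n = if (q.-1 %| n)%N then q.-1%:R else 0.
Proof.
case: ifP => [/dvdnP[m ->]|nd].
  rewrite (eq_bigr (fun=> 1)) => [|t t0]; last first.
    by rewrite mulnC exprM teichmuller_exp // expr1n.
  rewrite sumr_const; congr (_ *+ _).
  by rewrite /q -cardF -(cardC1 (0 : F)); apply: eq_card.
have [g pg] := finField_generator F; rewrite cardF -/q in pg.
have g0 : g != 0.
  apply/eqP=> g0; have /eqP := prim_expr_order pg.
  by rewrite g0 expr0n eqn0Ngt (prim_order_gt0 pg) /= eq_sym oner_eq0.
set S := \sum_(_ | _) _.
have e : T g ^+ n * S = S.
  rewrite {2}/S (reindex_inj (mulfI g0)) mulr_sumr.
  apply: eq_big => [t|t t0]; first by rewrite mulf_eq0 (negPf g0).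
  by rewrite teichmullerM // exprMn.
apply/eqP; move/eqP: e; rewrite -subr_eq0 -{2}(mul1r S) -mulrBl mulf_eq0.
case/orP=> //; rewrite subr_eq0 => /eqP e.
have := congr1 res e; rewrite rmorphXn rmorph1 /= teichmuller_res // => /eqP.
by rewrite -(prim_order_dvd pg) nd.
Qed.

End Teichmuller.

(** * The p-adic gamma function *)

Section Wilson.
Variable p : nat.
Hypothesis p_prime : prime p.
Hypothesis p_odd : odd p.

(** This is (-1)^n Gamma_p(n); the factor j = 0 is left out as a multiple of p. *)
Definition pfree_fact n := (\prod_(0 <= j < n | ~~ (p %| j)%N) j)%N.

Lemma pfree_fact0 : pfree_fact 0 = 1%N.
Proof. by rewrite /pfree_fact big_geq. Qed.

Lemma pfree_factS n :
  pfree_fact n.+1 = (pfree_fact n * if (p %| n)%N then 1 else n)%N.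
Proof.
by rewrite /pfree_fact !(big_mkcond (fun j => ~~ _)) big_nat_recr //=; case: (p %| n)%N.
Qed.

Lemma pfree_factD n m : (p %| m)%N ->
  pfree_fact (n + m) = pfree_fact n * pfree_fact m %[mod m].
Proof.
move=> pm; elim: n => [|n IH]; first by rewrite add0n pfree_fact0 mul1n.
rewrite addSn !pfree_factS (dvdn_addl _ pm) -modnMml IH modnMml.
case: ifP => _; first by rewrite !muln1.
by rewrite -modnMmr modnDr modnMmr mulnAC.
Qed.

(** Inversion permutes the units modulo m, so their product is its own inverse. *)
Lemma pfree_fact_sqr m : (1 < m)%N -> (forall j, (p %| j)%N = ~~ coprime m j) ->
  pfree_fact m * pfree_fact m = 1 %[mod m].
Proof.
move=> m1 h; have em : (Zp_trunc m).+2 = m by apply: Zp_cast.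
have e : (pfree_fact m)%:R = \prod_(x : 'Z_m | x \is a GRing.unit) x.
  have ordE (R : nzRingType) : (pfree_fact m)%:R =
      \prod_(i < (Zp_trunc m).+2 | ~~ (p %| i)%N) (i : nat)%:R :> R.
    by rewrite em /pfree_fact big_mkord natr_prod.
  rewrite ordE; apply: eq_big => [i|i _]; last by rewrite natr_Zp.
  by rewrite h negbK -[in RHS](natr_Zp i) unitZpE.
have e1 : (pfree_fact m * pfree_fact m)%:R = 1 :> 'Z_m.
  rewrite natrM {1}e e [X in _ * X](reindex_inj invr_inj) /=.
  rewrite [X in _ * X](eq_bigl (fun x : 'Z_m => x \is a GRing.unit)); last first.
    by move=> x; rewrite unitrV.
  by rewrite -big_split /= big1 // => x ux; rewrite mulrV.
have := congr1 val e1; rewrite /= val_Zp_nat // => ->.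
by rewrite em.
Qed.

Lemma pfree_fact_p : pfree_fact p = p.-1`!.
Proof.
rewrite /pfree_fact fact_prod big_mkcond /= -[in LHS](prednK (prime_gt0 p_prime)).
rewrite big_nat_recl //= mul1n [RHS]big_add1 /=.
apply: eq_big_nat => i /andP[_ ip]; case: ifP => // /negbFE /(dvdn_leq (ltn0Sn i)).
by rewrite ltnNge in ip; rewrite ltnS (negPf ip).
Qed.

(** Modulo p the product consists of p^(N-1) blocks (p - 1)! = -1, an odd number
    of them. *)
Lemma pfree_fact_ppow_modp N : (p %| (pfree_fact (p ^ N)).+1)%N || (N == 0).
Proof.
have chp := pchar_Fp p_prime; case: N => [|N]; rewrite ?orbT //= orbF.
have nat_mod m n : m = n %[mod p] -> m%:R = n%:R :> 'F_p.
  by move=> e; rewrite -(Fp_nat_mod p_prime m) e Fp_nat_mod.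
have e1 : p.-1`!%:R = -1 :> 'F_p.
  apply/eqP; rewrite -addr_eq0 natr1 -(dvdn_pcharf chp).
  by rewrite -Wilson ?prime_gt1.
have mulp k : (pfree_fact (p * k))%:R = (-1) ^+ k :> 'F_p.
  elim: k => [|k IH]; first by rewrite muln0 pfree_fact0.
  rewrite mulnS addnC (nat_mod _ _ (pfree_factD _ (dvdnn p))) natrM IH exprSr.
  by rewrite pfree_fact_p e1.
rewrite (dvdn_pcharf chp) -natr1 expnS mulp -signr_odd oddX p_odd orbT.
by rewrite expr1 addrC subrr.
Qed.

Lemma ppow_noncoprime N j : (p %| j)%N = ~~ coprime (p ^ N.+1) j.
Proof. by rewrite coprime_pexpl // prime_coprime // negbK. Qed.

(** Wilson's theorem for p^N: the product P of the units satisfies P^2 = 1, so p^N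
    divides (P - 1)(P + 1), and p does not divide P - 1 since P = -1 modulo p. *)
Lemma pfree_fact_ppow N : (p ^ N %| (pfree_fact (p ^ N)).+1)%N.
Proof.
case: N => [|N]; first by rewrite expn0 dvd1n.
set m := (p ^ N.+1)%N; set P := pfree_fact m.
have m1 : (1 < m)%N by rewrite -(exp1n N.+1) ltn_exp2r ?prime_gt1.
have Pp : (p %| P.+1)%N by have := pfree_fact_ppow_modp N.+1; rewrite orbF.
have P0 : (0 < P)%N by rewrite prodn_cond_gt0 // => -[|j] //; rewrite dvdn0.
have : (m %| P.+1 * P.-1)%N.
  have -> : (P.+1 * P.-1 = P * P - 1)%N by case: (P) P0 => // n _ /=; nia.
  rewrite -eqn_mod_dvd ?muln_gt0 ?P0 //; apply/eqP/pfree_fact_sqr => // j.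
  exact: ppow_noncoprime.
rewrite Gauss_dvdl // coprime_pexpl // prime_coprime //.
apply/negP=> Pm; have := dvdn_sub Pp Pm.
have -> : (P.+1 - P.-1 = 2)%N by lia.
by move/(dvdn_leq (isT : 0 < 2)%N); case: (p) p_prime p_odd => [|[|[|]]].
Qed.

End Wilson.

Section PadicGamma.
Variables (p : nat) (F : finFieldType) (W : idomainType) (res : {rmorphism W -> F}).
Hypothesis p_prime : prime p.
Hypothesis p_odd : odd p.
Hypothesis U : unramified_integers p res.
Implicit Types (x y : W) (N m n : nat).

Lemma gamma_natE n :
  (padic_gamma_nat p n)%:~R = (-1) ^+ n * (pfree_fact p n)%:R :> W.
Proof.
rewrite /padic_gamma_nat rmorphM rmorphXn rmorphN rmorph1 /=; congr (_ * _).
rewrite rmorph_prod /= /pfree_fact natr_prod; case: n => [|n]; first by rewrite !big_geq.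
rewrite [RHS]big_mkcond /= [RHS]big_ltn // dvdn0 mul1r -big_mkcond /=.
by apply: eq_bigr => j _; rewrite -pmulrn.
Qed.

(** A shift by p^N multiplies the product by -1 (Wilson's theorem), and the sign
    (-1)^n by (-1)^(p^N) = -1. *)
Lemma gamma_nat_periodic N n k :
  pcong p N ((padic_gamma_nat p (n + k * p ^ N))%:~R : W) (padic_gamma_nat p n)%:~R.
Proof.
case: N => [|N]; first exact: pcong0.
elim: k => [|k IH]; first by rewrite mul0n addn0; apply: pcong_refl.
apply: pcong_trans IH; rewrite mulSn addnCA addnC; set n' := (n + _)%N.
have sgn : (-1) ^+ (p ^ N.+1) = -1 :> W by rewrite -signr_odd oddX p_odd orbT expr1.
rewrite !gamma_natE exprD sgn mulrN1 mulNr -mulrN; apply: pcongMl.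
apply: (@pcong_trans _ _ _ (- (pfree_fact p n' * pfree_fact p (p ^ N.+1))%:R)).
  by apply/pcongN/pcong_nat/pfree_factD; rewrite expnS dvdn_mulr.
rewrite natrM -mulrN -[X in pcong _ _ _ X]mulr1; apply: pcongMl.
rewrite /pcong -opprD; apply: ppow_dvdN; rewrite natr1.
by apply/ppow_dvd_nat/pfree_fact_ppow.
Qed.

Lemma ppow_dvd_natW N k : ppow_dvd p N (k%:R : W) -> (p ^ N %| k)%N.
Proof.
case: k => [|k]; first by rewrite dvdn0.
have [u uu e] := natW_partE p_prime U (ltn0Sn k); rewrite pfactor_dvdn // leqNgt.
move=> hd; apply/negP=> lt; move: hd; rewrite e.
rewrite -(subnK lt) addnS -addSn => /(ppow_dvd_cancel U) hd.
have /(res_eq0 U) ru : ppow_dvd p 1 u by apply: ppow_dvdW hd.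
by have := rmorph_unit res uu; rewrite ru unitr0.
Qed.

Lemma gamma_nat_cong N m n : pcong p N (m%:R : W) n%:R ->
  pcong p N ((padic_gamma_nat p m)%:~R : W) (padic_gamma_nat p n)%:~R.
Proof.
wlog le_nm : m n / (n <= m)%N => [hw|].
  by case/orP: (leq_total n m) => le h; [apply: hw | apply/pcong_sym/hw/pcong_sym].
rewrite /pcong -natrB // => /ppow_dvd_natW /dvdnP[k e].
by rewrite -(subnK le_nm) e addnC; apply: gamma_nat_periodic.
Qed.

(** Membership in Z_p, the closure of the natural numbers. *)
Definition zp x := forall N, exists n : nat, pcong p N n%:R x.

(** The values at natural numbers approaching x form a Cauchy sequence, whose
    limit satisfies the condition that defines [padic_gamma] and is the only one
    to do so. *)
Lemma padic_gamma_spec x N n : zp x -> pcong p N n%:R x ->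
  pcong p N (padic_gamma_nat p n)%:~R (padic_gamma p x).
Proof.
move=> zx; have [a ha] := choice zx.
have [|l hl] := unram_complete U (u := fun N => (padic_gamma_nat p (a N))%:~R).
  move=> M; apply: gamma_nat_cong; apply: (pcong_trans (y := x)).
    exact: pcongW (ha M.+1).
  exact/pcong_sym/ha.
have good M k : pcong p M k%:R x -> pcong p M (padic_gamma_nat p k)%:~R l.
  move=> hk; apply: pcong_trans (hl M); apply: gamma_nat_cong.
  exact: pcong_trans hk (pcong_sym (ha M)).
suff -> : padic_gamma p x = l by apply: good.
rewrite /padic_gamma; case: xgetP => [y _ /= hy|no]; last first.
  by case: (no l) => M; exists M => k; apply: good.
apply: (eq_pcong U) => M; have [M' hM] := hy M.
have [k hk] := zx (maxn M M').
apply: (pcong_trans (y := (padic_gamma_nat p k)%:~R)).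
  by apply: pcong_sym; apply: hM; apply: ppow_dvdW hk; apply: leq_maxr.
by apply: good; apply: pcongW hk; apply: leq_maxl.
Qed.

Lemma zp_nat n : zp n%:R.
Proof. by move=> N; exists n; apply: pcong_refl. Qed.

Lemma padic_gamma_nat_val n : padic_gamma p (n%:R : W) = (padic_gamma_nat p n)%:~R.
Proof.
apply: (eq_pcong U) => N; apply/pcong_sym/padic_gamma_spec; first exact: zp_nat.
exact: pcong_refl.
Qed.

Lemma padic_gamma_cong N x y : zp x -> zp y -> pcong p N x y ->
  pcong p N (padic_gamma p x) (padic_gamma p y).
Proof.
move=> zx zy xy; have [n hn] := zx N.
apply: (pcong_trans (y := (padic_gamma_nat p n)%:~R)).
  exact/pcong_sym/padic_gamma_spec.
by apply: padic_gamma_spec => //; apply: pcong_trans hn xy.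
Qed.

Lemma zpD x y : zp x -> zp y -> zp (x + y).
Proof.
move=> zx zy N; have [m hm] := zx N; have [n hn] := zy N.
by exists (m + n)%N; rewrite natrD; apply: pcongD.
Qed.

(** The limit of the recursion at natural numbers, whose case distinction is
    constant near x. *)
Lemma padic_gammaS x : zp x ->
  padic_gamma p (x + 1) = - (if `[< ppow_dvd p 1 x >] then 1 else x) * padic_gamma p x.
Proof.
move=> zx; apply: (eq_pcong U) => N.
have [n hn] := zx N.+1; have hn' := pcongW (leqnSn N) hn.
apply: (pcong_trans (y := (padic_gamma_nat p n.+1)%:~R)).
  apply/pcong_sym/padic_gamma_spec; first exact/zpD/(zp_nat 1).
  by rewrite -natr1; apply: pcongD => //; apply: pcong_refl.
have -> : (padic_gamma_nat p n.+1)%:~R =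
    - (if (p %| n)%N then 1 else n%:R) * (padic_gamma_nat p n)%:~R :> W.
  rewrite !gamma_natE pfree_factS natrM exprS mulN1r !mulNr mulrA mulrC.
  by congr (- (_ * _)); case: ifP.
apply: pcongM; last exact: padic_gamma_spec.
apply: pcongN; have e : (p %| n)%N <-> ppow_dvd p 1 x.
  have h1 : pcong p 1 n%:R x by apply: pcongW hn.
  rewrite -(ppow_dvd1_nat p_prime U) -!(res_eq0 U).
  by move/(res_eq_pcong U): h1 => ->.
by case: asboolP => [/e -> | /e /negP/negPf ->] //; apply: pcong_refl.
Qed.

(** Gamma_p takes unit values, as products of integers prime to p. *)
Lemma padic_gamma_neq0 x : zp x -> padic_gamma p x != 0.
Proof.
move=> zx; have [n hn] := zx 1%N.
suff : res (padic_gamma p x) != 0 by apply: contraNneq => ->; rewrite rmorph0.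
have /(res_eq_pcong U) <- := padic_gamma_spec zx hn.
rewrite gamma_natE rmorphM rmorphXn rmorphN rmorph1 /= mulf_neq0 ?signr_eq0 //.
rewrite rmorph_nat /pfree_fact natr_prod prodf_seq_neq0; apply/allP=> j _.
by apply/implyP=> pj; apply: (natF_neq0 p_prime U).
Qed.

End PadicGamma.

(** * Forward differences and functions with small Newton coefficients *)

Section ForwardDifferences.
Variable R : comNzRingType.
Implicit Types (f g : nat -> R) (j m n : nat).

Definition fdiff f n := f n.+1 - f n.

Lemma iter_fdiffD j f g :
  iter j fdiff (fun n => f n + g n) = fun n => iter j fdiff f n + iter j fdiff g n.
Proof.
elim: j => //= j ->; apply/funext => n; rewrite /fdiff opprD.
by rewrite addrACA.
Qed.

Lemma iter_fdiffZ j c f :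
  iter j fdiff (fun n => c * f n) = fun n => c * iter j fdiff f n.
Proof. by elim: j => //= j ->; apply/funext => n; rewrite /fdiff mulrBr. Qed.

Lemma iter_fdiff0 j : iter j fdiff (fun=> 0) = fun=> 0.
Proof. by elim: j => //= j ->; apply/funext => n; rewrite /fdiff subr0. Qed.

Lemma iter_fdiff_sum j (I : Type) (s : seq I) (f : I -> nat -> R) :
  iter j fdiff (fun n => \sum_(i <- s) f i n) =
  fun n => \sum_(i <- s) iter j fdiff (f i) n.
Proof.
elim: s => [|i s IH].
  transitivity (iter j fdiff (fun=> 0)).
    by congr iter; apply/funext => n; rewrite big_nil.
  by rewrite iter_fdiff0; apply/funext => n; rewrite big_nil.
transitivity (iter j fdiff (fun n => f i n + \sum_(k <- s) f k n)).
  by congr iter; apply/funext => n; rewrite big_cons.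
by rewrite iter_fdiffD IH; apply/funext => n; rewrite big_cons.
Qed.

Lemma iter_fdiff_shift j f n :
  iter j fdiff (fun n => f n.+1) n = iter j fdiff f n.+1.
Proof. by elim: j n => //= j IH n; rewrite /fdiff !IH. Qed.

Lemma fdiffM f g :
  fdiff (fun n => f n * g n) = fun n => fdiff f n * g n.+1 + f n * fdiff g n.
Proof. by apply/funext => n; rewrite /fdiff mulrBl mulrBr addrA subrK. Qed.

Lemma newton_expansion f n :
  f n = \sum_(j < n.+1) iter j fdiff f 0 *+ 'C(n, j).
Proof.
elim: n f => [|n IH] f; first by rewrite big_ord1 bin0.
rewrite (IH (fun n => f n.+1)) (eq_bigr (fun j : 'I_n.+1 =>
  iter j fdiff f 0%N *+ 'C(n, j) + iter j.+1 fdiff f 0%N *+ 'C(n, j))); last first.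
  by move=> j _; rewrite iter_fdiff_shift -mulrnDl /= /fdiff addrC subrK.
rewrite big_split /= [in RHS]big_ord_recl bin0 /=.
under [in RHS]eq_bigr => j _ do rewrite /bump leq0n add1n binS mulrnDr.
rewrite big_split /= addrA; congr (_ + _).
by rewrite big_ord_recl [in RHS]big_ord_recr /= (@bin_small n n.+1) // mulr0n addr0 bin0.
Qed.

Lemma iter_fdiffE M f n :
  iter M fdiff f n = \sum_(k < M.+1) (-1) ^+ (M - k) * f (n + k)%N *+ 'C(M, k).
Proof.
elim: M n => [|M IH] n; first by rewrite big_ord1 /= mul1r addn0.
rewrite iterS /fdiff !IH [RHS]big_ord_recl /= bin0 subn0 addn0 mulr1n.
under [in RHS]eq_bigr => k _ do
  rewrite /bump leq0n add1n subSS binS addnS mulrnDr.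
rewrite big_split /= [RHS]addrA [LHS]addrC; congr (_ + _).
rewrite big_ord_recl /= bin0 subn0 addn0 mulr1n opprD -mulNr -mulN1r -exprS.
rewrite [in RHS]big_ord_recr /= (@bin_small M M.+1) // mulr0n addr0 -sumrN.
congr (_ + _); apply: eq_bigr => k _; rewrite /bump leq0n add1n addnS -mulNrn -mulNr.
by rewrite -[(M - k)%N in RHS]prednK ?subn_gt0 // exprS mulN1r -subnS.
Qed.

(** Differencing lowers degrees: the difference of X^i is the truncated binomial
    expansion of (X+1)^i. *)
Lemma fdiff_poly (P : {poly R}) : exists2 Q : {poly R},
  (size Q <= (size P).-1)%N &
  fdiff (fun n => P.[n%:R]) = fun n => Q.[n%:R].
Proof.
exists (\sum_(i < size P) P`_i *: \sum_(k < i) 'X^k *+ 'C(i, k)).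
  apply: (leq_trans (size_sum _ _ _)); apply/bigmax_leqP => i _.
  apply: (leq_trans (size_scale_leq _ _)); apply: (leq_trans (size_sum _ _ _)).
  apply/bigmax_leqP => k _; rewrite -scaler_nat.
  apply: (leq_trans (size_scale_leq _ _)); rewrite size_polyXn.
  by have := ltn_ord i; have := ltn_ord k; lia.
apply/funext => n; rewrite /fdiff !(horner_coef P) horner_sum -sumrB.
apply: eq_bigr => i _; rewrite hornerZ -mulrBr; congr (_ * _).
rewrite -natr1 (addrC n%:R) exprDn big_ord_recr /= subnn binn expr0 mul1r mulr1n addrK.
rewrite horner_sum; apply: eq_bigr => k _.
by rewrite expr1n mul1r hornerMn hornerXn.
Qed.

Lemma iter_fdiff_poly (P : {poly R}) j : exists2 Q : {poly R},
  (size Q <= size P - j)%N &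
  iter j fdiff (fun n => P.[n%:R]) = fun n => Q.[n%:R].
Proof.
elim: j => [|j [Q sQ eQ]]; first by exists P; rewrite ?subn0.
have [Q' sQ' eQ'] := fdiff_poly Q; exists Q'; last by rewrite iterS eQ.
by apply: (leq_trans sQ'); rewrite subnS; lia.
Qed.

Lemma iter_fdiff_poly0 (P : {poly R}) j n : (size P <= j)%N ->
  iter j fdiff (fun n => P.[n%:R]) n = 0.
Proof.
move=> sP; have [Q sQ ->] := iter_fdiff_poly P j.
have -> : Q = 0; last by rewrite horner0.
by apply/eqP; rewrite -size_poly_leq0 (leq_trans sQ) // leqn0 subn_eq0.
Qed.

End ForwardDifferences.

Section SmallDifferences.
Variables (p : nat) (R : idomainType).
Implicit Types (f g K : nat -> R) (j m n s t : nat).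

(** The required valuation is the ceiling of 2 (j + s) / 3. The slope 2/3 exceeds
    the slope 1/(p - 1) of the valuation of j!, even for p = 3, and is still
    within reach for the functions below. The truncation at order m makes proofs
    by induction on m possible; s counts the differences already taken. *)
Definition fdiff_small s m f :=
  forall j, (j <= m)%N -> forall n,
    ppow_dvd p ((2 * (j + s) + 2) %/ 3) (iter j (@fdiff R) f n).

Lemma fdiff_smallW s m m' f : (m' <= m)%N -> fdiff_small s m f -> fdiff_small s m' f.
Proof. by move=> le hf j jm; apply: hf; apply: leq_trans jm le. Qed.

Lemma fdiff_small_shift s m f :
  fdiff_small s m f -> fdiff_small s m (fun n => f n.+1).
Proof. by move=> hf j jm n; rewrite iter_fdiff_shift; apply: hf. Qed.

Lemma fdiff_small_fdiff s m f :
  fdiff_small s m.+1 f -> fdiff_small s.+1 m (fdiff f).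
Proof. by move=> hf j jm n; rewrite -iterSr -(addSnnS j s); apply: hf. Qed.

Lemma fdiff_small_val s m f n :
  fdiff_small s m f -> ppow_dvd p ((2 * s + 2) %/ 3) (f n).
Proof. by move=> /(_ 0%N (leq0n m) n); rewrite add0n. Qed.

(** The Leibniz rule moves a difference onto one of the factors, where it raises
    s or t; the bounds add up because the ceiling is subadditive. *)
Lemma fdiff_smallM s t m f g : fdiff_small s m f -> fdiff_small t m g ->
  fdiff_small (s + t) m (fun n => f n * g n).
Proof.
elim: m s t f g => [|m IH] s t f g hf hg [|j] jm n //.
- apply: ppow_dvdW (ppow_dvdM (fdiff_small_val n hf) (fdiff_small_val n hg)).
  by lia.
- apply: ppow_dvdW (ppow_dvdM (fdiff_small_val n hf) (fdiff_small_val n hg)).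
  by lia.
rewrite iterSr fdiffM iter_fdiffD.
apply: ppow_dvdD.
  rewrite addSnnS -addSn; apply: (IH s.+1 t (fdiff f) (fun n => g n.+1)) => //.
    exact: fdiff_small_fdiff.
  exact/(fdiff_smallW (leqnSn m))/fdiff_small_shift.
rewrite addSnnS -addnS; apply: (IH s t.+1 f (fdiff g)) => //.
  exact: fdiff_smallW hf.
exact: fdiff_small_fdiff.
Qed.

(** Solutions of f(n+1) = (1 + K(n)) f(n) are small as soon as K gains one order
    more than is asked of f; the induction feeds the bounds for f back into
    the right-hand side. *)
Lemma fdiff_small_recl K f m : (forall m', fdiff_small 1 m' K) ->
  (forall n, f n.+1 - f n = K n * f n) -> fdiff_small 0 m f.
Proof.
move=> hK e; elim: m => [|m IH] [|j] jm n //; try exact: ppow_dvd_any.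
rewrite iterSr (_ : fdiff f = fun n => K n * f n); last exact/funext.
by rewrite addSnnS; apply: (fdiff_smallM (hK m) IH).
Qed.

Lemma fdiff_small_recr K f m : (forall m', fdiff_small 1 m' K) ->
  (forall n, f n.+1 - f n = K n * f n.+1) -> fdiff_small 0 m f.
Proof.
move=> hK e; elim: m => [|m IH] [|j] jm n //; try exact: ppow_dvd_any.
rewrite iterSr (_ : fdiff f = fun n => K n * f n.+1); last exact/funext.
by rewrite addSnnS; apply: (fdiff_smallM (hK m) (fdiff_small_shift IH)).
Qed.

(** One difference of n -> f (a n + b) telescopes into a differences of f. *)
Lemma fdiff_small_affine s m a b f :
  fdiff_small s m f -> fdiff_small s m (fun n => f (a * n + b)%N).
Proof.
elim: m s b f => [|m IH] s b f hf [|j] jm n //; try exact: hf.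
rewrite iterSr.
have -> : fdiff (fun n => f (a * n + b)%N) =
    fun n => \sum_(0 <= i < a) fdiff f (a * n + (b + i))%N.
  apply/funext => k; rewrite /fdiff.
  rewrite (telescope_sumr_eq (fun i => f (a * k + (b + i))%N)) => [||i _].
  - by rewrite addn0 mulnS; congr (f _ - _); lia.
  - by [].
  - by rewrite !addnS.
rewrite iter_fdiff_sum; apply: ppow_dvd_sum => i _.
by rewrite addSnnS; apply: IH => //; apply: fdiff_small_fdiff.
Qed.

(** The j-th difference kills (p n)^i for i < j and is divisible by p^i otherwise;
    this is enough for i >= 2, while i = 0, 1 need the additional factor p of the
    hypotheses. *)
Lemma fdiff_small_poly (P : {poly R}) m : ppow_dvd p 1 P`_0 -> ppow_dvd p 1 P`_1 ->
  fdiff_small 1 m (fun n => P.[p%:R * n%:R]).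
Proof.
move=> h0 h1 j _ n.
have -> : (fun n => P.[p%:R * n%:R]) =
    fun n => \sum_(0 <= i < size P) (P`_i * p%:R ^+ i) * ('X^i).[n%:R].
  apply/funext => k; rewrite horner_coef big_mkord.
  by apply: eq_bigr => i _; rewrite hornerXn exprMn mulrA.
rewrite iter_fdiff_sum; apply: ppow_dvd_sum => i _; rewrite iter_fdiffZ.
have [ij|ji] := ltnP i j.
  by rewrite iter_fdiff_poly0 ?size_polyXn // mulr0; apply: ppow_dvd0.
apply: ppow_dvdMr; case: i ji => [|[|i]] ji.
- by rewrite expr0 mulr1; apply: ppow_dvdW h0; lia.
- have := ppow_dvdM h1 (@ppow_dvdP R p 1 1); rewrite mulr1.
  by apply: ppow_dvdW; lia.
- apply: ppow_dvdMl; apply: (@ppow_dvdW _ _ _ i.+2); first by lia.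
  by rewrite -[_ ^+ _]mulr1; apply: ppow_dvdP.
Qed.

Lemma fdiff_small_const m (c : R) : fdiff_small 0 m (fun=> c).
Proof.
case=> [|j] _ n; first exact: ppow_dvd_any.
rewrite iterSr (_ : fdiff _ = fun=> 0); last by apply/funext => k; rewrite /fdiff subrr.
by rewrite iter_fdiff0; apply: ppow_dvd0.
Qed.

Lemma fdiff_small_linear m (c : R) : fdiff_small 0 m (fun n => p%:R * (n%:R + c)).
Proof.
case=> [|[|j]] _ n; first exact: ppow_dvd_any.
  by rewrite /= /fdiff -mulrBr; apply: ppow_dvdMr; exists 1; rewrite mulr1.
rewrite 2!iterSr (_ : fdiff (fdiff _) = fun=> 0).
  by rewrite iter_fdiff0; apply: ppow_dvd0.
apply/funext => k; rewrite /fdiff -!natr1; ring.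
Qed.

End SmallDifferences.

Section NewtonSeries.
Variables (p : nat) (F : finFieldType) (W : idomainType) (res : {rmorphism W -> F}).
Hypothesis p_prime : prime p.
Hypothesis p_odd : odd p.
Hypothesis U : unramified_integers p res.

Lemma odd_prime_gt2 : (2 < p)%N.
Proof. by case: p p_prime p_odd => [|[|[|]]]. Qed.

Lemma two_unit : (2%:R : W) \is a GRing.unit.
Proof.
apply: (unit_nat p_prime U); apply/negP=> /(dvdn_leq (isT : 0 < 2)%N).
by rewrite leqNgt odd_prime_gt2.
Qed.

Lemma half_approx L : pcong p L ((p ^ L).-1./2.+1%:R : W) 2%:R^-1.
Proof.
apply: (ppow_dvd_unit two_unit); rewrite mulrBr mulrV ?two_unit // -natrM.
have oL : odd (p ^ L) by rewrite oddX p_odd orbT.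
have -> : (2 * (p ^ L).-1./2.+1 = p ^ L + 1)%N by lia.
by rewrite natrD addrK; apply: ppow_dvd_nat.
Qed.

Lemma logn_fact_le j : (2 * logn p j`! <= j)%N.
Proof.
rewrite logn_fact //.
have step k : (2 * (\sum_(1 <= i < k.+1) j %/ p ^ i) + j %/ p ^ k <= j)%N.
  elim: k => [|k IH]; first by rewrite big_geq // expn0 divn1.
  rewrite big_nat_recr //= expnSr divnMA; set x := (j %/ p ^ k)%N in IH *.
  have h : (3 * (x %/ p) <= x)%N.
    by apply: (leq_trans _ (leq_divM x p)); rewrite mulnC leq_mul2l odd_prime_gt2 orbT.
  by move: IH h; set s := bigop _ _ _; lia.
by apply: leq_trans (step j); rewrite leq_addr.
Qed.

(** The valuation of j! is at most j/2, so that j/6 of the 2j/3 digits of the j-th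
    Newton coefficient survive the division by j!. *)
Lemma newton_series (f : nat -> W) : (forall m, fdiff_small p 0 m f) ->
  exists alpha : nat -> W, (forall j, ppow_dvd p (j %/ 6) (alpha j)) /\
    forall n, f n = \sum_(j < n.+1) alpha j * (n ^_ j)%:R.
Proof.
move=> hf.
have [j|alpha ha] := @choice _ _ (fun j (a : W) =>
    ppow_dvd p (j %/ 6) a /\ j`!%:R * a = iter j (@fdiff W) f 0%N).
  have [z ez] := hf j j (leqnn j) 0%N.
  have [u uu eu] := natW_partE p_prime U (fact_gt0 j).
  have le := logn_fact_le j; set v := logn p j`! in le eu.
  exists (p%:R ^+ ((2 * (j + 0) + 2) %/ 3 - v) * (u^-1 * z)); split.
    by apply: ppow_dvdW (ppow_dvdP _ _ _); lia.
  rewrite ez eu -[in RHS](@subnK v ((2 * (j + 0) + 2) %/ 3)); last by lia.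
  by rewrite exprD -[in RHS](mulVKr uu z); set w := u^-1 * z; ring.
exists alpha; split=> [j|n]; first by have [] := ha j.
rewrite (newton_expansion f); apply: eq_bigr => j _; have [_ <-] := ha j.
by rewrite -bin_ffact natrM -[LHS]mulr_natr mulrC [in RHS]mulrC mulrA.
Qed.

(** Divided differences at 0, 1, ..., M, up to the factor M!. *)
Definition ddiff M (P : {poly W}) := iter M (@fdiff W) (fun n => P.[n%:R]) 0%N.

Definition ffpoly j : {poly W} := \prod_(i < j) ('X - i%:R%:P).

Lemma horner_ffpoly j n : (ffpoly j).[n%:R] = (n ^_ j)%:R.
Proof.
rewrite /ffpoly; elim: j => [|j IH]; first by rewrite big_ord0 hornerC.
rewrite big_ord_recr hornerM IH !hornerE ffactnSr natrM.
have [le|lt] := leqP j n; first by rewrite natrB.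
by rewrite ffact_small // !mul0r.
Qed.

Lemma ffpoly_monic j : ffpoly j \is monic.
Proof. by apply: monic_prod => i _; apply: monicXsubC. Qed.

Lemma size_ffpoly j : size (ffpoly j) = j.+1.
Proof.
elim: j => [|j IH]; first by rewrite /ffpoly big_ord0 size_poly1.
rewrite /ffpoly big_ord_recr -/(ffpoly j) size_Mmonic ?monicXsubC //; last first.
  by rewrite monic_neq0 ?ffpoly_monic.
by rewrite IH size_XsubC addn2.
Qed.

Lemma ddiffZ M c (P : {poly W}) : ddiff M (c *: P) = c * ddiff M P.
Proof.
have e : (fun n => (c *: P).[n%:R]) = fun n => c * P.[n%:R].
  by apply/funext => n; rewrite hornerZ.
by rewrite /ddiff e iter_fdiffZ.
Qed.

Lemma ddiffD M (P Q : {poly W}) : ddiff M (P + Q) = ddiff M P + ddiff M Q.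
Proof.
have e : (fun n => (P + Q).[n%:R]) = fun n => P.[n%:R] + Q.[n%:R].
  by apply/funext => n; rewrite hornerD.
by rewrite /ddiff e iter_fdiffD.
Qed.

Lemma ddiff_small M (P : {poly W}) : (size P <= M)%N -> ddiff M P = 0.
Proof. exact: iter_fdiff_poly0. Qed.

Lemma ddiff_ffM M (P : {poly W}) : ddiff M (P * ffpoly M) = M`!%:R * P.[M%:R].
Proof.
rewrite /ddiff iter_fdiffE big_ord_recr /= big1 => [|k _].
  rewrite add0r subnn mul1r hornerM horner_ffpoly add0n ffactnn binn mulr1n.
  by rewrite mulrC.
by rewrite hornerM horner_ffpoly add0n (ffact_small (ltn_ord k)) !mulr0 mul0rn.
Qed.

(** Divide P by the monic polynomial [ffpoly M]: the remainder has degree less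
    than M, and the quotient contributes M! times its value at M. *)
Lemma ddiff_dvd M (P : {poly W}) : exists c, ddiff M P = M`!%:R * c.
Proof.
rewrite (Pdiv.RingMonic.rdivp_eq (ffpoly_monic M) P) ddiffD ddiff_ffM.
rewrite [X in _ + X]ddiff_small ?addr0; first by eexists.
by rewrite -ltnS -(size_ffpoly M) Pdiv.Ring.ltn_rmodpN0 ?monic_neq0 ?ffpoly_monic.
Qed.

Lemma ddiff_coef M (P : {poly W}) : (size P <= M.+1)%N -> ddiff M P = M`!%:R * P`_M.
Proof.
move=> sP; have -> : P = P`_M *: ffpoly M + (P - P`_M *: ffpoly M) by rewrite addrC subrK.
rewrite ddiffD ddiffZ [X in _ + X]ddiff_small.
  have := ddiff_ffM M 1; rewrite mul1r hornerC mulr1 => ->.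
  rewrite addr0 coefD coefB coefZ addrC subrK mulrC; congr (_ * _).
apply/leq_sizeP => i; rewrite leq_eqVlt => /orP[/eqP <-|lt].
  rewrite coefB coefZ; have := ffpoly_monic M; rewrite monicE lead_coefE size_ffpoly /=.
  by move/eqP->; rewrite mulr1 subrr.
have sf : (size (ffpoly M) <= i)%N by rewrite size_ffpoly.
by rewrite coefB coefZ (nth_default 0 (leq_trans sP lt)) (nth_default 0 sf) mulr0 subrr.
Qed.

End NewtonSeries.

Section TraceEvaluation.
Variables (p : nat) (F : finFieldType) (W : idomainType) (res : {rmorphism W -> F}).
Hypothesis p_prime : prime p.
Hypothesis U : unramified_integers p res.
Variables (q b : nat) (sigma : W).
Hypothesis p_dvd_q : (p %| q)%N.
Hypothesis sigmaE : q%:R * sigma = sigma + b%:R.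

Local Notation Y := ('X + sigma%:P : {poly W})%R.
Local Notation lin := (q%:R%:P * 'X + b%:R%:P : {poly W})%R.

Lemma sub_value_factor (P : {poly W}) : exists2 Q : {poly W},
  P - (P.[- sigma])%:P = Y * Q & (size Q <= (size P).-1)%N.
Proof.
have /factor_theorem[Q eQ] : root (P - (P.[- sigma])%:P) (- sigma).
  by rewrite /root !hornerE subrr.
move: eQ; rewrite polyCN opprK mulrC => eQ; exists Q => //.
have [->|Q0] := eqVneq Q 0; first by rewrite size_poly0.
have := congr1 (fun T : {poly W} => size T) eQ; rewrite mulrC size_Mmonic ?monicXaddC //.
rewrite size_XaddC addn2 /= => e; rewrite -ltnS -e.
have P0 : P != 0.
  apply: contraNneq Q0 => P0; have := eQ; rewrite P0 horner0 subrr => /esym/eqP.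
  by rewrite mulf_eq0 (negPf (monic_neq0 (monicXaddC _))).
rewrite prednK ?lt0n ?size_poly_eq0 //.
apply: (leq_trans (size_polyD _ _)); rewrite geq_max leqnn size_polyN size_polyC.
by apply: (leq_trans (leq_b1 _)); rewrite lt0n size_poly_eq0.
Qed.

(** As -sigma is the fixed point of x -> q x + b, this is the expansion of
    P (-sigma + q (x + sigma)) in powers of x + sigma. *)
Lemma comp_linE (P : {poly W}) : P \Po lin =
  \sum_(i < size P) ((P \Po ('X - sigma%:P))`_i * q%:R ^+ i) *: Y ^+ i.
Proof.
have e : lin = q%:R *: Y - sigma%:P.
  rewrite -mul_polyC mulrDr -addrA; congr (_ + _).
  by rewrite -!(polyCM, polyCB, polyCD) sigmaE addrAC subrr add0r.
set Q := P \Po ('X - sigma%:P).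
have -> : P \Po lin = Q \Po (q%:R *: Y).
  by rewrite /Q -comp_polyA e comp_polyB comp_polyX comp_polyC.
have sQ : size Q = size P by rewrite /Q size_comp_poly2 ?size_XsubC.
rewrite comp_polyE sQ; apply: eq_bigr => i _.
by rewrite exprZn scalerA.
Qed.

Definition ddiff_in M e (P : {poly W}) :=
  exists2 c, ddiff M P = M`!%:R * c & ppow_dvd p e c.

Lemma ddiff_in_sum M e (I : Type) (s : seq I) (P : I -> {poly W}) :
  (forall i, ddiff_in M e (P i)) -> ddiff_in M e (\sum_(i <- s) P i).
Proof.
move=> h; elim: s => [|i s [c ec hc]].
  rewrite big_nil; exists 0; last exact: ppow_dvd0.
  by rewrite ddiff_small ?size_poly0 // mulr0.
have [c' ec' hc'] := h i; rewrite big_cons; exists (c' + c).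
  by rewrite ddiffD ec ec' mulrDr.
exact: ppow_dvdD.
Qed.

(** The sum over the nodes is the sum of all residues but one of the rational
    function f(x) ω(q x + b) / ((x + σ) ω(x)), where ω is the falling factorial
    with zeros 0, ..., M; the remaining finite residue is at the fixed point
    -σ of x -> q x + b, where the two factors ω cancel. The contribution of
    infinity is small: the j-th Newton term and the i-th power of x + σ in
    ω(q x + b) come with p^(j/6) q^i, and reach infinity only if i + j > M. *)
Lemma trace_evaluation (f alpha : nat -> W) M :
  (forall j, ppow_dvd p (j %/ 6) (alpha j)) ->
  (forall n, f n = \sum_(j < n.+1) alpha j * (n ^_ j)%:R) ->
  let lambda := \sum_(j < M.+1) alpha j * (ffpoly W j).[- sigma] in
  exists B : {poly W}, exists c : W,
  [/\ forall k, (k <= M)%N ->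
        (k%:R + sigma) * B.[k%:R] = f k * ((q * k + b) ^_ M.+1)%:R,
      ddiff M B = M`!%:R * c
    & pcong p (M %/ 6) c (- lambda)].
Proof.
move=> halpha hf lambda; pose om := ffpoly W M.+1.
have exB j : exists Q : {poly W},
    ffpoly W j - ((ffpoly W j).[- sigma])%:P = Y * Q /\ (size Q <= j)%N.
  by have [Q eQ sQ] := sub_value_factor (ffpoly W j); exists Q; rewrite size_ffpoly in sQ.
have [B0 hB0] := choice exB.
have omfix : (om \Po lin).[- sigma] = om.[- sigma].
  rewrite horner_comp !hornerE; congr _.[_].
  by rewrite mulrN sigmaE; ring.
have [E eE sE] := sub_value_factor (om \Po lin - om).
rewrite hornerD hornerN omfix subrr subr0 in eE.
pose R := \sum_(j < M.+1) alpha j *: ffpoly W j.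
pose B := (\sum_(j < M.+1) alpha j *: B0 j) * (om \Po lin) + lambda *: E.
have eB : Y * B = R * (om \Po lin) - lambda *: om.
  rewrite /B mulrDr mulrA -scalerAr -eE.
  have -> : Y * (\sum_(j < M.+1) alpha j *: B0 j) = R - lambda%:P.
    rewrite mulr_sumr /R /lambda rmorph_sum -sumrB; apply: eq_bigr => j _ /=.
    by rewrite -scalerAr -(proj1 (hB0 j)) scalerBr polyCM mul_polyC.
  by rewrite mulrBl (mul_polyC lambda) scalerBr subrKA.
have sY i : (size (Y ^+ i) <= i.+1)%N.
  by rewrite -[sigma]opprK polyCN size_exp_XsubC.
exists B; have [c2 ec2 hc2] : ddiff_in M (M %/ 6)
    ((\sum_(j < M.+1) alpha j *: B0 j) * (om \Po lin)).
  rewrite mulr_suml; apply: ddiff_in_sum => j.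
  rewrite comp_linE mulr_sumr; apply: ddiff_in_sum => i.
  rewrite -scalerAl -scalerAr scalerA.
  set a := alpha j * _.
  have [le|lt] := leqP (j + i) M.
    exists 0; last exact: ppow_dvd0.
    rewrite ddiffZ ddiff_small ?mulr0 //; apply: (leq_trans (size_polyMleq _ _)).
    have := proj2 (hB0 j); have := sY i; lia.
  have [c ec] := ddiff_dvd M (B0 j * Y ^+ i); exists (a * c).
    by rewrite ddiffZ ec mulrCA.
  apply/ppow_dvdMr; apply: (@ppow_dvdW _ _ _ (j %/ 6 + i)); first by lia.
  apply: ppow_dvdM => //; apply: ppow_dvdMl; rewrite -natrX.
  by apply/ppow_dvd_nat/dvdn_exp2r.
have somlin : (size (om \Po lin) <= M.+2)%N.
  rewrite comp_linE size_ffpoly; apply: (leq_trans (size_sum _ _ _)).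
  apply/bigmax_leqP => i _; apply: (leq_trans (size_scale_leq _ _)).
  exact: leq_trans (sY i) (ltn_ord i).
have [c1 ec1 hc1] : exists2 c, ddiff M E = M`!%:R * c & pcong p (M %/ 6) c (-1).
  have sE' : (size E <= M.+1)%N.
    apply: (leq_trans sE); rewrite -subn1 leq_subLR add1n.
    apply: (leq_trans (size_polyD _ _)); rewrite geq_max somlin size_polyN.
    by rewrite /om size_ffpoly leqnn.
  exists E`_M; first exact: ddiff_coef.
  have -> : E`_M = (om \Po lin)`_M.+1 - om`_M.+1.
    rewrite -coefB eE mulrDl coefD coefXM /= coefCM (nth_default 0 sE').
    by rewrite mulr0 addr0.
  have -> : om`_M.+1 = 1.
    by have := ffpoly_monic W M.+1; rewrite monicE lead_coefE size_ffpoly => /eqP.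
  rewrite -[X in pcong _ _ _ X]add0r; apply: pcongD; last exact: pcong_refl.
  rewrite /pcong subr0 comp_linE size_ffpoly coef_sum; apply: ppow_dvd_sum => i _.
  rewrite coefZ; have [iM|Mi] := leqP i M.
    have -> : (Y ^+ i)`_M.+1 = 0 by apply: nth_default; apply: leq_trans (sY i) _.
    by rewrite mulr0; apply: ppow_dvd0.
  apply/ppow_dvdMr/ppow_dvdMl; rewrite -natrX; apply: ppow_dvd_nat.
  by apply: (dvdn_trans _ (dvdn_exp2r i p_dvd_q)); apply: dvdn_exp2l; lia.
exists (c2 + lambda * c1); split=> [k kM||].
- have := congr1 (fun T : {poly W} => T.[k%:R]) eB.
  rewrite hornerM !hornerE => ->; rewrite horner_ffpoly ffact_small // mulr0 subr0.
  rewrite horner_comp !hornerE -natrM -natrD horner_ffpoly; congr (_ * _).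
  rewrite /R horner_sum hf (big_ord_widen M.+1 (fun j => alpha j * (k ^_ j)%:R)) //.
  rewrite [RHS]big_mkcond /=; apply: eq_bigr => j _.
  rewrite hornerZ horner_ffpoly; case: ltnP => // kj.
  by rewrite ffact_small ?mulr0.
- by rewrite /B ddiffD ddiffZ ec1 ec2 mulrDr mulrCA.
- rewrite -[X in pcong _ _ _ X]add0r -mulrN1; apply: pcongD.
    by rewrite /pcong subr0.
  exact: pcongMl.
Qed.

End TraceEvaluation.

(** * Jacobi sums as sums of coefficients of a power of a polynomial *)

Section Binomials.
Variable R : comNzRingType.

(** The coefficient of X^n in the power series (1 - X)^(-K-1). *)
Definition multibin K n := 'C(K + n, n).

Lemma multibinS K n : (n.+1 * multibin K n.+1 = (K + n).+1 * multibin K n)%N.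
Proof. by rewrite /multibin addnS -mul_bin_diag. Qed.

(** Like the alternating partial sums of a row of binomials, the truncations of
    the convolution (1 - X)^(K+1) (1 - X)^(-K-1) = 1 have a closed form. *)
Lemma truncated_convolution K x r :
  x%:R * (\sum_(j < r.+1 | (j <= x)%N)
     (-1) ^+ j * ('C(K.+1, j) * multibin K (x - j))%:R) =
  (-1) ^+ r * ('C(K, r) * multibin K (x - r) * (x - r))%:R :> R.
Proof.
elim: r => [|r IH].
  by rewrite big_mkcond big_ord1 /= subn0 !mul1r bin0 !bin0 !mul1n mulrC -natrM.
rewrite big_mkcond big_ord_recr -big_mkcond /= mulrDr IH.
have [rx|xr] := ltnP r x; last first.
  have -> : (x - r = 0)%N by lia.
  have -> : (x - r.+1 = 0)%N by lia.
  by rewrite !muln0 !mulr0 addr0.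
have [y ey] : exists y, x = (y + r.+1)%N by exists (x - r.+1)%N; lia.
have e1 : (x - r = y.+1)%N by lia.
have e2 : (x - r.+1 = y)%N by lia.
have h1 := congr1 (fun n => n%:R : R) (multibinS K y).
have h2 : (r.+1 * 'C(K, r.+1))%:R = (K%:R - r%:R) * 'C(K, r)%:R :> R.
  rewrite mul_bin_left; have [le|lt] := leqP r K; first by rewrite natrM natrB.
  by rewrite bin_small // muln0 mulr0.
rewrite e1 e2 ey binS exprS; move: h1 h2; rewrite !(natrM, natrD) -!natr1 !natrD.
set c := 'C(K, r)%:R; set c' := 'C(K, r.+1)%:R; set u := (multibin K y)%:R.
set v := (multibin K y.+1)%:R; set s := (-1) ^+ r => h1 h2.
have -> : s * (c * v * (y%:R + 1)) = s * c * ((y%:R + 1) * v) by ring.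
rewrite h1.
have -> : s * c * ((K%:R + y%:R + 1) * u) + (y%:R + (r%:R + 1)) * (-1 * s * ((c' + c) * u)) =
  -1 * s * (c' * u * y%:R) - s * u * ((r%:R + 1) * c') + s * u * (K%:R - r%:R) * c by ring.
by rewrite h2; ring.
Qed.

End Binomials.

(** An identity between products of factorials. The product on the right
    approximates a quotient of rising factorials of 1/2 when g + 1 approximates
    1/2. *)
Lemma truncated_convolution_closed M k y g :
  (k <= M)%N ->
  ((M + y) ^_ (M + y - k) * M`! * ('C(M + g, M - k) * multibin (M + g) y * y) =
   'C(M, k) * (M + y) ^_ M.+1 * \prod_(k <= i < M + y) (g.+1 + i))%N.
Proof.
move=> kM; set m := (M + y)%N.
have hA := bin_fact (leq_trans (leq_subr k M) (leq_addr g M)).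
have hB : (multibin (M + g) y * (y`! * (M + g)`!) = (M + g + y)`!)%N.
  by rewrite /multibin -{2}(addnK y (M + g)%N) bin_fact // leq_addl.
have hC := bin_fact kM.
have hD : (m ^_ (m - k) * k`! = m`!)%N.
  by rewrite -{2}(@subKn k m) ?ffact_fact ?leq_subr //; lia.
have hP : (\prod_(k <= i < m) (g.+1 + i) * (g + k)`! = (g + m)`!)%N.
  have risingE n : (\prod_(k <= i < k + n) (g.+1 + i) * (g + k)`! = (g + (k + n))`!)%N.
    elim: n => [|n IH]; first by rewrite addn0 big_geq // mul1n.
    by rewrite addnS big_nat_recr ?leq_addr //= mulnAC IH mulnC addSn addnS factS.
  by have := risingE (m - k)%N; rewrite subnKC //; lia.
have hF : (m ^_ M.+1 * y`! = m`! * y)%N.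
  case: y @m {hB hD hP} => [|y] m; first by rewrite muln0 ffact_small // /m addn0.
  have <- : (m - M.+1 = y)%N by lia.
  rewrite factS mulnCA ffact_fact; last by lia.
  by rewrite mulnC; congr (_ * _)%N; lia.
have eMg : (M + g - (M - k) = g + k)%N by lia.
have emg : (M + g + y = g + m)%N by lia.
rewrite eMg in hA; rewrite emg in hB.
set A := 'C(M + g, M - k) in hA *; set B := multibin _ _ in hB *.
set D := (m ^_ (m - k))%N in hD *; set P := bigop _ _ _ in hP *.
set Ff := (m ^_ M.+1)%N in hF *; set C := 'C(M, k) in hC *.
have pos : (0 < k`! * (M - k)`! * (g + k)`! * y`! * (M + g)`!)%N.
  by rewrite !muln_gt0 !fact_gt0.
apply/eqP; rewrite -(eqn_pmul2r pos); apply/eqP.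
transitivity ((D * k`!) * M`! * (A * ((M - k)`! * (g + k)`!)) * (B * (y`! * (M + g)`!)) * y)%N.
  by ring.
rewrite hD hA hB.
transitivity ((C * (k`! * (M - k)`!)) * (Ff * y`!) * (P * (g + k)`!) * (M + g)`!)%N; last by ring.
by rewrite hC hF hP; ring.
Qed.

Section GeometricPower.
Variables (W : idomainType) (q : nat).
Hypothesis q_gt0 : (0 < q)%N.

Definition geom_poly : {poly W} := \sum_(i < q) 'X^i.

Lemma geom_polyE : (1 - 'X) * geom_poly = 1 - 'X^q.
Proof.
by rewrite /geom_poly -opprB mulNr -subrX1 opprB.
Qed.

(** Polynomials stand here for the power series (1 - X)^(-K-1), known modulo X^B. *)
Lemma inverse_power_series K B : exists Z : {poly W},
  (1 - 'X) ^+ K.+1 * \poly_(n < B) (multibin K n)%:R = 1 + 'X^B * Z.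
Proof.
have step (P : {poly W}) (c : nat -> W) : (forall n, (n < B)%N ->
    c n - (if n is n'.+1 then c n' else 0) = P`_n) ->
    exists Z : {poly W}, (1 - 'X) * \poly_(n < B) c n = \poly_(n < B) P`_n + 'X^B * Z.
  move=> h; case: B h => [|B] h.
    by exists 0; rewrite !poly_def !big_ord0 !mulr0 addr0.
  exists (- c B)%:P; apply/polyP => n.
  rewrite mulrBl mul1r coefB coefXM coefD mulrC coefCM coefXn !coef_poly.
  case: n => [|n] /=; first by rewrite -h // !subr0 mulr0 addr0.
  have [lt|gt|->] := ltngtP n B; last by rewrite ltnn ltnSn eqxx mulr1 !add0r.
    have e1 : (n.+1 < B.+1)%N by lia.
    have e2 : (n < B.+1)%N by lia.
    by rewrite e1 e2 -h // eqSS ltn_eqF // mulr0 addr0.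
  have e1 : (n.+1 < B.+1)%N = false by lia.
  have e2 : (n < B.+1)%N = false by lia.
  by rewrite e1 e2 eqSS gtn_eqF // mulr0 subrr addr0.
have cpoly (c : nat -> W) : \poly_(n < B) (\poly_(n < B) c n)`_n = \poly_(n < B) c n.
  by apply/polyP => n; rewrite !coef_poly; case: ltnP.
elim: K => [|K [Z eZ]].
  have [n lt|Z eZ] := step 1 (fun n => (multibin 0 n)%:R).
    by rewrite /multibin !add0n binn coef1; case: n lt => [|n] _; rewrite ?subr0 // binn subrr.
  have [Z' eZ'] : exists Z' : {poly W}, \poly_(n < B) (1 : {poly W})`_n = 1 + 'X^B * Z'.
    case: (B) => [|B']; first by exists (-1); rewrite poly_def big_ord0 mul1r subrr.
    exists 0; rewrite mulr0 addr0; apply/polyP => n; rewrite coef_poly.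
    by case: ltnP => //; rewrite coef1; case: n.
  by exists (Z' + Z); rewrite expr1 eZ eZ' mulrDr addrA.
have [n lt|Z' eZ'] := step (\poly_(n < B) (multibin K n)%:R) (fun n => (multibin K.+1 n)%:R).
  rewrite coef_poly lt /multibin; case: n lt => [|n] _; first by rewrite !bin0 subr0.
  by rewrite [(K.+1 + n.+1)%N]addSn binS addSnnS natrD addrK.
rewrite cpoly in eZ'; exists (Z + (1 - 'X) ^+ K.+1 * Z').
rewrite exprSr -mulrA eZ' mulrDr eZ -addrA; congr (_ + _).
by rewrite mulrDr; congr (_ + _); rewrite mulrCA.
Qed.

(** Read off from (1 - X^q)^(K+1) (1 - X)^(-K-1). *)
Lemma coef_geom_poly_exp K m :
  (geom_poly ^+ K.+1)`_m =
  \sum_(j < K.+2 | (q * j <= m)%N)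
    (-1) ^+ j * ('C(K.+1, j) * multibin K (m - q * j))%:R.
Proof.
have [Z eZ] := inverse_power_series K m.+1.
set V := \poly_(n < m.+1) _ in eZ.
have -> : geom_poly ^+ K.+1 =
    (1 - 'X^q) ^+ K.+1 * V - 'X^(m.+1) * (geom_poly ^+ K.+1 * Z).
  rewrite -geom_polyE exprMn mulrAC eZ; set G := geom_poly ^+ _; set T := 'X^_.
  by ring.
rewrite coefB coefXnM ltnSn subr0 exprDn mulr_suml coef_sum [RHS]big_mkcond /=.
apply: eq_bigr => j _; rewrite expr1n mul1r (exprNn 'X^q) -exprM -mulrnAr.
have -> : (-1) ^+ j * ('X^(q * j) *+ 'C(K.+1, j)) * V =
    ((-1) ^+ j * 'C(K.+1, j)%:R) *: ('X^(q * j) * V).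
  by rewrite -mulr_natl -mul_polyC rmorphM rmorphXn rmorphN rmorph1 rmorph_nat; ring.
rewrite coefZ coefXnM ltnNge; case: leqP => /= h; last by rewrite mulr0.
by rewrite coef_poly ltnS leq_subr natrM mulrA.
Qed.

End GeometricPower.

Lemma triangular_sum (R : comNzRingType) n (G : nat -> nat -> R) :
  \sum_(i < n) \sum_(j < i.+1) G j (i - j)%N =
  \sum_(k < n) \sum_(j < n - k) G j k.
Proof.
elim: n => [|n IH]; first by rewrite !big_ord0.
rewrite big_ord_recr IH [RHS]big_ord_recr /= subSnn big_ord1.
rewrite [X in _ + X](reindex_inj rev_ord_inj) big_ord_recr /= subSS subnn addrA.
congr (_ + G _ _); last by rewrite subn0.
rewrite -big_split; apply: eq_bigr => k _ /=.
rewrite (subSn (ltnW (ltn_ord k))) big_ord_recr /= subSS; congr (_ + G _ _).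
by rewrite subKn // ltnW.
Qed.

Section GeometricSumPowers.
Variables (p r : nat) (W : idomainType).
Hypothesis p_prime : prime p.
Hypothesis p_odd : odd p.
Hypothesis r_gt0 : (0 < r)%N.

Local Notation q := (p ^ r)%N.
Local Notation h := (q.-1./2).
Local Notation rho := (geom_poly W q).

Lemma q_gt2 : (2 < q)%N.
Proof.
apply: (leq_trans (odd_prime_gt2 p_prime p_odd)).
by rewrite -{1}(expn1 p) leq_exp2l ?prime_gt1.
Qed.

Lemma q_odd : odd q.
Proof. by rewrite oddX p_odd orbT. Qed.

Lemma half_predq : q.-1 = (h * 2)%N.
Proof. by move: q_odd q_gt2; clear; lia. Qed.

(** From j C(n, j) = n C(n-1, j-1), since the valuation of j is at most j. *)
Lemma dvdn_bin_ppow L c j : (0 < j)%N -> (p ^ (L - j) %| 'C(c * p ^ L, j))%N.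
Proof.
case: j => // j _; have e := mul_bin_diag (c * p ^ L) j.
have [->|C0] := posnP 'C(c * p ^ L, j.+1); first by rewrite dvdn0.
have : (p ^ L %| j.+1 * 'C(c * p ^ L, j.+1))%N by rewrite -e -mulnA mulnCA dvdn_mulr.
rewrite !pfactor_dvdn ?muln_gt0 // lognM // => hL; rewrite leq_subLR.
by apply: (leq_trans hL); rewrite leq_add2r; apply/ltnW/ltn_logl.
Qed.

Lemma prime_dvd_bin_ppow j : (0 < j < q)%N -> (p %| 'C(q, j))%N.
Proof.
case: j => // j /andP[_ jq]; have e := mul_bin_diag q j.
apply: contraTT jq => pC; rewrite -leqNgt.
have : (q %| j.+1 * 'C(q, j.+1))%N by rewrite -e dvdn_mulr.
rewrite Gauss_dvdl ?coprime_pexpl ?prime_coprime //.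
exact: dvdn_leq.
Qed.

Lemma coef_1subX n i : ((1 - 'X : {poly W}) ^+ n)`_i = (-1) ^+ i * 'C(n, i)%:R.
Proof.
have -> : (1 - 'X : {poly W}) ^+ n = \poly_(i < n.+1) ((-1) ^+ i * 'C(n, i)%:R).
  rewrite exprDn poly_def; apply: eq_bigr => j _.
  rewrite expr1n mul1r (exprNn 'X) -mul_polyC -mulr_natr.
  by rewrite polyCM polyC_exp polyCN polyC_natr mulrAC.
by rewrite coef_poly ltnS; case: leqP => // lt; rewrite bin_small ?mulr0.
Qed.

(** Modulo p the coefficients (-1)^i C(q-1, i) of (1 - X)^(q-1) are 1, by Pascal's
    rule and C(q, i) = 0. *)
Lemma geom_poly_modp : exists2 Y : {poly W},
  rho = (1 - 'X) ^+ q.-1 + p%:R *: Y & (size Y <= q)%N.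
Proof.
have q0 : (0 < q)%N by apply: ltn_trans q_gt2.
have [i|z hz] := @choice _ _ (fun (i : nat) (z : W) =>
    (i < q)%N -> 1 - (-1) ^+ i * 'C(q.-1, i)%:R = p%:R * z).
  have [iq|_] := ltnP i q; last by exists 0.
  suff [z ez] : ppow_dvd p 1 (1 - (-1) ^+ i * 'C(q.-1, i)%:R : W) by exists z.
  elim: i iq => [|i IH] iq.
    by rewrite bin0 mulr1 subrr; apply: ppow_dvd0.
  have e : 'C(q, i.+1) = ('C(q.-1, i.+1) + 'C(q.-1, i))%N by rewrite -binS prednK.
  have -> : 1 - (-1) ^+ i.+1 * 'C(q.-1, i.+1)%:R =
     (1 - (-1) ^+ i * 'C(q.-1, i)%:R) + (-1) ^+ i * 'C(q, i.+1)%:R :> W.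
    by rewrite e natrD exprS; ring.
  apply: ppow_dvdD; first by apply: IH; apply: ltnW.
  by apply/ppow_dvdMl/ppow_dvd_nat; rewrite expn1 prime_dvd_bin_ppow.
exists (\poly_(i < q) z i); last exact: size_poly.
have -> : rho = \poly_(i < q) 1.
  by rewrite /geom_poly poly_def; apply: eq_bigr => i _; rewrite scale1r.
apply/polyP => i; rewrite coefD coefZ coef_1subX !coef_poly.
case: ltnP => iq; first by rewrite -hz // addrC subrK.
by rewrite bin_small ?mulr0 ?addr0 // prednK.
Qed.

(** The exponent K = M + (p^L + 1)/2 approximates M + 1/2. Modulo p^(M+1), the
    power rho^K is a polynomial H of small degree times (1 - X)^(h p^L), because
    each factor p in the expansion of ((1 - X)^(q-1) + p Y)^K costs only one
    factor (1 - X)^(q-1). The second factor is close to 1 in its coefficients of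
    low degree, and close to the quadratic character of 1 - t at the Teichmüller
    representative of t. *)
Lemma geom_poly_exp_cong M L : exists H : {poly W},
  [/\ (size H <= q.-1 * M.+1)%N,
      pcong p M.+1 (rho ^+ (M + (p ^ L).-1./2).+1) (H * (1 - 'X) ^+ (h * p ^ L))
    & H.[1] = 0].
Proof.
have q2 := q_gt2; have hq := half_predq.
have [Y eY sY] := geom_poly_modp.
set g := (p ^ L).-1./2; set K := (M + g).+1.
have eg : (2 * g.+1 = p ^ L + 1)%N.
  have : odd (p ^ L) by rewrite oddX p_odd orbT.
  have : (0 < p ^ L)%N by rewrite expn_gt0 prime_gt0.
  rewrite /g; lia.
exists (\sum_(j < M.+1) ('C(K, j)%:R * p%:R ^+ j) *:
   (Y ^+ j * (1 - 'X) ^+ (q.-1 * (M - j) + h))); split.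
- apply: (leq_trans (size_sum _ _ _)); apply/bigmax_leqP => j _.
  apply: (leq_trans (size_scale_leq _ _)); apply: (leq_trans (size_polyMleq _ _)).
  have -> : (1 - 'X : {poly W}) = - ('X - 1%:P) by rewrite opprB.
  rewrite exprNn; have -> n (P : {poly W}) : size ((-1) ^+ n * P) = size P.
    by rewrite -signr_odd; case: odd; rewrite ?expr1 ?mulN1r ?size_polyN ?mul1r.
  rewrite size_exp_XsubC addnS /=.
  have := size_poly_exp_leq Y j; have := ltn_ord j; rewrite ltnS => jM.
  have : (q.-1 * (M - j) = q.-1 * M - q.-1 * j)%N by rewrite mulnBr.
  have : ((size Y).-1 * j <= q.-1 * j)%N by rewrite leq_mul2r; apply/orP; right; lia.
  have : (q.-1 * j <= q.-1 * M)%N by rewrite leq_mul2l jM orbT.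
  rewrite mulnS; move: (q.-1 * j)%N (q.-1 * M)%N (q.-1 * (M - j))%N => u1 u2 u3.
  by move: ((size Y).-1 * j)%N (size (Y ^+ j)) => u4 u5; lia.
- rewrite eY exprDn mulr_suml.
  have MK : (M.+1 <= K.+1)%N by rewrite /K; lia.
  rewrite (big_ord_widen K.+1 (fun j => ('C(K, j)%:R * p%:R ^+ j) *:
   (Y ^+ j * (1 - 'X) ^+ (q.-1 * (M - j) + h)) * (1 - 'X) ^+ (h * p ^ L))) //.
  rewrite [X in pcong _ _ _ X]big_mkcond /=; apply: pcong_sum => j _.
  rewrite -mulr_natl exprZn -scalerAr -!mul_polyC !(polyC_natr, polyC_exp, polyCM).
  case: ltnP => jM; last first.
    rewrite /pcong subr0; apply: ppow_dvdMl; apply: ppow_dvdMr.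
    by apply: (@ppow_dvdW _ _ _ j) => //; exists 1; rewrite mulr1.
  have -> : (K - j = (M - j) + g.+1)%N.
    by have eK i : (i < M.+1)%N -> ((M + g).+1 - i = (M - i) + g.+1)%N; [lia | apply: eK].
  have e : (q.-1 * (M - j + g.+1) = (q.-1 * (M - j) + h) + h * p ^ L)%N.
    by rewrite mulnDr -addnA; congr (_ + _)%N; move: eg hq; set Q := (p ^ L)%N; nia.
  rewrite -exprM e exprD; set A := _ ^+ _; set B := _ ^+ (h * _).
  rewrite /pcong [X in ppow_dvd _ _ X](_ : _ = 0); first exact: ppow_dvd0.
  by ring.
- rewrite horner_sum big1 // => j _.
  rewrite hornerZ hornerM horner_exp !hornerE subrr expr0n.
  have h0 : (h == 0)%N = false by move: q2 hq; clear; lia.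
  by rewrite addn_eq0 h0 andbF /= !mulr0.
Qed.

Lemma coef_hpoly M L (H : {poly W}) m : (M + m <= L)%N ->
  pcong p M.+1 (rho ^+ (M + (p ^ L).-1./2).+1) (H * (1 - 'X) ^+ (h * p ^ L)) ->
  pcong p M H`_m (rho ^+ (M + (p ^ L).-1./2).+1)`_m.
Proof.
move=> hL [Z /(congr1 (fun P : {poly W} => P`_m))]; rewrite coefB => eZ.
apply: pcong_sym; apply: (pcong_trans (y := (H * (1 - 'X) ^+ (h * p ^ L))`_m)).
  rewrite /pcong eZ -polyC_natr -polyC_exp coefCM; apply: ppow_dvdMr.
  by apply: (@ppow_dvdW _ _ _ M.+1) => //; exists 1; rewrite mulr1.
rewrite coefM big_ord_recr /= subnn coef_1subX bin0 mul1r mulr1.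
rewrite -[X in pcong _ _ _ X]add0r; apply: pcongD; last exact: pcong_refl.
rewrite /pcong subr0; apply: ppow_dvd_sum => i _; apply: ppow_dvdMl.
rewrite coef_1subX; apply/ppow_dvdMl/ppow_dvd_nat.
have := ltn_ord i => im; apply: (dvdn_trans _ (@dvdn_bin_ppow L h (m - i) _)).
  by apply: dvdn_exp2l; lia.
by rewrite subn_gt0.
Qed.

Definition trace_term M K x k : W :=
  \sum_(j < (M - k).+1 | (j <= x)%N)
     (-1) ^+ j * ('C(K.+1, j) * multibin K (x - j))%:R.

(** With k = i - j, the exponent (q-1) i + b - q j of the expansion of rho^(K+1) is
    (q-1) k + b - j, so the coefficients regroup by k into truncated
    convolutions. *)
Lemma coef_trace M K b : (0 < b < q.-1)%N -> (M <= K)%N ->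
  \sum_(i < M.+1) (rho ^+ K.+1)`_(q.-1 * i + b) =
  \sum_(k < M.+1) trace_term M K (q.-1 * k + b) k.
Proof.
move=> /andP[b0 bq] MK; pose x k := (q.-1 * k + b)%N.
have q2 := q_gt2.
pose G j k : W := if (j <= x k)%N then (-1) ^+ j * ('C(K.+1, j) * multibin K (x k - j))%:R else 0.
transitivity (\sum_(i < M.+1) \sum_(j < i.+1) G j (i - j)%N); last first.
  rewrite triangular_sum; apply: eq_bigr => k _.
  by rewrite /trace_term [RHS]big_mkcond subSn // -ltnS.
apply: eq_bigr => i _; rewrite coef_geom_poly_exp; last by apply: ltn_trans q2.
have iK : (i.+1 <= K.+2)%N by have := ltn_ord i; lia.
rewrite (big_ord_widen _ (fun j => G j (i - j)%N) iK).
rewrite [LHS]big_mkcond [RHS]big_mkcond /=.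
apply: eq_bigr => j _; case: ltnP => [ji|ij]; last first.
  by rewrite leqNgt; have -> : (q.-1 * i + b < q * j)%N by nia.
have e : (q.-1 * i + b = x (i - j)%N + q.-1 * j)%N.
  by rewrite /x addnAC -mulnDr subnK.
have eq1 : (q * j = j + q.-1 * j)%N by rewrite -mulSn prednK // (ltn_trans _ q2).
by rewrite e eq1 leq_add2r subnDr /G.
Qed.

End GeometricSumPowers.

Section JacobiTrace.
Variables (p r : nat) (F : finFieldType) (W : idomainType) (res : {rmorphism W -> F}).
Hypothesis p_prime : prime p.
Hypothesis p_odd : odd p.
Hypothesis r_gt0 : (0 < r)%N.
Hypothesis cardF : #|F| = (p ^ r)%N.
Hypothesis U : unramified_integers p res.

Local Notation q := (p ^ r)%N.
Local Notation h := (q.-1./2).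
Local Notation T := (teichmuller res).
Local Notation rho := (geom_poly W q).

Definition jacobi_sum a : W :=
  \sum_(t : F | t != 0) (quadratic_char (1 - t))%:~R * T t ^+ a.

(** Euler's criterion in the residue field; the power p^L lifts it by L digits. *)
Lemma quadratic_char_teichmuller L (t : F) (w : W) : res w = t ->
  pcong p L.+1 (w ^+ (h * p ^ L)) (quadratic_char t)%:~R.
Proof.
move=> rw; have oF : odd #|F| by rewrite cardF (q_odd r p_odd).
have -> : (quadratic_char t)%:~R = ((quadratic_char t)%:~R : W) ^+ (p ^ L).
  rewrite /quadratic_char; case: ifP => _; last case: ifP => _.
  - by rewrite expr0n expn_eq0 eqn0Ngt prime_gt0.
  - by rewrite expr1n.
  - by rewrite rmorphN rmorph1 -signr_odd oddX p_odd orbT expr1.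
rewrite exprM -add1n; apply: pcongXpn => //; apply/(res_eq_pcong U).
by rewrite rmorphXn /= rw rmorph_int (quadratic_charE oF) cardF.
Qed.

(** If t is not 1, then rho has value 1 at the root of unity T = T t, since
    (1 - T) rho(T) = 1 - T^q = 1 - T. So H.[T] is inverse to the quadratic
    character of 1 - t, which is its own inverse. *)
Lemma hpoly_teichmuller M L (H : {poly W}) (t : F) : (M <= L)%N ->
  pcong p M.+1 (rho ^+ (M + (p ^ L).-1./2).+1) (H * (1 - 'X) ^+ (h * p ^ L)) ->
  H.[1] = 0 -> t != 0 ->
  pcong p M H.[T t] (quadratic_char (1 - t))%:~R.
Proof.
move=> ML hH H1 t0; have [->|t1] := eqVneq t 1.
  rewrite (teichmuller1 p_prime r_gt0 cardF U) H1 subrr /quadratic_char eqxx.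
  exact: pcong_refl.
have rT : res (1 - T t) = 1 - t.
  by rewrite rmorphB rmorph1 (teichmuller_res p_prime r_gt0 cardF U).
have T1 : 1 - T t != 0.
  by apply: contra_neq t1 => e; move: rT; rewrite e rmorph0 => /esym/eqP; rewrite subr_eq0 => /eqP.
have rho1 : rho.[T t] = 1.
  apply: (mulfI T1); have := congr1 (fun P : {poly W} => P.[T t]) (geom_polyE W q).
  rewrite hornerM !hornerE => ->.
  have := teichmuller_exp p_prime r_gt0 cardF U t0; have := q_gt2 p_prime p_odd r_gt0.
  by case: (q) => // q' _ /= e; rewrite exprS e !mulr1.
case: hH => Z /(congr1 (fun P : {poly W} => P.[T t])).
have e1X : (1 - 'X : {poly W}).[T t] = 1 - T t by rewrite !hornerE.
rewrite hornerD hornerN hornerM !horner_exp rho1 expr1n e1X => eZ.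
have e1 : pcong p M (H.[T t] * (quadratic_char (1 - t))%:~R) 1.
  apply: pcong_sym; apply: (pcong_trans (y := H.[T t] * (1 - T t) ^+ (h * p ^ L))).
    rewrite /pcong eZ hornerM horner_exp -polyC_natr hornerC.
    by apply: ppow_dvdMr; apply: (@ppow_dvdW _ _ _ M.+1) => //; exists 1; rewrite mulr1.
  apply: pcongMl; apply: (@pcongW _ _ _ L.+1); first exact: leqW.
  exact: quadratic_char_teichmuller.
have sq : ((quadratic_char (1 - t))%:~R : W) * (quadratic_char (1 - t))%:~R = 1.
  rewrite /quadratic_char subr_eq0 eq_sym (negPf t1); case: ifP => _; first by rewrite mulr1.
  by rewrite rmorphN rmorph1 mulrNN mulr1.
have := pcongMr (quadratic_char (1 - t))%:~R e1.
by rewrite -mulrA sq mulr1 mul1r.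
Qed.

(** Orthogonality of characters: only the exponents congruent to b modulo q - 1
    survive the sum over t. *)
Lemma sum_teichmuller_horner M b (H : {poly W}) : (0 < b < q.-1)%N ->
  (size H <= q.-1 * M.+1)%N ->
  \sum_(t : F | t != 0) H.[T t] * T t ^+ (q.-1 - b) =
  q.-1%:R * \sum_(i < M.+1) H`_(q.-1 * i + b).
Proof.
move=> /andP[b0 bq] sH; have q0 : (0 < q.-1)%N by apply: leq_ltn_trans bq.
transitivity (\sum_(0 <= m < M.+1 * q.-1) H`_m * \sum_(t : F | t != 0) T t ^+ (m + (q.-1 - b))).
  rewrite big_mkord; under [RHS]eq_bigr => m _ do rewrite mulr_sumr.
  rewrite exchange_big /=; apply: eq_bigr => t t0.
  rewrite mulnC in sH; rewrite (horner_coef_wide _ sH) mulr_suml; apply: eq_bigr => m _.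
  by rewrite exprD mulrA.
rewrite big_nat_mul mulr_sumr big_mkord; apply: eq_bigr => i _.
rewrite -{1}[(i * _)%N]add0n big_addn mulSn addnK big_mkord.
rewrite (bigD1 (Ordinal bq)) //= [X in _ + X]big1 ?addr0 => [|s sb].
  rewrite (sum_teichmuller_exp p_prime r_gt0 cardF U) mulnC addnC.
  have -> : (q.-1 * i + b + (q.-1 - b) = i.+1 * q.-1)%N.
    by rewrite -addnA subnKC ?(ltnW bq) // mulSn mulnC addnC.
  by rewrite dvdn_mull // mulrC.
rewrite (sum_teichmuller_exp p_prime r_gt0 cardF U) addnAC dvdn_addl ?dvdn_mull //.
case: ifP; rewrite ?mulr0 // => /dvdnP[c ec].
have := ltn_ord s; move/eqP: sb => sb sq; case: sb; apply/val_inj => /=.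
by case: c ec => [|[|c]]; nia.
Qed.

End JacobiTrace.

Section JacobiNewton.
Variables (p r : nat) (F : finFieldType) (W : idomainType) (res : {rmorphism W -> F}).
Hypothesis p_prime : prime p.
Hypothesis p_odd : odd p.
Hypothesis r_gt0 : (0 < r)%N.
Hypothesis cardF : #|F| = (p ^ r)%N.
Hypothesis U : unramified_integers p res.

Local Notation q := (p ^ r)%N.

Variables (b : nat) (sigma : W).
Hypothesis b_bound : (0 < b < q.-1)%N.
Hypothesis sigmaE : q%:R * sigma = sigma + b%:R.

(** The closed forms turn the truncated convolution into a Lagrange interpolation
    term at the node k, up to the replacement of 1/2 by (p^L + 1)/2. The division
    by m ^_ (m - k) and by (q-1) k + b costs digits, but a number of them that is
    independent of L. *)
Lemma trace_term_cong (f : nat -> W) M L k (B : {poly W}) :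
  (k <= M)%N ->
  let m := (q * k + b)%N in
  f k * (m ^_ (m - k))%:R = \prod_(k <= i < m) (2%:R^-1 + i%:R) ->
  (k%:R + sigma) * B.[k%:R] = f k * (m ^_ M.+1)%:R ->
  pcong p (L - logn p (m ^_ (m - k) * (q.-1 * k + b)))
    (M`!%:R * (q.-1%:R * trace_term W M (M + (p ^ L).-1./2) (q.-1 * k + b) k))
    ((-1) ^+ (M - k) * B.[k%:R] *+ 'C(M, k)).
Proof.
move=> kM m hf hB; have /andP[b0 bq] := b_bound.
set g := (p ^ L).-1./2; set x := (q.-1 * k + b)%N; set D := (m ^_ (m - k))%N.
have q2 := q_gt2 p_prime p_odd r_gt0.
have eqS : q = q.-1.+1 by rewrite prednK // (ltnW (ltnW q2)).
have em : m = (x + k)%N by rewrite /m /x {1}eqS mulSn -addnA addnC.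
have D0 : (0 < D)%N by rewrite ffact_gt0 leq_subr.
have x0 : (0 < x)%N by rewrite addn_gt0 b0 orbT.
set t := trace_term _ _ _ _ _.
have eT : (D * M`!)%:R * (x%:R * t) =
    (-1) ^+ (M - k) * ('C(M, k) * m ^_ M.+1)%:R * \prod_(k <= i < m) (g.+1%:R + i%:R).
  rewrite /t /trace_term truncated_convolution.
  have [Mm|mM] := leqP M m; last first.
    have -> : (x - (M - k) = 0)%N by lia.
    by rewrite !muln0 mulr0 (ffact_small (ltnW mM : (m < M.+1)%N)) muln0 !mulr0 mul0r.
  have ey : m = (M + (x - (M - k)))%N by lia.
  have := @truncated_convolution_closed M k (x - (M - k)) g kM.
  rewrite -ey -/D => /(congr1 (fun n => n%:R : W)); rewrite [in RHS]natrM natr_prod.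
  under eq_bigr do rewrite natrD.
  by move=> e; rewrite -[RHS]mulrA -e mulrCA -natrM.
have hx : x%:R = q.-1%:R * (k%:R + sigma).
  rewrite natrD natrM mulrDr; congr (_ + _); apply: (addrI sigma).
  by rewrite -sigmaE -[in LHS](prednK (ltnW (ltnW q2))) -natr1; ring.
have fin : pcong p L ((D * x)%:R * (M`!%:R * (q.-1%:R * t)))
    ((D * x)%:R * ((-1) ^+ (M - k) * B.[k%:R] *+ 'C(M, k))).
  have -> : (D * x)%:R * (M`!%:R * (q.-1%:R * t)) =
      q.-1%:R * ((D * M`!)%:R * (x%:R * t)) by rewrite !natrM; ring.
  have -> : (D * x)%:R * ((-1) ^+ (M - k) * B.[k%:R] *+ 'C(M, k)) =
     q.-1%:R * ((-1) ^+ (M - k) * ('C(M, k) * m ^_ M.+1)%:R * (f k * D%:R)).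
    rewrite -mulr_natl natrM hx [in RHS]natrM.
    have -> : q.-1%:R * ((-1) ^+ (M - k) * ('C(M, k)%:R * (m ^_ M.+1)%:R) * (f k * D%:R)) =
      q.-1%:R * (-1) ^+ (M - k) * 'C(M, k)%:R * D%:R * (f k * (m ^_ M.+1)%:R) by ring.
    by rewrite -hB; ring.
  apply: pcongMl; rewrite eT; apply: pcongMl; rewrite hf.
  apply: pcong_prod => i _; apply: pcongD; last exact: pcong_refl.
  exact: (half_approx p_prime p_odd U).
have [le|lt] := leqP (logn p (D * x)) L; last by rewrite (eqP (ltnW lt)); apply: pcong0.
apply: (@ppow_dvd_natM p F W res p_prime U _ (D * x)); first by rewrite muln_gt0 D0.
by rewrite mulrBr subnK.
Qed.

(** L is taken large enough to make up for all losses of precision; then the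
    Jacobi sum is a sum over the nodes 0, ..., M, to be evaluated as the value
    of the Newton series of -f at the fixed point -sigma. *)
Lemma jacobi_newton (f alpha : nat -> W) M :
  (forall k, let m := (q * k + b)%N in
     f k * (m ^_ (m - k))%:R = \prod_(k <= i < m) (2%:R^-1 + i%:R)) ->
  (forall j, ppow_dvd p (j %/ 6) (alpha j)) ->
  (forall n, f n = \sum_(j < n.+1) alpha j * (n ^_ j)%:R) ->
  pcong p (M %/ 6) (jacobi_sum res (q.-1 - b))
    (- \sum_(j < M.+1) alpha j * (ffpoly W j).[- sigma]).
Proof.
move=> hf halpha hN; have /andP[b0 bq] := b_bound.
have [B [c [hB hc hl]]] :=
  trace_evaluation p_prime (dvdn_exp r_gt0 (dvdnn p)) sigmaE M halpha hN.
set v := logn p M`!.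
pose V := (\sum_(k < M.+1) logn p ((q * k + b) ^_ (q * k + b - k) * (q.-1 * k + b)))%N.
pose L := (M + (q.-1 * M + b) + v + V)%N; set K := (M + (p ^ L).-1./2)%N.
have [H [sH cH H1]] := geom_poly_exp_cong W p_prime p_odd r_gt0 M L.
apply: pcong_trans hl; apply: (@pcongW _ _ _ M); first exact: leq_div.
apply: (pcong_trans (y := \sum_(t : F | t != 0) H.[teichmuller res t] * teichmuller res t ^+ (q.-1 - b))).
  apply: pcong_sum => t t0; apply: pcongMr; apply: pcong_sym.
  have ML : (M <= L)%N by rewrite /L -!addnA leq_addr.
  exact: (hpoly_teichmuller p_prime p_odd r_gt0 cardF U ML cH).
rewrite (sum_teichmuller_horner p_prime p_odd r_gt0 cardF U b_bound sH).
apply: (pcong_trans (y := q.-1%:R * \sum_(i < M.+1) (geom_poly W q ^+ K.+1)`_(q.-1 * i + b))).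
  apply: pcongMl; apply: pcong_sum => i _.
  apply: (coef_hpoly p_prime p_odd r_gt0 _ cH); rewrite /L -!addnA !leq_add2l.
  have le : (q.-1 * i <= q.-1 * M)%N by rewrite leq_mul2l -ltnS ltn_ord orbT.
  by move: le; move: (q.-1 * i)%N (q.-1 * M)%N => u1 u2; lia.
rewrite (coef_trace W p_prime p_odd r_gt0 b_bound); last by rewrite /K leq_addr.
rewrite mulr_sumr; apply: (@ppow_dvd_natM p F W res p_prime U _ M`! _ (fact_gt0 M)).
rewrite -/v mulrBr -hc mulr_sumr /ddiff iter_fdiffE.
apply: pcong_sum => k _; rewrite add0n.
have kM : (k <= M)%N by rewrite -ltnS.
apply: pcongW (trace_term_cong L kM (hf k) (hB k kM)).
have le : (logn p ((q * k + b) ^_ (q * k + b - k) * (q.-1 * k + b)) <= V)%N.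
  by rewrite /V (bigD1 k) //= leq_addr.
apply: leq_trans (leq_sub2l L le).
by rewrite /L addnK leq_add2r leq_addr.
Qed.

End JacobiNewton.

(** * Rising factorials and their p-adic unit parts *)

Section RisingFactorial.
Variable W : idomainType.
Implicit Types (c : W) (m n : nat).

Definition poch c n := \prod_(0 <= i < n) (c + i%:R).

Lemma poch0 c : poch c 0 = 1.
Proof. by rewrite /poch big_geq. Qed.

Lemma pochS c n : poch c n.+1 = poch c n * (c + n%:R).
Proof. by rewrite /poch big_nat_recr. Qed.

Lemma poch1E n : poch 1 n = n`!%:R.
Proof.
elim: n => [|n IH]; first by rewrite poch0.
by rewrite pochS IH factS natrM -natr1 mulrC addrC.
Qed.

End RisingFactorial.

Section BlockProduct.
Variables (p : nat) (F : finFieldType) (W : idomainType) (res : {rmorphism W -> F}).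
Hypothesis p_prime : prime p.
Hypothesis p_odd : odd p.
Hypothesis U : unramified_integers p res.

Lemma natF_eq m n : m = n %[mod p] -> m%:R = n%:R :> F.
Proof.
have e k : (k %% p)%:R = k%:R :> F.
  by rewrite [in RHS](divn_eq k p) natrD natrM (res_p U) mulr0 add0r.
by move=> h; rewrite -(e m) h e.
Qed.

Lemma natF_exp_pred n : ~~ (p %| n)%N -> (n%:R : F) ^+ p.-1 = 1.
Proof.
move=> pn; have n0 := natF_neq0 p_prime U pn; apply: (mulfI n0).
rewrite -exprS prednK ?prime_gt0 // mulr1 -natrX.
exact/natF_eq/fermat_little.
Qed.

(** Both sides are monic of degree p - 1 and vanish at -1, ..., -(p - 1). *)
Lemma prod_prime_field : \prod_(1 <= s < p) ('X + s%:R%:P) = 'X^(p.-1) - 1 :> {poly F}.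
Proof.
have p2 := odd_prime_gt2 p_prime p_odd.
set P := bigop _ _ _; apply/eqP; rewrite -subr_eq0; apply/eqP.
have Pm : P \is monic by apply: monic_prod => s _; apply: monicXaddC.
have szP : size P = p.
  rewrite /P -{2}(prednK (prime_gt0 p_prime)) -{1}(prednK (prime_gt0 p_prime)).
  elim: p.-1 => [|n IH]; first by rewrite big_geq ?size_poly1.
  rewrite big_nat_recr //= size_Mmonic ?monicXaddC ?IH ?size_XaddC ?addn2 //.
  by rewrite -size_poly_eq0 IH.
have Qm : 'X^(p.-1) - 1 \is @monic F by rewrite monicXnsubC // -subn1 subn_gt0; lia.
have szQ : size ('X^(p.-1) - 1 : {poly F}) = p.
  have p1 : (0 < p.-1)%N by move: p2; clear; lia.
  by rewrite size_XnsubC // prednK ?prime_gt0.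
apply: (@roots_geq_poly_eq0 _ _ [seq - s%:R | s <- index_iota 1 p]).
- apply/allP => _ /mapP[s hs ->]; move: (hs); rewrite mem_index_iota => /andP[s0 sp].
  rewrite /root hornerD hornerN /P horner_prod (big_rem s) //= !hornerE addNr mul0r sub0r.
  have -> : (- s%:R : F) ^+ p.-1 = 1.
    rewrite exprNn natF_exp_pred; last by rewrite gtnNdvd.
    have -> : p.-1 = (p.-1./2 * 2)%N by move: p_odd p2; clear; lia.
    by rewrite exprM sqrr_sign mulr1.
  by rewrite subrr oppr0.
- rewrite map_inj_in_uniq ?iota_uniq // => s t.
  wlog le : s t / (s <= t)%N => [hw|].
    by case/orP: (leq_total s t) => le hs ht e; [apply: hw | apply/esym/hw].
  rewrite !mem_index_iota => /andP[s0 sp] /andP[t0 tp] /oppr_inj e.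
  apply/eqP; rewrite eqn_leq le leqNgt; apply/negP=> lt.
  have pn : ~~ (p %| t - s)%N by rewrite gtnNdvd ?subn_gt0 //; lia.
  by have := natF_neq0 p_prime U pn; rewrite natrB // e subrr eqxx.
- rewrite size_map size_iota subn1 -ltnS prednK ?prime_gt0 //.
  rewrite -[X in (_ < X)%N](prednK (prime_gt0 p_prime)) ltnS.
  apply/leq_sizeP => i pi; rewrite coefB.
  have [ei|ni] := eqVneq i p.-1.
    move: Pm Qm; rewrite !monicE !lead_coefE szP szQ -ei => /eqP -> /eqP ->.
    by rewrite subrr.
  by rewrite !nth_default ?subrr ?szP ?szQ //; lia.
Qed.

End BlockProduct.

Section UnitPart.
Variables (p : nat) (F : finFieldType) (W : idomainType) (res : {rmorphism W -> F}).
Hypothesis p_prime : prime p.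
Hypothesis p_odd : odd p.
Hypothesis U : unramified_integers p res.

(** The hypothesis says that c + i0 is the first multiple p c in the progression
    c, c + 1, ...; it holds for c = 1 and c = 1/2, the fixed points of
    Dwork's map c -> (c + i0) / p. *)
Variables (c : W) (i0 : nat).
Hypothesis i0_lt : (i0 < p)%N.
Hypothesis cE : p%:R * c = c + i0%:R.

Definition unit_poch m := \prod_(0 <= i < m | i != i0 %[mod p]) (c + i%:R).

Lemma dvd_shift m : (m == i0 %[mod p]) = (p %| m + (p - i0))%N.
Proof.
by rewrite -(eqn_modDr (p - i0)) subnKC ?(ltnW i0_lt) // modnn.
Qed.

Lemma unit_pochS m :
  unit_poch m.+1 = unit_poch m * if m != i0 %[mod p] then c + m%:R else 1.
Proof. by rewrite /unit_poch !(big_mkcond (fun i => i != i0 %[mod p])) big_nat_recr. Qed.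

(** The multiples of p among the factors are p c, p (c + 1), ..., p (c + t - 1). *)
Lemma poch_split m : let t := ((m + (p.-1 - i0)) %/ p)%N in
  poch c m = unit_poch m * p%:R ^+ t * poch c t.
Proof.
have p0 := prime_gt0 p_prime.
elim: m => [|m IH] /=.
  by rewrite add0n divn_small ?poch0 /unit_poch ?big_geq ?mulr1 //; lia.
rewrite addSn divnS // unit_pochS pochS IH dvd_shift.
have -> : (m + (p.-1 - i0)).+1 = (m + (p - i0))%N by lia.
case: (boolP (p %| m + (p - i0))%N) => [/dvdnP[[|s] es]|_] /=; first by lia.
  set t := ((m + (p.-1 - i0)) %/ p)%N.
  have -> : t = s.
    rewrite /t; have -> : (m + (p.-1 - i0) = s * p + p.-1)%N.
      by move: es; rewrite mulSn; lia.
    by rewrite divnMDl // divn_small ?addn0 // prednK.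
  rewrite add1n pochS exprS mulr1.
  have -> : c + m%:R = p%:R * (c + s%:R).
    rewrite mulrDr cE -addrA -natrM -natrD; congr (_ + _%:R).
    by move: es; rewrite mulSn mulnC; lia.
  by ring.
by rewrite add0n; ring.
Qed.

Lemma res_c : res c = - i0%:R.
Proof.
have := congr1 res cE; rewrite rmorphM rmorphD !rmorph_nat (res_p U) mul0r => /esym/eqP.
by rewrite addr_eq0 => /eqP.
Qed.

Lemma unit_factor i : i != i0 %[mod p] -> c + i%:R \is a GRing.unit.
Proof.
move=> ii; apply: (unit_res U); rewrite rmorphD res_c rmorph_nat /= addrC.
have -> : i%:R - i0%:R = (i + (p - i0))%:R :> F.
  by rewrite natrD natrB ?(ltnW i0_lt) // (res_p U) sub0r.
by apply: (natF_neq0 p_prime U); rewrite -dvd_shift.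
Qed.

Lemma unit_poch_unit m : unit_poch m \is a GRing.unit.
Proof.
by rewrite /unit_poch; elim/big_ind: _ => [|x y ux uy|i]; rewrite ?unitr1 ?unitrM ?ux //;
  apply: unit_factor.
Qed.

Definition block_poly mu : {poly W} :=
  \prod_(mu <= i < mu + p | i != i0 %[mod p]) ('X + (c + i%:R)%:P).

(** Modulo p a block runs over the nonzero residues. *)
Lemma block_poly_res mu : map_poly res (block_poly mu) = 'X^(p.-1) - 1.
Proof.
have p0 := prime_gt0 p_prime.
pose g i : {poly F} := 'X + (i%:R - i0%:R)%:P.
pose G i := if i != i0 %[mod p] then g i else 1.
have -> : map_poly res (block_poly mu) = \prod_(mu <= i < mu + p) G i.
  rewrite /block_poly rmorph_prod /= [RHS]big_mkcond /= big_mkcond; apply: eq_bigr => i _.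
  rewrite /G /g; case: ifP => _; last exact: rmorph1.
  rewrite rmorphD /= map_polyX map_polyC /= rmorphD res_c rmorph_nat.
  by rewrite (addrC i%:R).
have perG i : G (i + p)%N = G i by rewrite /G modnDr /g natrD (res_p U) addr0.
have shift n : \prod_(n <= i < n + p) G i = \prod_(i0 <= i < i0 + p) G i.
  have stepG k : \prod_(k.+1 <= i < k.+1 + p) G i = \prod_(k <= i < k + p) G i.
    rewrite [RHS]big_ltn; last by rewrite -{1}[k]addn0 ltn_add2l.
    by rewrite addSn big_nat_recr /= ?perG 1?mulrC // -{1}[k]addn0 ltn_add2l.
  have all0 k : \prod_(k <= i < k + p) G i = \prod_(0 <= i < 0 + p) G i.
    by elim: k => // k <-; apply: stepG.
  by rewrite !all0.
rewrite shift -(prod_prime_field p_prime p_odd U) big_ltn; last by rewrite -{1}[i0]addn0 ltn_add2l.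
rewrite {1}/G eqxx /= mul1r -{1}[i0.+1]add1n [X in \prod_(_ <= i < X) _]addnC big_addn addnK.
apply: eq_big_nat => s /andP[s0 sp]; rewrite /G /g natrD addrK ifT //.
by rewrite -[in X in _ != X](add0n i0) eqn_modDr mod0n modn_small // -lt0n.
Qed.

Lemma unit_poch_block n mu :
  unit_poch (p * n.+1 + mu) = unit_poch (p * n + mu) * (block_poly mu).[p%:R * n%:R].
Proof.
have e : (p * n.+1 + mu = (mu + p) + p * n)%N by rewrite mulnS; lia.
rewrite /unit_poch e (@big_cat_nat _ _ _ (p * n + mu)%N) //=; last by lia.
congr (_ * _); rewrite addnC big_addn addnK horner_prod.
apply: eq_big => [i|i _]; first by rewrite (addnC i) mulnC modnMDl.
by rewrite hornerD hornerX hornerC natrD natrM; ring.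
Qed.

Definition block_correction mu : {poly W} := - block_poly mu - 1.

(** As p - 1 >= 2, the polynomial X^(p-1) - 1 has no linear coefficient, and the
    factor -1 is removed in the correction. *)
Lemma block_correction_small mu m :
  fdiff_small p 1 m (fun n => (block_correction mu).[p%:R * n%:R]).
Proof.
have p2 := odd_prime_gt2 p_prime p_odd.
have coefE i : res (block_correction mu)`_i = - ('X^(p.-1) - 1 : {poly F})`_i - (i == 0)%:R.
  by rewrite /block_correction -(block_poly_res mu) coefB coefN coef1 coef_map rmorphB rmorphN rmorph_nat.
apply: fdiff_small_poly; apply/(res_eq0 U); rewrite coefE coefB coefXn coef1 /=.
  have -> : (0%N == p.-1) = false by move: p2; clear; lia.
  by rewrite sub0r opprK subrr.
have -> : (1%N == p.-1) = false by move: p2; clear; lia.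
by rewrite !(mulr0n, subr0, oppr0).
Qed.

(** The sign (-1)^n turns the factor -1 of each block into 1 + O(p). *)
Definition signed_unit_poch mu n := (-1) ^+ n * unit_poch (p * n + mu).

Lemma signed_unit_poch_rec mu n : signed_unit_poch mu n.+1 - signed_unit_poch mu n =
  (block_correction mu).[p%:R * n%:R] * signed_unit_poch mu n.
Proof.
rewrite /signed_unit_poch unit_poch_block exprS /block_correction !(hornerD, hornerN, hornerC).
by ring.
Qed.

Lemma signed_unit_poch_unit mu n : signed_unit_poch mu n \is a GRing.unit.
Proof. by rewrite unitrM unitrX ?unitrN1 ?unit_poch_unit. Qed.

Lemma signed_unit_poch_small mu m : fdiff_small p 0 m (signed_unit_poch mu).
Proof.
apply: fdiff_small_recl (signed_unit_poch_rec mu) => m'.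
exact: block_correction_small.
Qed.

Lemma signed_unit_poch_inv_small mu m :
  fdiff_small p 0 m (fun n => (signed_unit_poch mu n)^-1).
Proof.
apply: (@fdiff_small_recr _ _ (fun n => -1 * (block_correction mu).[p%:R * n%:R])) => [m'|n].
  move=> j jm n; rewrite iter_fdiffZ; apply: ppow_dvdMl.
  exact: block_correction_small jm n.
have u0 := signed_unit_poch_unit mu n; have u1 := signed_unit_poch_unit mu n.+1.
have := signed_unit_poch_rec mu n; move: u0 u1.
set a := signed_unit_poch mu n; set a' := signed_unit_poch mu n.+1.
set k := _.[_] => u0 u1 rec; apply: (mulrI u1); apply: (mulrI u0).
have -> : a * (a' * (a'^-1 - a^-1)) = a * (a' * a'^-1) - a' * (a * a^-1) by ring.
have -> : a * (a' * (-1 * k * a'^-1)) = - (k * a) * (a' * a'^-1) by ring.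
by rewrite !mulrV // !mulr1 -rec opprB.
Qed.

End UnitPart.

Section BinomialRatio.
Variables (p : nat) (F : finFieldType) (W : idomainType) (res : {rmorphism W -> F}).
Hypothesis p_prime : prime p.
Hypothesis p_odd : odd p.
Hypothesis U : unramified_integers p res.

Local Notation half := (2%:R^-1 : W).

Lemma fixed_one : p%:R * 1 = 1 + p.-1%:R :> W.
Proof. by rewrite mulr1 -{1}(prednK (prime_gt0 p_prime)) -natr1 addrC. Qed.

Lemma mul2half : 2%:R * half = 1.
Proof. by rewrite mulrV // (two_unit p_prime p_odd U). Qed.

Lemma fixed_half : p%:R * half = half + p.-1./2%:R.
Proof.
apply: (mulrI (two_unit p_prime p_odd U)).
rewrite mulrDr mulrCA mul2half mulr1 -natrM.
have -> : (2 * p.-1./2 = p.-1)%N by move: p_odd; clear; lia.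
by rewrite -{1}(prednK (prime_gt0 p_prime)) -natr1 addrC.
Qed.

Lemma half_lt : (p.-1./2 < p)%N.
Proof. by have := prime_gt0 p_prime; clear; lia. Qed.

Lemma poch1_neq0 n : poch (1 : W) n != 0.
Proof. by rewrite poch1E (natW_neq0 p_prime U) ?fact_gt0. Qed.

Lemma half_add_neq0 n : half + n%:R != 0.
Proof.
apply: contraTneq isT => e.
have := congr1 (fun x => 2%:R * x) e; rewrite mulr0 mulrDr mul2half -natrM addrC natr1.
by move/eqP; rewrite (negPf (natW_neq0 p_prime U _)).
Qed.

Lemma poch_half_neq0 n : poch half n != 0.
Proof. by rewrite /poch prodf_seq_neq0; apply/allP => i _; rewrite half_add_neq0. Qed.

Definition uone m := unit_poch p (1 : W) p.-1 m.
Definition uhalf m := unit_poch p half p.-1./2 m.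

Lemma poch1_split m : poch (1 : W) m = uone m * p%:R ^+ (m %/ p) * poch 1 (m %/ p).
Proof.
have lt : (p.-1 < p)%N by rewrite prednK ?prime_gt0.
by have /= := poch_split p_prime p_odd lt fixed_one m; rewrite subnn addn0.
Qed.

Lemma poch_half_split m : let t := ((m + p.-1./2) %/ p)%N in
  poch half m = uhalf m * p%:R ^+ t * poch half t.
Proof.
have /= := poch_split p_prime p_odd half_lt fixed_half m.
by have -> : (p.-1 - p.-1./2 = p.-1./2)%N by move: p_odd; clear; lia.
Qed.

(** Both products split into unit parts, equally many factors p, and shorter
    products; the numerator has one more factor p (n + 1/2) when mu lies beyond
    the multiple of p in the last block. *)
Lemma ratio_step mu : (mu < p)%N -> exists R : nat -> W,
  (forall m, fdiff_small p 0 m R) /\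
  forall n, R n * (poch 1 (p * n + mu) * poch half n) =
            poch half (p * n + mu) * poch 1 n.
Proof.
move=> mup; pose eps := (p <= mu + p.-1./2)%N.
have lt : (p.-1 < p)%N by rewrite prednK ?prime_gt0.
exists (fun n => signed_unit_poch p half p.-1./2 mu n *
  (signed_unit_poch p 1 p.-1 mu n)^-1 * (if eps then p%:R * (n%:R + half) else 1)).
split=> [m|n].
  apply: (@fdiff_smallM _ _ 0 0); first apply: (@fdiff_smallM _ _ 0 0).
  - exact: (signed_unit_poch_small p_prime p_odd U half_lt fixed_half).
  - exact: (signed_unit_poch_inv_small p_prime p_odd U lt fixed_one).
  - by case: (eps); [apply: fdiff_small_linear | apply: fdiff_small_const].
rewrite (poch1_split (p * n + mu)) (poch_half_split (p * n + mu)) /=.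
have e1 : ((p * n + mu) %/ p = n)%N by rewrite mulnC divnMDl ?prime_gt0 // divn_small ?addn0.
have e2 : ((p * n + mu + p.-1./2) %/ p = n + eps)%N.
  rewrite -addnA mulnC divnMDl ?prime_gt0 //; congr (_ + _)%N; rewrite /eps.
  have hlt := half_lt; case: leqP => h; last by rewrite divn_small.
  by rewrite -(subnK h) divnDr // divnn prime_gt0 // divn_small // ltn_subLR //; lia.
rewrite e1 e2 /signed_unit_poch -/(uone (p * n + mu)) -/(uhalf (p * n + mu)).
have u1 : uone (p * n + mu) \is a GRing.unit by apply: (unit_poch_unit p_prime U lt fixed_one).
have us : (-1) ^+ n \is a @GRing.unit W by rewrite unitrX ?unitrN1.
rewrite invrM //; set a := uone _; set s := (-1) ^+ n; set b := uhalf _.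
have -> X : s * b * (a^-1 * s^-1) * X * (a * p%:R ^+ n * poch 1 n * poch half n) =
  (s * s^-1) * (a * a^-1) * (b * X * p%:R ^+ n * poch half n * poch 1 n) by ring.
rewrite !mulrV // !mul1r; case: (eps) => /=; last by rewrite addn0 mulr1.
by rewrite addn1 pochS exprSr; ring.
Qed.

(** One step for each of the s digits of b in base p. *)
Lemma ratio_exists s b : (b < p ^ s)%N -> exists R : nat -> W,
  (forall m, fdiff_small p 0 m R) /\
  forall n, R n * (poch 1 (p ^ s * n + b) * poch half n) =
            poch half (p ^ s * n + b) * poch 1 n.
Proof.
have p0 := prime_gt0 p_prime.
elim: s b => [|s IH] b hb.
  exists (fun=> 1); split=> [m|n]; first exact: fdiff_small_const.
  by move: hb; rewrite expn0 ltnS leqn0 => /eqP ->; rewrite mul1n addn0 mul1r mulrC.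
have hb1 : (b %/ p < p ^ s)%N by rewrite ltn_divLR // -expnSr.
have [R1 [sm1 e1]] := IH _ hb1; have [R2 [sm2 e2]] := ratio_step (ltn_pmod b p0).
exists (fun n => R2 (p ^ s * n + b %/ p)%N * R1 n); split=> [m|n].
  by apply: (@fdiff_smallM _ _ 0 0) => //; apply: fdiff_small_affine.
have em : (p * (p ^ s * n + b %/ p) + b %% p = p ^ s.+1 * n + b)%N.
  by rewrite mulnDr mulnA -expnS -addnA [(p * (b %/ p))%N]mulnC -divn_eq.
set m1 := (p ^ s * n + b %/ p)%N in em *.
apply: (mulfI (poch1_neq0 m1)); apply: (mulfI (poch_half_neq0 m1)).
rewrite -em; set m := (p * m1 + _)%N.
have -> : poch half m1 * (poch 1 m1 * (R2 m1 * R1 n * (poch 1 m * poch half n))) =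
  (R2 m1 * (poch 1 m * poch half m1)) * (R1 n * (poch 1 m1 * poch half n)) by ring.
by rewrite e1 /m e2; ring.
Qed.

End BinomialRatio.

(** * The p-adic gamma values of the Jacobi sums *)

Section ZpElements.
Variables (p : nat) (F : finFieldType) (W : idomainType) (res : {rmorphism W -> F}).
Hypothesis p_prime : prime p.
Hypothesis p_odd : odd p.
Hypothesis U : unramified_integers p res.

Lemma zpM (x y : W) : zp p x -> zp p y -> zp p (x * y).
Proof.
move=> zx zy N; have [m hm] := zx N; have [n hn] := zy N.
by exists (m * n)%N; rewrite natrM; apply: pcongM.
Qed.

Lemma zpN (x : W) : zp p x -> zp p (- x).
Proof.
move=> zx; rewrite -mulN1r; apply: zpM => // N.
exists (p ^ N).-1; rewrite /pcong opprK natr1 prednK ?expn_gt0 ?prime_gt0 //.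
exact/ppow_dvd_nat.
Qed.

Lemma zp_int (z : int) : zp p (z%:~R : W).
Proof. by case: z => n; [|rewrite NegzE rmorphN; apply: zpN]; apply: zp_nat. Qed.

Lemma zp_invn m : ~~ (p %| m)%N -> zp p ((m%:R : W)^-1).
Proof.
move=> pm N; exists (m ^ (totient (p ^ N)).-1)%N.
have um := unit_nat p_prime U pm; apply: (ppow_dvd_unit um).
rewrite mulrBr mulrV // -natrM -expnS prednK ?totient_gt0 ?expn_gt0 ?prime_gt0 //.
apply: (@pcong_nat _ _ _ _ 1%N); apply: Euler_exp_totient.
by rewrite coprimeXr // coprime_sym prime_coprime.
Qed.

Lemma zp_half : zp p (2%:R^-1 : W).
Proof. by move=> N; exists (p ^ N).-1./2.+1; apply: (half_approx p_prime p_odd U). Qed.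

(** The functional equation of Gamma_p skips the same factors as [unit_poch], the
    multiples of p. *)
Lemma padic_gamma_unit_poch (c : W) i0 m : (i0 < p)%N -> p%:R * c = c + i0%:R -> zp p c ->
  padic_gamma p (c + m%:R) = (-1) ^+ m * unit_poch p c i0 m * padic_gamma p c.
Proof.
move=> lt cE zc; elim: m => [|m IH].
  by rewrite addr0 mul1r /unit_poch big_geq // mul1r.
rewrite -natr1 addrA (padic_gammaS p_prime p_odd U); last exact: zpD zc (zp_nat p W m).
rewrite IH unit_pochS exprS.
have -> : `[< ppow_dvd p 1 (c + m%:R) >] = (m == i0 %[mod p]).
  apply/asboolP/idP => [|h]; last first.
    rewrite (dvd_shift lt) in h; apply/(res_eq0 U); rewrite rmorphD (res_c U cE) rmorph_nat.
    have := ppow_dvd1_nat p_prime U (m + (p - i0)); rewrite -(res_eq0 U) rmorph_nat.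
    by move=> /iffRL /(_ h); rewrite natrD natrB ?(ltnW lt) // (res_p U) sub0r addrC.
  move=> /(res_eq0 U) e; apply: contraT => /(unit_factor p_prime U lt cE) um.
  by have := rmorph_unit res um; rewrite e unitr0.
by case: ifP => _ /=; ring.
Qed.

End ZpElements.

Section DigitOrbit.
Variables (p r a : nat).
Hypothesis p_prime : prime p.
Hypothesis p_odd : odd p.
Hypothesis r_gt0 : (0 < r)%N.

Local Notation q := (p ^ r)%N.
Hypothesis a_bound : (0 < a < q.-1)%N.

(** The numerators of the fractional parts of a p^i / (q - 1). *)
Definition orbit_num i := ((a * p ^ i) %% q.-1)%N.

Definition below_half i := (2 * orbit_num i < q.-1)%N.

(** Modulo p^l, (q - 1)(n_i + 1) is the i-th numerator, so that n_i + 1 approximates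
    the i-th fractional part. *)
Definition orbit_nat l i := ((orbit_num i + p ^ i * (q.-1 - a) * q ^ l) %/ q.-1).-1.

Let Q_gt0 : (0 < q.-1)%N.
Proof. by case/andP: a_bound => _; apply: leq_ltn_trans. Qed.

Let q_mod : q = 1 %[mod q.-1].
Proof. by rewrite -{1}(prednK (n := q)) ?expn_gt0 ?prime_gt0 // -addn1 modnDl. Qed.

Lemma orbit_num_lt i : (orbit_num i < q.-1)%N.
Proof. by rewrite ltn_mod. Qed.

Lemma orbit_num0 : orbit_num 0 = a.
Proof. by rewrite /orbit_num expn0 muln1 modn_small //; case/andP: a_bound. Qed.

Lemma orbit_num_r : orbit_num r = a.
Proof. by rewrite -[RHS]orbit_num0 /orbit_num -modnMmr q_mod modnMmr expn0. Qed.

Lemma orbit_natE l i :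
  (q.-1 * (orbit_nat l i).+1 = orbit_num i + p ^ i * (q.-1 - a) * q ^ l)%N.
Proof.
have /andP[a0 aq] := a_bound.
set X := (orbit_num i + _)%N.
have dvdX : (q.-1 %| X)%N.
  rewrite /X /dvdn /orbit_num modnDml -modnDmr -modnMmr -modnXm q_mod modnXm exp1n modnMmr muln1 modnDmr.
  by rewrite mulnC -mulnDr subnKC ?(ltnW aq) // modnMl.
have X0 : (0 < X)%N.
  by rewrite addn_gt0 !muln_gt0 !expn_gt0 (prime_gt0 p_prime) subn_gt0 aq orbT.
rewrite /orbit_nat -/X prednK; first by rewrite mulnC divnK.
by rewrite divn_gt0 // dvdn_leq.
Qed.

(** The number e is a digit of a / (q - 1) in base p. *)
Lemma orbit_step i : exists2 e, (e < p)%N &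
  (p * orbit_num i = orbit_num i.+1 + q.-1 * e)%N.
Proof.
exists ((p * orbit_num i) %/ q.-1)%N.
  by rewrite ltn_divLR // ltn_pmul2l ?prime_gt0 // orbit_num_lt.
rewrite [LHS](divn_eq _ q.-1) addnC [(_ %/ _ * _)%N]mulnC; congr (_ + _)%N.
by rewrite /orbit_num modnMmr expnS mulnCA.
Qed.

Lemma orbit_nat_step l i e : (e < p)%N ->
  (p * orbit_num i = orbit_num i.+1 + q.-1 * e)%N ->
  orbit_nat l i.+1 = (p * orbit_nat l i + (p.-1 - e))%N.
Proof.
move=> ep he; have h0 := orbit_natE l i; have h1 := orbit_natE l i.+1.
have : (q.-1 * ((orbit_nat l i.+1).+1 + e) = q.-1 * (p * (orbit_nat l i).+1))%N.
  rewrite mulnCA h0 mulnDr h1 mulnDr he expnS.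
  by rewrite addnAC !mulnA.
move/eqP; rewrite eqn_pmul2l // => /eqP; rewrite mulnS; lia.
Qed.

Lemma orbit_nat_div l i : (orbit_nat l i.+1 %/ p = orbit_nat l i)%N.
Proof.
have [e ep he] := orbit_step i; rewrite (orbit_nat_step l ep he).
have p0 := prime_gt0 p_prime.
by rewrite mulnC divnMDl // divn_small ?addn0 //; lia.
Qed.

(** The numbers n_i + δ_i, where δ_i is [below_half i], approximate the fractional
    part of a p^i / (q - 1) - 1/2, lowered by 1/2; so they form an orbit for the
    parameter 1/2, as the n_i do for the parameter 1. *)
Lemma orbit_half_div l i :
  ((orbit_nat l i.+1 + below_half i.+1 + p.-1./2) %/ p = orbit_nat l i + below_half i)%N.
Proof.
have [e ep he] := orbit_step i; rewrite (orbit_nat_step l ep he).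
have p0 := prime_gt0 p_prime.
have [h eh] : exists h, p = (2 * h + 1)%N by exists p./2; move: p_odd; lia.
have -> : (p.-1./2 = h)%N by lia.
have hl := orbit_num_lt i; have hl' := orbit_num_lt i.+1.
have /andP[lo up] :
    (p * below_half i <= (p.-1 - e) + below_half i.+1 + h < p * below_half i + p)%N.
  move: he hl hl'; rewrite /below_half; set A := orbit_num i; set A' := orbit_num i.+1.
  move: (q.-1) => Q; rewrite eh addn1 /= => he hl hl'.
  have {}ep : (e <= 2 * h)%N by lia.
  have cmp : [\/ (e < h /\ Q * e + Q <= Q * h)%N, e = h | (h < e /\ Q * h + Q <= Q * e)%N].
    case: (ltngtP e h) => lt; [apply: Or31 | apply: Or33 | exact: Or32];
      by split=> //; rewrite addnC -mulnS leq_mul2l lt orbT.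
  case: ltnP => c1.
    have c1' : ((2 * h).+1 * (2 * A) < (2 * h).+1 * Q)%N by rewrite ltn_pmul2l.
    case: cmp => [[lt le]|eeh|[lt le]]; case: ltnP => c2; apply/andP; split;
      rewrite ?eeh in he *; lia.
  have c1' : ((2 * h).+1 * Q <= (2 * h).+1 * (2 * A))%N by rewrite leq_pmul2l.
  case: cmp => [[lt le]|eeh|[lt le]]; case: ltnP => c2; apply/andP; split;
    rewrite ?eeh in he *; lia.
set y := ((p.-1 - e) + below_half i.+1 + h)%N in lo up.
have -> : (p * orbit_nat l i + (p.-1 - e) + below_half i.+1 + h =
    (orbit_nat l i + below_half i) * p + (y - p * below_half i))%N.
  rewrite -[in RHS](mulnC p) mulnDr -[RHS]addnA subnKC // /y.
  by rewrite !addnA.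
by rewrite divnMDl // divn_small ?addn0 // ltn_subLR.
Qed.

Lemma orbit_nat_r l : orbit_nat l r = (q * orbit_nat l 0 + (q.-1 - a))%N.
Proof.
have h0 := orbit_natE l 0; have h1 := orbit_natE l r.
rewrite orbit_num0 expn0 mul1n in h0; rewrite orbit_num_r in h1.
have /andP[a0 aq] := a_bound.
have eq1 : q = q.-1.+1 by rewrite prednK // expn_gt0 prime_gt0.
have : (q.-1 * (orbit_nat l r).+1 = q.-1 * (q * orbit_nat l 0 + (q.-1 - a)).+1)%N.
  rewrite h1 -[(p ^ r * (q.-1 - a) * q ^ l)%N]mulnA.
  have -> : ((q.-1 - a) * q ^ l = q.-1 * (orbit_nat l 0).+1 - a)%N by rewrite h0 addKn.
  have [c ec] : exists c, q.-1 = (c + a)%N by exists (q.-1 - a)%N; rewrite subnK // ltnW.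
  move: eq1 ec (orbit_nat l 0); set Q := q.-1 => -> -> n.
  have -> : ((c + a) * n.+1 - a = (c + a) * n + c)%N by rewrite mulnS addnAC addnK addnC.
  by rewrite addnK; ring.
by move/eqP; rewrite eqn_pmul2l // eqSS => /eqP.
Qed.

End DigitOrbit.

Section JacobiGamma.
Variables (p r : nat) (F : finFieldType) (W : idomainType) (res : {rmorphism W -> F}).
Hypothesis p_prime : prime p.
Hypothesis p_odd : odd p.
Hypothesis r_gt0 : (0 < r)%N.
Hypothesis cardF : #|F| = (p ^ r)%N.
Hypothesis U : unramified_integers p res.

Local Notation q := (p ^ r)%N.
Local Notation half := (2%:R^-1 : W).

Lemma poch_cat (c : W) k m : (k <= m)%N ->
  poch c m = poch c k * \prod_(k <= i < m) (c + i%:R).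
Proof. by move=> km; rewrite /poch (@big_cat_nat _ _ _ k). Qed.

(** A natural number n close to the fixed point -sigma may replace it in the
    Newton series, which becomes R n. *)
Lemma jacobi_ratio b (sigma : W) (R : nat -> W) : (0 < b < q.-1)%N ->
  q%:R * sigma = sigma + b%:R ->
  (forall m, fdiff_small p 0 m R) ->
  (forall n, R n * (poch 1 (q * n + b) * poch half n) = poch half (q * n + b) * poch 1 n) ->
  forall N n, pcong p N n%:R (- sigma) -> pcong p N (jacobi_sum res (q.-1 - b)) (- R n).
Proof.
move=> hb sE smR eR N n hn; have [alpha [ha hN]] := newton_series p_prime p_odd U smR.
pose M := (6 * N)%N; have eM : (M %/ 6 = N)%N by rewrite mulKn.
have hR k : let m := (q * k + b)%N in
    R k * (m ^_ (m - k))%:R = \prod_(k <= i < m) (half + i%:R).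
  move=> m; have km : (k <= m)%N.
    by apply: (leq_trans _ (leq_addr _ _)); rewrite leq_pmull // expn_gt0 prime_gt0.
  have := eR k; rewrite -/m (poch_cat half km) poch1E.
  rewrite -(ffact_fact (leq_subr k m)) (subKn km).
  rewrite natrM -poch1E => e.
  apply: (mulfI (poch1_neq0 p_prime U k)); apply: (mulfI (poch_half_neq0 p_prime p_odd U k)).
  by move: e; set P := bigop _ _ _ => e; rewrite mulrCA [RHS]mulrA [RHS]mulrAC -e; ring.
have := jacobi_newton p_prime p_odd r_gt0 cardF U hb sE M hR ha hN; rewrite eM => hJ.
apply: (pcong_trans hJ); apply: pcongN.
apply: (pcong_trans (y := \sum_(j < M.+1) alpha j * (n ^_ j)%:R)).
  apply: pcong_sum => j _; apply: pcongMl; rewrite -horner_ffpoly /ffpoly !horner_prod.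
  by apply: pcong_prod => i _; rewrite !hornerE; apply: pcongD; [apply: pcong_sym | apply: pcong_refl].
rewrite hN.
have widen K : (n <= K)%N -> (M <= K)%N ->
    pcong p N (\sum_(j < M.+1) alpha j * (n ^_ j)%:R) (\sum_(j < K.+1) alpha j * (n ^_ j)%:R) /\
    \sum_(j < n.+1) alpha j * (n ^_ j)%:R = \sum_(j < K.+1) alpha j * (n ^_ j)%:R.
  rewrite -ltnS -[(M <= K)%N]ltnS => nK MK; split.
    rewrite (big_ord_widen _ (fun j => alpha j * (n ^_ j)%:R) MK) big_mkcond /=.
    apply: pcong_sum => j _; case: ltnP => Mj; first exact: pcong_refl.
    apply: pcong_sym; rewrite /pcong subr0; apply: ppow_dvdMr; apply: ppow_dvdW (ha j).
    by rewrite -eM leq_div2r // ltnW.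
  rewrite (big_ord_widen _ (fun j => alpha j * (n ^_ j)%:R) nK) big_mkcond /=.
  by apply: eq_bigr => j _; case: ltnP => // nj; rewrite ffact_small ?mulr0.
by have [h1 ->] := widen (maxn n M) (leq_maxl _ _) (leq_maxr _ _).
Qed.

Variable a : nat.
Hypothesis a_bound : (0 < a < q.-1)%N.

Local Notation num := (orbit_num p r a).
Local Notation dl := (below_half p r a).
Local Notation nn := (orbit_nat p r a).

(** The fractional part of a p^i / (q - 1), as an element of W. *)
Definition orbit_frac i : W := (num i)%:R / q.-1%:R.

Lemma pred_q_ndvd : ~~ (p %| q.-1)%N.
Proof.
apply/negP => h; have := dvdn_exp r_gt0 (dvdnn p).
have -> : (p ^ r = q.-1 + 1)%N by rewrite addn1 prednK // expn_gt0 prime_gt0.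
by rewrite dvdn_addr // dvdn1 => /eqP p1; have := prime_gt1 p_prime; rewrite p1.
Qed.

Lemma pred_q_unit : (q.-1%:R : W) \is a GRing.unit.
Proof. exact: (unit_nat p_prime U pred_q_ndvd). Qed.

Lemma orbit_fracE i : q.-1%:R * orbit_frac i = (num i)%:R.
Proof. by rewrite /orbit_frac mulrC mulrVK ?pred_q_unit. Qed.

Lemma zp_orbit_frac i : zp p (orbit_frac i).
Proof. by apply: zpM; [apply: zp_nat | apply: (zp_invn p_prime U pred_q_ndvd)]. Qed.

Lemma orbit_nat_cong l i : pcong p l (nn l i).+1%:R (orbit_frac i).
Proof.
apply: (ppow_dvd_unit pred_q_unit); rewrite mulrBr orbit_fracE -natrM.
rewrite (orbit_natE p_prime a_bound) natrD addrAC subrr add0r.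
apply: ppow_dvd_nat; apply: dvdn_mull; rewrite -expnM; apply: dvdn_exp2l.
by rewrite leq_pmull.
Qed.

Lemma orbit_poch_half l j :
  poch half (nn l j + dl j) = poch half (nn l 0 + dl 0) *
  \prod_(i < j) (uhalf p W (nn l i.+1 + dl i.+1) * p%:R ^+ (nn l i + dl i)).
Proof.
elim: j => [|j IH]; first by rewrite big_ord0 mulr1.
rewrite big_ord_recr /= mulrA (mulrC (poch _ _)) -mulrA.
rewrite (poch_half_split p_prime p_odd U) (orbit_half_div p_prime p_odd r_gt0 a_bound) IH.
by ring.
Qed.

Lemma orbit_poch1 l j :
  poch 1 (nn l j) = poch 1 (nn l 0) *
  \prod_(i < j) (uone p W (nn l i.+1) * p%:R ^+ nn l i).
Proof.
elim: j => [|j IH]; first by rewrite !big_ord0 mulr1.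
rewrite big_ord_recr /= mulrA -IH (poch1_split W p_prime p_odd).
by rewrite (orbit_nat_div p_prime p_odd r_gt0 a_bound); ring.
Qed.

Lemma below_half_r : dl r = dl 0.
Proof. by rewrite /below_half (orbit_num_r p_prime a_bound) (orbit_num0 a_bound). Qed.

Lemma poch_addb (c : W) n (d : bool) : poch c (n + d) = poch c n * (c + n%:R) ^+ d.
Proof. by case: d; rewrite ?addn1 ?addn0 ?pochS ?expr1 ?expr0 ?mulr1. Qed.

(** Along the orbit, the splitting of the rising factorials at n_(i+1) into unit
    parts and rising factorials at n_i telescopes. From n_0 to
    n_r = q n_0 + (q - 1 - a), only unit parts and powers of p are left. The two
    powers of exponent δ_0 appear because the orbit of the numerator starts at
    n_0 + δ_0 and ends at n_r + δ_0. *)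
Lemma orbit_ratio l (R : nat -> W) :
  (forall n, R n * (poch 1 (q * n + (q.-1 - a)) * poch half n) =
             poch half (q * n + (q.-1 - a)) * poch 1 n) ->
  R (nn l 0) * (half + (nn l r)%:R) ^+ dl 0 * \prod_(i < r) uone p W (nn l i.+1) =
  (half + (nn l 0)%:R) ^+ dl 0 *
    \prod_(i < r) (p%:R ^+ dl i * uhalf p W (nn l i.+1 + dl i.+1)).
Proof.
move=> /(_ (nn l 0)); rewrite -(orbit_nat_r p_prime a_bound) => e.
have h1 := orbit_poch_half l r; rewrite below_half_r !poch_addb in h1.
have h2 := orbit_poch1 l r.
pose P : W := \prod_(i < r) p%:R ^+ nn l i.
have P0 : P != 0.
  by apply/prodf_neq0 => i _; rewrite expf_neq0 // (unram_p_neq0 U).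
rewrite big_split /= -/P in h2.
have e1 : \prod_(i < r) (uhalf p W (nn l i.+1 + dl i.+1) * p%:R ^+ (nn l i + dl i)) =
    P * \prod_(i < r) (p%:R ^+ dl i * uhalf p W (nn l i.+1 + dl i.+1)).
  by rewrite /P -big_split; apply: eq_bigr => i _ /=; rewrite exprD; ring.
rewrite e1 in h1; rewrite h2 in e.
set A := \prod_(i < r) uone _ _ _ in e *; set B := \prod_(i < r) (_ * uhalf _ _ _) in h1 *.
apply: (mulfI P0); apply: (mulfI (poch1_neq0 p_prime U (nn l 0))).
apply: (mulfI (poch_half_neq0 p_prime p_odd U (nn l 0))).
set x := (half + (nn l 0)%:R) ^+ _ in h1 *; set y := (half + (nn l r)%:R) ^+ _ in h1 *.
set p1 := poch 1 _ in e *; set ph := poch half (nn l 0) in e h1 *.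
have -> : ph * (p1 * (P * (R (nn l 0) * y * A))) = (R (nn l 0) * (p1 * (A * P) * ph)) * y by ring.
rewrite e; have -> : poch half (nn l r) * p1 * y = (poch half (nn l r) * y) * p1 by ring.
by rewrite h1; ring.
Qed.

Lemma padic_gamma1S m : padic_gamma p (m.+1%:R : W) = (-1) ^+ m.+1 * uone p W m.
Proof.
have lt : (p.-1 < p)%N by rewrite prednK ?prime_gt0.
have g1 : padic_gamma p (1 : W) = -1.
  rewrite -[1 in LHS](_ : 1%:R = 1) // (padic_gamma_nat_val p_prime p_odd U) gamma_natE.
  by rewrite /pfree_fact big_ltn_cond // dvdn0 /= big_geq // mulr1 expr1.
rewrite -natr1 addrC (padic_gamma_unit_poch p_prime p_odd U m lt (fixed_one W p_prime)); last exact: zp_nat 1%N.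
by rewrite g1 exprS /uone; ring.
Qed.

Lemma padic_gamma_half m :
  padic_gamma p (half + m%:R) = (-1) ^+ m * uhalf p W m * padic_gamma p half.
Proof.
apply: (padic_gamma_unit_poch p_prime p_odd U m (half_lt p_prime) (fixed_half p_prime p_odd U)).
exact: zp_half p_prime p_odd U.
Qed.

(** The fractional part of a p^i / (q - 1) - 1/2. *)
Definition orbit_shift i : W := orbit_frac i - half + (dl i)%:R.

Lemma half_sub1 : half - 1 = - half.
Proof.
apply/eqP; rewrite -subr_eq0; apply/eqP; transitivity (2%:R * half - 1); first by ring.
by rewrite (mul2half p_prime p_odd U) subrr.
Qed.

Lemma orbit_shiftE i : orbit_shift i = half + (orbit_frac i - 1 + (dl i)%:R).
Proof. by rewrite /orbit_shift -half_sub1; ring. Qed.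

Lemma prod_cyclic (g : nat -> W) : g r = g 0%N ->
  \prod_(i < r) g i.+1 = \prod_(i < r) g i.
Proof.
rewrite -(prednK r_gt0) => e; rewrite big_ord_recr [RHS]big_ord_recl /= e mulrC.
by congr (_ * _); apply: eq_bigr.
Qed.

(** The Gross-Koblitz formula for the Jacobi sums of the quadratic character: the
    limit of [orbit_ratio], with the unit parts read as quotients of values of
    Gamma_p. *)
Theorem jacobi_gamma :
  jacobi_sum res a * \prod_(i < r) (padic_gamma p half * padic_gamma p (orbit_frac i)) =
  - \prod_(i < r) (- (- p%:R) ^+ dl i * padic_gamma p (orbit_shift i)).
Proof.
have /andP[a0 aq] := a_bound.
have hb : (0 < q.-1 - a < q.-1)%N by rewrite subn_gt0 aq ltn_subLR ?(ltnW aq) // -[X in (X < _)%N]add0n ltn_add2r.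
have lt : (q.-1 - a < q)%N by apply: (leq_ltn_trans (leq_subr _ _)); rewrite prednK // expn_gt0 prime_gt0.
have [R [smR eR]] := ratio_exists p_prime p_odd U lt.
have frac0 : orbit_frac 0 = a%:R / q.-1%:R by rewrite /orbit_frac (orbit_num0 a_bound).
have fracr : orbit_frac r = orbit_frac 0.
  by rewrite /orbit_frac (orbit_num0 a_bound) (orbit_num_r p_prime a_bound).
pose sigma : W := 1 - orbit_frac 0.
have sE : q%:R * sigma = sigma + (q.-1 - a)%:R.
  have -> : q%:R = q.-1%:R + 1 :> W by rewrite natr1 prednK // expn_gt0 prime_gt0.
  rewrite mulrDl mul1r addrC; congr (_ + _).
  by rewrite /sigma mulrBr mulr1 orbit_fracE (orbit_num0 a_bound) natrB // ltnW.
have zh := zp_half p_prime p_odd U.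
have zm1 : zp p (-1 : W) by apply: zpN => //; apply: (zp_nat p W 1).
have zfrac i : zp p (orbit_frac i - 1) by apply: zpD => //; apply: zp_orbit_frac.
have zshift i : zp p (orbit_shift i).
  rewrite orbit_shiftE; apply: (zpD zh); apply: zpD; first exact: zfrac.
  exact: zp_nat.
pose G1 := \prod_(i < r) (padic_gamma p half * padic_gamma p (orbit_frac i.+1)).
pose G2 := \prod_(i < r) (p%:R ^+ dl i * ((-1) ^+ (dl i.+1).+1 * padic_gamma p (orbit_shift i.+1))).
(* The factors of exponent dl 0 come from both ends of the orbit, and tend to the
   same limit. *)
have key : jacobi_sum res a * (orbit_frac 0 - half) ^+ dl 0 * G1 =
    - ((orbit_frac 0 - half) ^+ dl 0 * G2).
  apply: (eq_pcong U) => l.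
  have cn i : pcong p l (nn l i)%:R (orbit_frac i - 1).
    have := pcongD (orbit_nat_cong l i) (pcong_refl p l (-1 : W)).
    by rewrite -natr1 addrK.
  have hJ : pcong p l (jacobi_sum res a) (- R (nn l 0)).
    have := jacobi_ratio hb sE smR eR (N := l) (n := nn l 0).
    by rewrite subKn ?(ltnW aq) //; apply; rewrite /sigma opprB; apply: cn.
  have ch i : orbit_frac i = orbit_frac 0 -> pcong p l (half + (nn l i)%:R) (orbit_frac 0 - half).
    move=> e0; have -> : orbit_frac 0 - half = half + (orbit_frac 0 - 1).
      by rewrite -half_sub1; ring.
    by apply: pcongD; [apply: pcong_refl | rewrite -e0; apply: cn].
  have e := orbit_ratio l eR.
  pose g1 := \prod_(i < r) (padic_gamma p half * padic_gamma p ((nn l i.+1).+1%:R : W)).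
  pose g2 := \prod_(i < r) (p%:R ^+ dl i *
    ((-1) ^+ (dl i.+1).+1 * padic_gamma p (half + (nn l i.+1 + dl i.+1)%:R))).
  have e' : R (nn l 0) * (half + (nn l r)%:R) ^+ dl 0 * g1 = (half + (nn l 0)%:R) ^+ dl 0 * g2.
    pose s := \prod_(i < r) ((-1) ^+ (nn l i.+1).+1 * padic_gamma p half).
    have -> : g1 = s * \prod_(i < r) uone p W (nn l i.+1).
      rewrite /g1 /s -big_split; apply: eq_bigr => i _ /=.
      by rewrite padic_gamma1S; ring.
    rewrite mulrCA e.
    have -> : g2 = s * \prod_(i < r) (p%:R ^+ dl i * uhalf p W (nn l i.+1 + dl i.+1)).
      rewrite /g2 /s -big_split; apply: eq_bigr => i _ /=.
      rewrite padic_gamma_half.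
      have -> : (-1) ^+ (dl i.+1).+1 * ((-1) ^+ (nn l i.+1 + dl i.+1) *
          uhalf p W (nn l i.+1 + dl i.+1) * padic_gamma p half) =
        (-1) ^+ (nn l i.+1).+1 * padic_gamma p half * uhalf p W (nn l i.+1 + dl i.+1).
        by case: (dl i.+1); rewrite ?addn1 ?addn0 !exprS ?expr0; ring.
      by ring.
    by rewrite [RHS]mulrCA.
  have cg1 : pcong p l g1 G1.
    apply: pcong_prod => i _; apply: pcongMl; apply: (padic_gamma_cong p_prime p_odd U).
    - exact: zp_nat.
    - exact: zp_orbit_frac.
    - exact: orbit_nat_cong.
  have cg2 : pcong p l g2 G2.
    apply: pcong_prod => i _; do 2!apply: pcongMl; apply: (padic_gamma_cong p_prime p_odd U).
    - by apply: (zpD zh); apply: zp_nat.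
    - exact: zshift.
    - rewrite orbit_shiftE natrD; apply: pcongD; first exact: pcong_refl.
      by apply: pcongD; [apply: cn | apply: pcong_refl].
  apply: (pcong_trans (y := - (R (nn l 0) * (half + (nn l r)%:R) ^+ dl 0 * g1))).
    rewrite -!mulNr; apply: pcongM; last exact: pcong_sym.
    by apply: pcongM => //; apply/pcongX/pcong_sym/ch.
  by rewrite e'; apply: pcongN; apply: pcongM => //; apply/pcongX/ch.
(* If dl 0 holds, then a / (q - 1) < 1/2, and the factor to cancel is not 0. *)
have c0 : (orbit_frac 0 - half) ^+ dl 0 != 0.
  case: (boolP (dl 0)) => [lt0|_]; last by rewrite expr0 oner_neq0.
  rewrite expr1; apply: contraTneq lt0 => e0; rewrite /below_half; apply/negP=> lt1.
  have := congr1 (fun x => 2%:R * q.-1%:R * x) e0; rewrite mulr0.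
  have -> : 2%:R * q.-1%:R * (orbit_frac 0 - half) =
    2%:R * (q.-1%:R * orbit_frac 0) - q.-1%:R * (2%:R * half) by ring.
  rewrite orbit_fracE (mul2half p_prime p_odd U) mulr1 -natrM => /eqP.
  rewrite -opprB oppr_eq0 -natrB ?(ltnW lt1) //.
  by rewrite (negPf (natW_neq0 p_prime U _)) // subn_gt0.
have eG1 : G1 = \prod_(i < r) (padic_gamma p half * padic_gamma p (orbit_frac i)).
  by apply: (prod_cyclic (g := fun i => padic_gamma p half * padic_gamma p (orbit_frac i))); rewrite fracr.
have eG2 : G2 = \prod_(i < r) (- (- p%:R) ^+ dl i * padic_gamma p (orbit_shift i)).
  rewrite /G2 big_split /=.
  rewrite (prod_cyclic (g := fun i => (-1) ^+ (dl i).+1 * padic_gamma p (orbit_shift i))); last first.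
    by rewrite /orbit_shift fracr below_half_r.
  rewrite -big_split; apply: eq_bigr => i _ /=.
  by case: (dl i); rewrite ?expr1 ?expr0 ?exprS; ring.
apply: (mulfI c0); rewrite -eG1 -eG2 mulrN -key; ring.
Qed.

End JacobiGamma.

(** * Fractional parts and rational arguments *)

Section FractionalParts.

Lemma floor_unique (x y : rat) (m : int) : x = m%:~R + y -> 0 <= y < 1 -> Num.floor x = m.
Proof.
move=> -> /andP[y0 y1]; apply: floor_def.
by rewrite lerDl y0 intrD ltrD2l y1.
Qed.

Lemma frac_part_unique (x y : rat) (m : int) : x = m%:~R + y -> 0 <= y < 1 -> frac_part x = y.
Proof.
by move=> e hy; rewrite /frac_part (floor_unique e hy) e addrC addKr.
Qed.

Lemma frac_part_bounds (x : rat) : 0 <= frac_part x < 1.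
Proof.
rewrite /frac_part subr_ge0 ltrBlDr addrC.
by have /andP[-> h] := floor_itv x; move: h; rewrite intrD.
Qed.

End FractionalParts.

Section RationalArguments.
Variables (p : nat) (F : finFieldType) (W : idomainType) (res : {rmorphism W -> F}).
Hypothesis p_prime : prime p.
Hypothesis p_odd : odd p.
Hypothesis U : unramified_integers p res.

(** The denominator of x divides m, hence is invertible in W. *)
Lemma ratr_mul_den (x : rat) (m : nat) (z : int) : ~~ (p %| m)%N ->
  x * m%:R = z%:~R -> ratr x * m%:R = z%:~R :> W.
Proof.
move=> pm e.
have ez : numq x * m%:Z = z * denq x.
  by apply: (@intr_inj rat); rewrite !intrM -e numqE -pmulrn mulrAC.
have dm : (`|denq x| %| m)%N.
  have := congr1 absz ez; rewrite !abszM absz_nat => h.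
  rewrite -(@Gauss_dvdr _ `|numq x|); last by rewrite coprime_sym coprime_num_den.
  by rewrite h dvdn_mull.
have ud : (denq x)%:~R \is a @GRing.unit W.
  rewrite -absz_denq -pmulrn; apply: (unit_nat p_prime U).
  by apply: contra pm => /dvdn_trans; apply.
apply: (mulIr ud); rewrite /ratr mulrAC divrK //.
by have := congr1 (fun k : int => k%:~R : W) ez; rewrite !rmorphM /= -pmulrn => <-.
Qed.

Lemma zp_ratr (x : rat) (m : nat) (z : int) : ~~ (p %| m)%N ->
  x * m%:R = z%:~R -> zp p (ratr x : W).
Proof.
move=> pm /(ratr_mul_den pm) e; have um := unit_nat p_prime U pm.
rewrite -(mulrK um (ratr x)) e; apply: zpM; first exact: zp_int.
exact: (zp_invn p_prime U pm).
Qed.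

Lemma frac_part_den (x : rat) (m : nat) (z : int) :
  x * m%:R = z%:~R -> frac_part x * m%:R = (z - Num.floor x * m%:Z)%:~R.
Proof. by move=> e; rewrite /frac_part mulrBl e rmorphB rmorphM /= -pmulrn. Qed.

Lemma gamma_rat_neq0 (x : rat) (m : nat) (z : int) : ~~ (p %| m)%N ->
  x * m%:R = z%:~R -> gamma_rat W p (frac_part x) != 0.
Proof.
move=> pm e; rewrite /gamma_rat tofrac_eq0.
apply: (padic_gamma_neq0 p_prime p_odd U).
exact: zp_ratr pm (frac_part_den e).
Qed.

End RationalArguments.

(** * The factors of McCarthy's function *)

Section McCarthyFactors.
Variables (p r : nat) (F : finFieldType) (W : idomainType) (res : {rmorphism W -> F}).
Hypothesis p_prime : prime p.
Hypothesis p_odd : odd p.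
Hypothesis r_gt0 : (0 < r)%N.
Hypothesis cardF : #|F| = (p ^ r)%N.
Hypothesis U : unramified_integers p res.

Local Notation q := (p ^ r)%N.
Local Notation half := (2%:R^-1 : W).
Local Notation Gamma x := (tofrac (padic_gamma p (x : W))).

Definition upper_factor (x : rat) (a i : nat) : {fraction W} :=
  let P : rat := (p ^ i)%N%:R in
  let s : rat := a%:R / ((p ^ r)%N%:R - 1) in
  (- p%:R) ^ (- Num.floor (frac_part (x * P) - s * P))
  * (gamma_rat W p (frac_part ((x - s) * P)) / gamma_rat W p (frac_part (x * P))).

Definition lower_factor (y : rat) (a i : nat) : {fraction W} :=
  let P : rat := (p ^ i)%N%:R in
  let s : rat := a%:R / ((p ^ r)%N%:R - 1) in
  (- p%:R) ^ (- Num.floor (frac_part (- y * P) + s * P))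
  * (gamma_rat W p (frac_part ((- y + s) * P)) / gamma_rat W p (frac_part (- y * P))).

Lemma pfrac_neq0 : - p%:R != 0 :> {fraction W}.
Proof. by rewrite oppr_eq0 -(rmorph_nat (@tofrac W)) tofrac_eq0 (unram_p_neq0 U). Qed.

Lemma mccarthy_factorE x y a i :
  mccarthy_factor W p r x y a i = upper_factor x a i * lower_factor y a i.
Proof.
rewrite /mccarthy_factor /upper_factor /lower_factor expfzDr ?pfrac_neq0 //.
by rewrite [RHS]mulrACA [RHS]mulrA.
Qed.

Definition seq_factor (g : rat -> nat -> nat -> {fraction W}) (s : seq rat) a :=
  \prod_(x <- s) \prod_(i < r) g x a i.

Lemma prod_mccarthy_factor n (A B : seq rat) a : size A = n -> size B = n ->
  \prod_(j < n) \prod_(i < r) mccarthy_factor W p r A`_j B`_j a i =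
  seq_factor upper_factor A a * seq_factor lower_factor B a.
Proof.
move=> sA sB.
transitivity (\prod_(j < n) ((\prod_(i < r) upper_factor A`_j a i) *
  \prod_(i < r) lower_factor B`_j a i)).
  apply: eq_bigr => j _; rewrite -[RHS]big_split; apply: eq_bigr => i _ /=.
  by rewrite mccarthy_factorE.
rewrite big_split /= /seq_factor.
by rewrite (big_nth 0) [X in _ = _ * X](big_nth 0) !big_mkord sA sB.
Qed.

Lemma seq_factor0 (s : seq rat) :
  (forall x, x \in s -> exists m : nat, exists2 z : int, ~~ (p %| m)%N & x * m%:R = z%:~R) ->
  seq_factor upper_factor s 0 = 1 /\ seq_factor lower_factor s 0 = 1.
Proof.
have floor0 x : Num.floor (frac_part x) = 0.
  by apply: (@floor_unique _ (frac_part x)); rewrite ?add0r ?frac_part_bounds.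
move=> hs; split; rewrite /seq_factor big_seq big1 // => x /hs[m [z pm e]];
  rewrite big1 // => i _; rewrite /upper_factor /lower_factor /= !mul0r ?subr0 ?addr0 floor0.
  have e' : x * (p ^ i)%N%:R * m%:R = (z * (p ^ i)%N%:Z)%:~R.
    by rewrite mulrAC e rmorphM /= -pmulrn.
  by rewrite expr0z mul1r divff // (gamma_rat_neq0 p_prime p_odd U pm e').
have e' : - x * (p ^ i)%N%:R * m%:R = (- z * (p ^ i)%N%:Z)%:~R.
  by rewrite mulrAC mulNr e rmorphM rmorphN /= -pmulrn.
by rewrite expr0z mul1r divff // (gamma_rat_neq0 p_prime p_odd U pm e').
Qed.

Variable a : nat.
Hypothesis a_bound : (0 < a < q.-1)%N.

Local Notation num := (orbit_num p r a).
Local Notation dl := (below_half p r a).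
Local Notation quo i := ((a * p ^ i) %/ q.-1)%N.

Let Q0 : (0 < q.-1)%N.
Proof. by case/andP: a_bound => _; apply: leq_ltn_trans. Qed.

Lemma shiftE i : a%:R / ((p ^ r)%N%:R - 1) * (p ^ i)%N%:R = (quo i)%:Z%:~R + (num i)%:R / q.-1%:R :> rat.
Proof.
have -> : (p ^ r)%N%:R - 1 = q.-1%:R :> rat.
  by rewrite -[in LHS](prednK (n := q)) ?expn_gt0 ?prime_gt0 // -natr1 addrK.
have Qn : q.-1%:R != 0 :> rat by rewrite pnatr_eq0 -lt0n.
apply: (mulIf Qn); rewrite mulrAC divfK // mulrDl divfK // -pmulrn -natrM -natrM -natrD.
by rewrite -divn_eq.
Qed.

Lemma frac_num_bounds i : 0 <= ((num i)%:R / q.-1%:R : rat) < 1.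
Proof.
have Qn : 0 < q.-1%:R :> rat by rewrite ltr0n.
by rewrite divr_ge0 ?ler0n //= ltr_pdivrMr // mul1r ltr_nat ltn_mod.
Qed.

Lemma ratr_num i : ratr ((num i)%:R / q.-1%:R) = orbit_frac p r W a i.
Proof.
have uQ := pred_q_unit p_prime r_gt0 U; have pQ := pred_q_ndvd p_prime r_gt0.
have Qn : q.-1%:R != 0 :> rat by rewrite pnatr_eq0 -lt0n.
have h := @ratr_mul_den p F W res p_prime U ((num i)%:R / q.-1%:R) q.-1 (num i)%:Z pQ.
apply: (mulIr uQ); rewrite h; last by rewrite divfK // -pmulrn.
by rewrite -pmulrn mulrC (orbit_fracE p_prime r_gt0 U).
Qed.

Lemma lower_factor_zero i :
  lower_factor 0 a i = (- p%:R) ^ (- (quo i)%:Z) * Gamma (orbit_frac p r W a i).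
Proof.
rewrite /lower_factor /= oppr0 mul0r.
have z01 : 0 <= (0 : rat) < 1 by rewrite lexx ltr01.
rewrite (@frac_part_unique 0 0 0) ?addr0 // !add0r shiftE.
rewrite (floor_unique erefl (frac_num_bounds i)) (frac_part_unique erefl (frac_num_bounds i)).
rewrite /gamma_rat ratr_num; congr (_ * _).
have -> : ratr 0 = 0%:R :> W by rewrite /ratr mul0r.
by rewrite (padic_gamma_nat_val p_prime p_odd U) gamma_natE pfree_fact0 mulr1 tofrac1 divr1.
Qed.

Lemma half_ppow i : exists u : nat, - 2%:R^-1 * (p ^ i)%N%:R = (- u.+1%:Z)%:~R + 2%:R^-1 :> rat.
Proof.
exists (p ^ i)./2; have o : odd (p ^ i) by rewrite oddX p_odd orbT.
rewrite -{1}(odd_double_half (p ^ i)) o -muln2 natrD natrM rmorphN /= -pmulrn.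
by rewrite -(natr1 (p ^ i)./2); lra.
Qed.

Lemma ratr_shift i (x : rat) : x = (num i)%:R / q.-1%:R - 2%:R^-1 + (dl i)%:R ->
  ratr x = orbit_shift p r W a i.
Proof.
move=> ->; have uQ := pred_q_unit p_prime r_gt0 U; have u2 := two_unit p_prime p_odd U.
have pQ := pred_q_ndvd p_prime r_gt0.
have Qn : q.-1%:R != 0 :> rat by rewrite pnatr_eq0 -lt0n.
have p2 : ~~ (p %| 2)%N.
  by apply/negP=> /(dvdn_leq (isT : 0 < 2)%N); rewrite leqNgt odd_prime_gt2.
have pm : ~~ (p %| 2 * q.-1)%N by rewrite Euclid_dvdM // negb_or p2.
pose z : int := (2 * num i)%N%:Z - q.-1%:Z + (2 * q.-1 * dl i)%N%:Z.
have e : ((num i)%:R / q.-1%:R - 2%:R^-1 + (dl i)%:R) * (2 * q.-1)%N%:R = z%:~R :> rat.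
  rewrite /z intrD intrB -!pmulrn !natrM.
  by field; rewrite ?Qn.
have u2Q : (2 * q.-1)%N%:R \is a @GRing.unit W by rewrite natrM unitrM u2.
apply: (mulIr u2Q); rewrite (ratr_mul_den p_prime U pm e) /orbit_shift.
rewrite /z intrD intrB -!pmulrn !natrM.
rewrite -(orbit_fracE p_prime r_gt0 U a i); set y := orbit_frac _ _ _ _ _.
have -> : (y - half + (dl i)%:R) * (2%:R * q.-1%:R) =
    2%:R * (q.-1%:R * y) - (2%:R * half) * q.-1%:R + 2%:R * q.-1%:R * (dl i)%:R by ring.
by rewrite (mul2half p_prime p_odd U) mul1r.
Qed.

(** Adding 1/2 to the fractional part s of a p^i / (q - 1) carries over 1 unless
    s < 1/2, and leaves the fractional part of s - 1/2. *)
Lemma lower_factor_half i :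
  lower_factor 2%:R^-1 a i = (- p%:R) ^ (- ((quo i)%:Z + (~~ dl i)%:Z)) *
    (Gamma (orbit_shift p r W a i) / Gamma half).
Proof.
have [u hu] := half_ppow i; rewrite /lower_factor /= mulrDl shiftE hu.
have h01 : 0 <= (2%:R^-1 : rat) < 1 by [].
have Qn : 0 < q.-1%:R :> rat by rewrite ltr0n.
rewrite (frac_part_unique erefl h01).
have /andP[n0 n1] := frac_num_bounds i.
have cmp : dl i = (((num i)%:R / q.-1%:R : rat) < 2%:R^-1).
  by rewrite /below_half ltr_pdivrMr // mulrC ltr_pdivlMr // -natrM ltr_nat mulnC.
set y := (num i)%:R / _ in n0 n1 cmp *.
pose y' : rat := y - 2%:R^-1 + (dl i)%:R.
have hy' : 0 <= y' < 1.
  rewrite /y'; move: cmp; case: (dl i) => /esym /=.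
    by move=> lt; rewrite mulr1n; apply/andP; split; lra.
  by move/negbT; rewrite -leNgt => le; rewrite mulr0n; apply/andP; split; lra.
have e1 : 2%:R^-1 + ((quo i)%:Z%:~R + y) = ((quo i)%:Z + (~~ dl i)%:Z)%:~R + y'.
  by rewrite /y' intrD; case: (dl i) => /=; lra.
have e2 : (- u.+1%:Z)%:~R + 2%:R^-1 + ((quo i)%:Z%:~R + y) =
    (- u.+1%:Z + ((quo i)%:Z + (~~ dl i)%:Z))%:~R + y'.
  by rewrite -addrA e1 addrA -intrD.
rewrite (floor_unique e1 hy') (frac_part_unique e2 hy') /gamma_rat.
rewrite (ratr_shift (erefl y')); congr (_ * (_ / _)).
have p2 : ~~ (p %| 2)%N.
  by apply/negP=> /(dvdn_leq (isT : 0 < 2)%N); rewrite leqNgt odd_prime_gt2.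
have e3 : 2%:R^-1 * 2%:R = 1%:~R :> rat by [].
have := ratr_mul_den p_prime U p2 e3 => e4.
have -> : ratr 2%:R^-1 = half; last by [].
apply: (mulIr (two_unit p_prime p_odd U)); rewrite e4.
by rewrite mulrC (mul2half p_prime p_odd U).
Qed.

(** The Gross-Koblitz formula turns the factors at the lower parameter 0 into
    those at 1/2. The factor q is distributed as one p for each i, which makes
    p (-p)^(δ - 1) = -(-p)^δ for δ = 0, 1. *)
Lemma jacobi_lower_factors :
  tofrac (jacobi_sum res a) * \prod_(i < r) lower_factor 0 a i =
  - q%:R * \prod_(i < r) lower_factor 2%:R^-1 a i.
Proof.
have gk := congr1 (@tofrac W) (jacobi_gamma p_prime p_odd r_gt0 cardF U a_bound).
rewrite rmorphM rmorphN !rmorph_prod /= in gk.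
have gh : Gamma half != 0.
  by rewrite tofrac_eq0 (padic_gamma_neq0 p_prime p_odd U) //; apply: zp_half p_prime p_odd U.
pose P : {fraction W} := \prod_(i < r) (- p%:R) ^ (- (quo i)%:Z).
pose H : {fraction W} := \prod_(i < r) Gamma half.
have H0 : H != 0 by apply/prodf_neq0.
have e1 : H * \prod_(i < r) lower_factor 0 a i =
    P * \prod_(i < r) tofrac (padic_gamma p half * padic_gamma p (orbit_frac p r W a i)).
  rewrite /H /P -!big_split; apply: eq_bigr => i _ /=.
  by rewrite lower_factor_zero rmorphM; ring.
have e2 : H * (q%:R * \prod_(i < r) lower_factor 2%:R^-1 a i) = P *
    \prod_(i < r) tofrac (- (- p%:R) ^+ dl i * padic_gamma p (orbit_shift p r W a i)).
  have -> : q%:R = \prod_(i < r) p%:R :> {fraction W}.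
    by rewrite prodr_const card_ord natrX.
  rewrite /H /P -!big_split; apply: eq_bigr => i _ /=.
  rewrite lower_factor_half opprD expfzDr ?pfrac_neq0 // rmorphM rmorphN rmorphXn rmorphN rmorph_nat.
  have -> : p%:R * ((- p%:R) ^ (- (quo i)%:Z) * (- p%:R) ^ (- (~~ dl i)%:Z) *
      (Gamma (orbit_shift p r W a i) / Gamma half)) =
    (- p%:R) ^ (- (quo i)%:Z) * (p%:R * (- p%:R) ^ (- (~~ dl i)%:Z)) *
    Gamma (orbit_shift p r W a i) / Gamma half :> {fraction W} by ring.
  have -> : p%:R * (- p%:R) ^ (- (~~ dl i)%:Z) = - (- p%:R) ^+ dl i :> {fraction W}.
    case: (dl i); rewrite /= ?expr1 ?opprK ?expr0.
      by rewrite oppr0 expr0z mulr1.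
    rewrite exprN1 invrN mulrN divff //.
    by have := pfrac_neq0; rewrite oppr_eq0.
  by field.
by apply: (mulfI H0); rewrite mulrCA e1 mulrCA gk mulNr !mulrN e2.
Qed.

End McCarthyFactors.

Section ParameterLists.
Variables (d k : nat).
Hypotheses (k_ge1 : (1 <= k)%N) (k_lt_d : (k < d)%N) (d_odd : odd d) (k_odd : odd k).

Let h0 := (d - k)./2.

Let h0E : (d - k = 2 * h0)%N.
Proof. by have : odd (d - k) = false; [rewrite oddB ?d_odd ?k_odd // ltnW | rewrite /h0; lia]. Qed.

Let h0_gt0 : (0 < h0)%N.
Proof. by move: h0E k_lt_d; clear; lia. Qed.

Let h0_mem : h0 \in iota 1 (d - k).-1.
Proof. by rewrite mem_iota; move: h0E h0_gt0; clear; lia. Qed.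

Lemma size_upper_params : size (upper_params d) = d.-1.
Proof. by rewrite size_map size_iota. Qed.

Lemma size_lower_params_left : size (lower_params_left d k) = d.-1.
Proof. by rewrite size_cat !size_map !size_iota; move: k_ge1 k_lt_d; clear; lia. Qed.

Lemma size_lower_params_right : size (lower_params_right d k) = d.-1.
Proof.
rewrite !size_cat !size_map size_filter size_iota /=.
have := count_predC (pred1 h0) (iota 1 (d - k).-1).
rewrite count_uniq_mem ?iota_uniq // h0_mem size_iota -/h0 => e.
have -> : count (fun h => h != h0) (iota 1 (d - k).-1) = (d - k).-2.
  by rewrite -[in RHS]e add1n.
by move: k_ge1 k_lt_d h0E h0_gt0; clear; lia.
Qed.

(** The entry h = (d - k)/2 of the left list is the parameter 1/2. *)
Lemma lower_params_prod (R : comNzRingType) (g : rat -> R) : exists c,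
  \prod_(y <- lower_params_left d k) g y = c * g 2%:R^-1 /\
  \prod_(y <- lower_params_right d k) g y = c * g 0.
Proof.
have half : h0%:R / (d - k)%N%:R = 2%:R^-1 :> rat.
  have nz : h0%:R != 0 :> rat by rewrite pnatr_eq0 -lt0n.
  by rewrite h0E natrM; field.
exists (\prod_(y <- [seq h%:R / k%:R | h <- iota 0 k]) g y *
  \prod_(h <- iota 1 (d - k).-1 | h != h0) g (h%:R / (d - k)%N%:R)).
rewrite /lower_params_left /lower_params_right; split.
  rewrite big_cat /= -mulrA; congr (_ * _).
  by rewrite big_map (bigD1_seq h0) ?iota_uniq //= half mulrC.
by rewrite !big_cat /= big_seq1 mulrA; congr (_ * _ * _); rewrite big_map big_filter.
Qed.

Lemma params_den p : prime p -> ~~ (p %| d * k * (d - k))%N -> forall x : rat,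
  x \in upper_params d ++ lower_params_left d k ++ lower_params_right d k ->
  exists m : nat, exists2 z : int, ~~ (p %| m)%N & x * m%:R = z%:~R.
Proof.
move=> pr nd x.
have [pd pk pdk] : [/\ ~~ (p %| d)%N, ~~ (p %| k)%N & ~~ (p %| d - k)%N].
  by move: nd; rewrite !Euclid_dvdM // !negb_or => /andP[/andP[]].
have frac m h : ~~ (p %| m)%N -> exists m' : nat, exists2 z : int,
    ~~ (p %| m')%N & (h%:R / m%:R : rat) * m'%:R = z%:~R.
  move=> pm; exists m; exists h%:Z => //; rewrite divfK // pnatr_eq0.
  by apply: contraNneq pm => ->; rewrite dvdn0.
rewrite !mem_cat => /orP[/mapP[h _ ->]|]; first exact: frac.
case/orP=> [/orP[/mapP[h _ ->]|/mapP[h _ ->]]|]; try exact: frac.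
case/or3P=> [/mapP[h _ ->]|/mapP[h _ ->]|]; try exact: frac.
rewrite inE => /eqP ->; exists 1%N; exists 0; last by rewrite mul0r.
by rewrite dvdn1; apply: contraTneq pr => ->.
Qed.

End ParameterLists.

Section CharacterSums.
Variables (p r : nat) (F : finFieldType) (W : idomainType) (res : {rmorphism W -> F}).
Hypothesis p_prime : prime p.
Hypothesis p_odd : odd p.
Hypothesis r_gt0 : (0 < r)%N.
Hypothesis cardF : #|F| = (p ^ r)%N.
Hypothesis U : unramified_integers p res.

Local Notation q := (p ^ r)%N.
Local Notation T := (teichmuller res).

(** The substitution t -> 1/t; t (t - 1) becomes 1 - t up to a square. *)
Lemma sum_quadratic_omegabar a :
  \sum_(t : F) (quadratic_char (t * (t - 1)))%:~R * omegabar res a t = jacobi_sum res a.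
Proof.
rewrite (bigD1 0) //= {1}/omegabar eqxx mulr0 add0r /jacobi_sum.
rewrite (reindex_inj invr_inj) /=; apply: eq_big => [t|t t0]; first by rewrite invr_eq0.
rewrite invr_eq0 in t0; rewrite /omegabar invr_eq0 (negPf t0).
rewrite (teichmullerV p_prime r_gt0 cardF U) // invrK; congr (_%:~R * _).
have -> : t^-1 * (t^-1 - 1) = t^-1 ^+ 2 * (1 - t) by field.
by rewrite quadratic_char_sqM // invr_eq0.
Qed.

Lemma quadratic_char_exp (t : F) : t != 0 ->
  (quadratic_char t)%:~R = T t ^+ (q.-1./2) :> W.
Proof.
move=> t0; have hq := half_predq p_prime p_odd r_gt0.
apply: (root_unity_inj p_prime r_gt0 cardF U).
- rewrite hq mulnC exprM /quadratic_char (negPf t0).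
  by case: ifP => _; rewrite ?expr1n // rmorphN rmorph1 sqrrN !expr1n.
- by rewrite exprAC (teichmuller_exp p_prime r_gt0 cardF U) // expr1n.
- rewrite rmorph_int rmorphXn /= (teichmuller_res p_prime r_gt0 cardF U) //.
  by rewrite quadratic_charE cardF // q_odd.
Qed.

(** The quadratic character has sum 0, and the term at t = 0 that the Jacobi sum
    leaves out is 1. *)
Lemma jacobi_sum0 : jacobi_sum res 0 = -1.
Proof.
have hq := half_predq p_prime p_odd r_gt0; have q2 := q_gt2 p_prime p_odd r_gt0.
have s0 : \sum_(t : F) (quadratic_char t)%:~R = 0 :> W.
  rewrite (bigD1 0) //= {1}/quadratic_char eqxx add0r.
  rewrite (eq_bigr (fun t => T t ^+ q.-1./2)) => [|t t0]; last exact: quadratic_char_exp.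
  rewrite (sum_teichmuller_exp p_prime r_gt0 cardF U) gtnNdvd //.
    by move: hq q2; clear; lia.
  by move: hq q2; clear; lia.
have e : \sum_(t : F) (quadratic_char (1 - t))%:~R = 0 :> W.
  by rewrite -[RHS]s0 [RHS](reindex_inj (inv_inj (subKr 1))).
rewrite /jacobi_sum; apply/eqP; rewrite -addr_eq0; apply/eqP; rewrite -[RHS]e.
rewrite [RHS](bigD1 0) //= subr0 [RHS]addrC; congr (_ + _).
  by apply: eq_bigr => t _; rewrite mulr1.
have -> : quadratic_char (1 : F) = 1; last by [].
rewrite /quadratic_char oner_eq0 ifT //; apply/existsP; exists 1.
by rewrite expr1n.
Qed.

End CharacterSums.

(** * Comparison of the two sides *)

Theorem theorem1p6
    (d k : nat) (k_ge1 : (1 <= k)%N) (k_lt_d : (k < d)%N)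
    (d_odd : odd d) (k_odd : odd k)
    (p : nat) (p_prime : prime p) (p_odd : odd p)
    (p_ndvd : ~~ (p %| d * k * (d - k))%N)
    (r : nat) (r_ge1 : (1 <= r)%N)
    (F : finFieldType) (card_F : #|F| = (p ^ r)%N)
    (W : idomainType) (res : {rmorphism W -> F})
    (W_unram : unramified_integers p res)
    (x : F) (x_neq0 : x != 0) :
  1 + (p ^ r)%N%:R *
      mccarthyG res p r d.-1 (upper_params d) (lower_params_left d k) x
  = - \sum_(t : F) (quadratic_char (t * (t - 1)))%:~R *
        mccarthyG res p r d.-1 (upper_params d) (lower_params_right d k) (x * t)
  :> {fraction W}.
Proof.
set q := (p ^ r)%N.
pose up a : {fraction W} := seq_factor r (upper_factor p r W) (upper_params d) a.
pose low s a : {fraction W} := seq_factor r (lower_factor p r W) s a.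
have q2 : (2 < q)%N := q_gt2 p_prime p_odd r_ge1.
have qpos : (0 < q)%N by rewrite ltnW // ltnW.
have sgn a : (-1) ^+ (a * d.-1) = 1 :> {fraction W}.
  have e : ~~ odd (a * d.-1) by rewrite oddM; case: (d) d_odd => //= n /negPf ->; rewrite andbF.
  by rewrite -signr_odd (negPf e).
pose c0 : {fraction W} := - 1 / (q%:R - 1).
have GE B t : size B = d.-1 -> mccarthyG res p r d.-1 (upper_params d) B t =
    c0 * \sum_(a < q.-1) tofrac (omegabar res a t) * (up a * low B a).
  move=> sB; rewrite /mccarthyG -/q -/c0 big_mkord; congr (_ * _); apply: eq_bigr => a _.
  by rewrite sgn mul1r (prod_mccarthy_factor r W_unram a (size_upper_params d) sB).
set BL := lower_params_left d k; set BR := lower_params_right d k.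
have omegaM a t : omegabar res a (x * t) = omegabar res a x * omegabar res a t.
  rewrite /omegabar mulf_eq0 (negPf x_neq0) /=; case: (eqVneq t 0) => [_|t0]; first by rewrite mulr0.
  rewrite (teichmullerM p_prime r_ge1 card_F W_unram) // invrM.
  - by rewrite exprMn mulrC.
  - exact: (teichmuller_unit p_prime r_ge1 card_F W_unram).
  - exact: (teichmuller_unit p_prime r_ge1 card_F W_unram).
have RE : \sum_(t : F) (quadratic_char (t * (t - 1)))%:~R *
      mccarthyG res p r d.-1 (upper_params d) BR (x * t) =
    c0 * \sum_(a < q.-1) tofrac (omegabar res a x) *
      (tofrac (jacobi_sum res a) * (up a * low BR a)).
  transitivity (\sum_(t : F) \sum_(a < q.-1) c0 * (tofrac (omegabar res a x) *
      (tofrac ((quadratic_char (t * (t - 1)))%:~R * omegabar res a t) * (up a * low BR a)))).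
    apply: eq_bigr => t _; rewrite GE ?(size_lower_params_right k_ge1 k_lt_d d_odd k_odd) //.
    rewrite mulrCA !mulr_sumr; apply: eq_bigr => a _; congr (_ * _).
    by rewrite omegaM !tofracM -(rmorph_int (@tofrac W)); ring.
  rewrite exchange_big mulr_sumr; apply: eq_bigr => a _; rewrite -mulr_sumr; congr (_ * _).
  rewrite -mulr_sumr -mulr_suml; congr (_ * (_ * _)).
  by rewrite -rmorph_sum (sum_quadratic_omegabar p_prime r_ge1 card_F W_unram).
have prm := params_den p_prime p_ndvd.
have good s : (forall y, y \in s -> y \in upper_params d ++ BL ++ BR) ->
    seq_factor r (upper_factor p r W) s 0 = 1 /\ low s 0%N = 1.
  by move=> hs; apply: (seq_factor0 r p_prime p_odd W_unram) => y /hs /prm.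
have up0 : up 0%N = 1.
  by have [] := good (upper_params d); first by move=> y; rewrite mem_cat => ->.
have lowL0 : low BL 0%N = 1.
  by have [] := good BL; first by move=> y hy; rewrite mem_cat (mem_cat y BL) hy orbT.
have lowR0 : low BR 0%N = 1.
  by have [] := good BR; first by move=> y hy; rewrite mem_cat (mem_cat y BL) hy !orbT.
have coef (a : nat) : (0 < a < q.-1)%N ->
    tofrac (jacobi_sum res a) * (up a * low BR a) = - q%:R * (up a * low BL a).
  move=> ha; have [c [eL eR]] := lower_params_prod k_ge1 k_lt_d d_odd k_odd
    (fun y => \prod_(i < r) lower_factor p r W y a i).
  rewrite /low /seq_factor eL eR.
  have := jacobi_lower_factors p_prime p_odd r_ge1 card_F W_unram ha.
  set A := \prod_(i < r) lower_factor p r W 0 a i; set B := \prod_(i < r) _ => e.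
  by rewrite mulrCA [_ * (c * A)]mulrCA e; ring.
have eQ : q.-1 = q.-2.+1 by rewrite prednK // -subn1 subn_gt0 (ltnW q2).
rewrite RE GE ?(size_lower_params_left k_ge1 k_lt_d) // eQ !big_ord_recl /=.
rewrite up0 lowL0 lowR0 (jacobi_sum0 p_prime p_odd r_ge1 card_F W_unram).
have om0 : omegabar res 0 x = 1 by rewrite /omegabar (negPf x_neq0) expr0.
rewrite om0; set SL := \sum_(i < _) _; set SR := \sum_(i < _) _.
have -> : SR = - q%:R * SL.
  rewrite /SR /SL mulr_sumr; apply: eq_bigr => i _; rewrite /bump leq0n add1n.
  rewrite coef; first by ring.
  by have := ltn_ord i; rewrite -ltnS -eQ.
(* What is left of the terms at a = 0 is 1 - q / (q - 1) = - 1 / (q - 1). *)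
have q1 : q%:R - 1 != 0 :> {fraction W}.
  rewrite -(prednK qpos) -natr1 addrK -(rmorph_nat (@tofrac W)) tofrac_eq0.
  by rewrite (natW_neq0 p_prime W_unram) // eQ.
rewrite !rmorphN !rmorph1 /c0; field.
exact: q1.
Qed.
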